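(* Let $u\in\mathrm{BMOA}(\mathbb{T})$, let $G_u$ be the linear Hankel operator $G_uf=P(u\cdot Jf)$ on $\mathcal{H}^2$, and let $s>0$ be a singular value of $G_u$. Then there exist an inner function $\theta$ and an isometric multiplier $p$ on the model space $K_\theta$ such that $$\mathrm{Ker}(G_u^*G_u-s^2I)=\mathbf{C}(pK_\theta),\qquad \mathrm{Ker}(G_uG_u^*-s^2I)=pK_\theta ,$$ and the action $G_u:\mathrm{Ker}(G_u^*G_u-s^2I)\to\mathrm{Ker}(G_uG_u^*-s^2I)$ is given by $$G_u\mathbf{C}(pf)=s\,p\,\overline{z}\,\theta\,\overline{f},\qquad f\in K_\theta .$$
   Context: $\mathbb{D}$ is the open unit disk and $\mathbb{T}$ the unit circle; $\mathcal{H}^2\subset L^2(\mathbb{T})$ is the standard Hardy space of the unit disk (functions in $\mathcal{H}^2$ are identified with their analytic extensions to $\mathbb{D}$), and $P$ is the orthogonal projection of $L^2(\mathbb{T})$ onto $\mathcal{H}^2$. $\mathrm{BMOA}(\mathbb{T})$ is the space of functions in $\mathcal{H}^2$ of bounded mean oscillation on $\mathbb{T}$. $J$ is the linear involution in $L^2(\mathbb{T})$ given by $Jf(z)=f(\overline{z})$, $z\in\mathbb{T}$, and $\mathbf{C}$ is the anti-linear involution in $\mathcal{H}^2$ given by $\mathbf{C}f(z)=\overline{f(\overline{z})}$, $z\in\mathbb{T}$. For $u\in\mathrm{BMOA}(\mathbb{T})$, $G_uf=P(u\cdot Jf)$ is a bounded linear operator on $\mathcal{H}^2$ (defined e.g.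 on polynomials and extended by continuity). A number $s>0$ is called a singular value of $G_u$ if $\mathrm{Ker}(G_u^*G_u-s^2I)\neq\{0\}$. An inner function $\theta$ is a bounded analytic function on $\mathbb{D}$ with $|\theta|=1$ a.e. on $\mathbb{T}$. The model space is $K_\theta=\mathcal{H}^2\cap(\theta\mathcal{H}^2)^\perp$. For $f\in K_\theta$ the function $\overline{z}\theta\overline{f}$ (on $\mathbb{T}$) also belongs to $K_\theta$. An analytic function $p$ on $\mathbb{D}$ is an isometric multiplier on $K_\theta$ if for every $f\in K_\theta$ one has $pf\in\mathcal{H}^2$ and $\|pf\|=\|f\|$; then $pK_\theta:=\{pf: f\in K_\theta\}$. The expression $p\overline{z}\theta\overline{f}$ denotes the product of $p$ with the element $\overline{z}\theta\overline{f}\in K_\theta$. *)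

(* Defs.v *)
From HB Require Import structures.
From mathcomp Require Import all_boot all_order all_algebra.
From mathcomp Require Import complex.
From mathcomp Require Import all_classical all_reals all_analysis.
Set Implicit Arguments.
Unset Strict Implicit.
Unset Printing Implicit Defensive.
Import Order.TTheory GRing.Theory Num.Theory.
Import numFieldNormedType.Exports.
Local Open Scope classical_set_scope.
Local Open Scope ring_scope.

(* An element of L^2(T) is represented by a function
   f : R[i] -> R[i], of which only the values on the unit circle matter; these
   are read through the parametrization t |-> e^{it}.  Equality in L^2(T) is
   [aeT].  An element of the Hardy space is represented by its boundary
   function, and [ext] is its analytic extension to the disk. *)

Section Circle.
Context {R : realType}.
Local Notation C := R[i].
Local Notation mu := (@lebesgue_measure R).

Definition expi (t : R) : C := (cos t +i* sin t)%C.

Definition aeT (f g : C -> C) : Prop :=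
  {ae mu, forall t : R, f (expi t) = g (expi t)}.

(* Mean value over the arc {e^{it} : a <= t <= b}. *)
Definition arc_mean (a b : R) (f : C -> C) : C :=
  Complex ((b - a)^-1 * \int[mu]_(t in `[a, b]) complex.Re (f (expi t)))
          ((b - a)^-1 * \int[mu]_(t in `[a, b]) complex.Im (f (expi t))).

(* Integral with respect to the normalized Lebesgue measure on T. *)
Definition intT (f : C -> C) : C := arc_mean (- pi) pi f.

Definition L2 (f : C -> C) : Prop :=
  [/\ measurable_fun [set: R] (fun t => complex.Re (f (expi t))),
      measurable_fun [set: R] (fun t => complex.Im (f (expi t))) &
      mu.-integrable `[- pi, pi]
        (fun t => (Normc.normc (f (expi t)) ^+ 2)%:E)].

Definition dotT (f g : C -> C) : C := intT (fun z => f z * (g z)^*%C).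

Definition normT (f : C -> C) : R := Num.sqrt (complex.Re (dotT f f)).

Definition fourier (f : C -> C) (n : int) : C := intT (fun z => f z * z ^ (- n)).

Definition H2 : set (C -> C) :=
  [set f | L2 f /\ forall n : int, n < 0 -> fourier f n = 0].

(* The sum of \hat f(n) z^n over n >= 0; C^o is C with its usual topology. *)
Definition ext (f : C -> C) (z : C) : C :=
  lim (series (fun n : nat => fourier f n * z ^+ n : C^o) @ \oo).

(* Every arc is {e^{it} : a <= t <= b} for some a < b <= a + 2 pi. *)
Definition bounded_mean_oscillation (f : C -> C) : Prop :=
  exists M : R, forall a b : R, a < b -> b <= a + 2 * pi ->
    (b - a)^-1 * \int[mu]_(t in `[a, b])
       Normc.normc (f (expi t) - arc_mean a b f) <= M.

Definition BMOA : set (C -> C) :=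
  [set f | H2 f /\ bounded_mean_oscillation f].

(* Operators on H^2 are functions on representatives, considered modulo aeT;
   their values outside H2 are irrelevant. *)
Definition operator := (C -> C) -> (C -> C).

Definition bounded_operator (G : operator) : Prop :=
  [/\ forall f, H2 f -> H2 (G f),
      forall (a : C) f g, H2 f -> H2 g ->
        aeT (G (fun z => a * f z + g z)) (fun z => a * G f z + G g z) &
      exists M : R, forall f, H2 f -> normT (G f) <= M * normT f].

(* Objects determined only modulo aeT by a property are picked with [xget];
   the default value is junk, used only when no such object exists.  (For the
   hankel operator of a symbol in BMOA, for adjoints of bounded operators and
   for projections of functions in L2, one does exist.) *)
Definition projH2 (f : C -> C) : C -> C :=
  xget (fun=> 0) [set g | H2 g /\
    forall h, H2 h -> dotT (fun z => f z - g z) h = 0].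

Definition adjoint (G : operator) : operator := fun g =>
  xget (fun=> 0) [set h | H2 h /\ forall f, H2 f -> dotT (G f) g = dotT f h].

Definition invJ (f : C -> C) : C -> C := fun z => f z^*%C.

Definition invC (f : C -> C) : C -> C := fun z => (f z^*%C)^*%C.

(* The continuous extension to H^2 of q |-> P(u . Jq), q a polynomial. *)
Definition hankel (u : C -> C) : operator :=
  xget (fun _ _ => 0) [set G | bounded_operator G /\
    forall q : {poly C},
      aeT (G (horner q)) (projH2 (fun z => u z * invJ (horner q) z))].

(* Ker (A - c I) *)
Definition eigenker (A : operator) (c : C) : set (C -> C) :=
  [set f | H2 f /\ aeT (A f) (fun z => c * f z)].

Definition singular_value (G : operator) (s : R) : Prop :=
  0 < s /\ exists2 f, eigenker (adjoint G \o G) ((s ^+ 2)%:C)%C f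
                    & ~ aeT f (fun=> 0).

Definition inner (theta : C -> C) : Prop :=
  [/\ H2 theta,
      exists M : R, forall z : C, `|z| < 1 ->
        Normc.normc (ext theta z) <= M &
      {ae mu, forall t : R, Normc.normc (theta (expi t)) = 1}].

Definition model_space (theta : C -> C) : set (C -> C) :=
  [set f | H2 f /\ forall h, H2 h -> dotT f (fun z => theta z * h z) = 0].

(* On K_theta, f |-> \bar z theta \bar f. *)
Definition conj_theta (theta f : C -> C) : C -> C :=
  fun z => z^*%C * theta z * (f z)^*%C.

Definition analytic (p : C -> C) : Prop :=
  forall z : C, `|z| < 1 -> derivable (p : C^o -> C^o) z 1.

(* pf = g, the product being taken on the disk, with pf in H^2. *)
Definition is_product (p f g : C -> C) : Prop :=
  H2 g /\ forall z : C, `|z| < 1 -> ext g z = p z * ext f z.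

Definition mul_space (p : C -> C) (K : set (C -> C)) : set (C -> C) :=
  [set g | exists2 f, K f & is_product p f g].

Definition isometric_multiplier (p : C -> C) (K : set (C -> C)) : Prop :=
  analytic p /\
  forall f, K f -> exists2 g, is_product p f g & normT g = normT f.

End Circle.

(* Main.v *)
Require Import Defs.
From HB Require Import structures.
From mathcomp Require Import all_boot all_order all_algebra.
From mathcomp Require Import complex ring lra.
From mathcomp Require Import all_classical all_reals all_analysis.
From mathcomp Require Import measurable_realfun.
Set Implicit Arguments.
Unset Strict Implicit.
Unset Printing Implicit Defensive.
Import Order.TTheory GRing.Theory Num.Theory.
Import numFieldNormedType.Exports.
Import ComplexField.Normc.
Local Open Scope classical_set_scope.
Local Open Scope ring_scope.

(** Let [S] be the shift on the Hardy space, [C] the conjugation [invC], and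
    [H f = G_u (C f)], that is [H f = P (u conj f)]. The operator [H] is antilinear, satisfies
    [<H f, g> = <H g, f>] and [H S = S^* H], and one has [G_u G_u^* = H^2] and
    [G_u^* G_u = C H^2 C]. Everything therefore concerns the space [E = Ker (H^2 - s^2)], on which
    [J = H / s] is an antiunitary involution.

    Near invariance. Let [m] be the least index at which some element of [E] has a nonzero
    coefficient, and let [p] be the unit vector of [E] proportional to the projection of [z^m].
    An element [f] of [E] is orthogonal to [p] exactly when its coefficient of index [m]
    vanishes, and then [S^* f] lies in [E] ([near_invariant]). Conjugating by [J], every [h] in [E]
    orthogonal to [q = J p] satisfies [S h] in [E] ([E_shift]).

    Division. Hence [f = <f,p> p + S f1] with [f1] in [E] and
    [|f|^2 = |<f,p>|^2 + |f1|^2]. Iterating, the successive coefficients [<f_n,p>] are those of a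
    Hardy function [quot f] with [|quot f| <= |f|], and [f = p quot f] on the circle
    ([quot_mul]).

    The inner function. Comparing Fourier coefficients, [J f conj (J g) = g conj f] almost
    everywhere ([J_mulJ]). With [f = g = p] this gives [|q| = |p|]; as a nonzero Hardy function
    vanishes almost nowhere ([nonvanishing]), [quot q] is unimodular, and [theta = z quot q] is
    inner. With [g = p] it gives [quot (J f) = conj z theta conj (quot f)], which is at once the
    formula for the action of [G_u] and the reason why [quot f] belongs to [K_theta].

    Isometry. The adjoint of the division step on [E] is [V g = S (g - <g,q> q)]. The vectors
    [V^n p] represent the coefficients of [quot f], and their quotients represent those of the
    elements of [K_theta]. So for [k] in [K_theta] the series [sum_n k_n V^n p] converges in [E] to
    some [f] with [quot f = k] and [|f| = |k|] ([quot_onto]), and [p] is an isometric multiplier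
    of [K_theta] onto [E].

    The analysis behind this consists of the uniqueness theorem for Fourier coefficients of
    integrable functions ([fourier_inj]), the completeness of the space of square integrable
    functions ([L2_complete]), and the compatibility of products on the circle with products on the
    disk ([is_productP]), which is obtained by dividing [f - f(w)] by [z - w] in the Hardy
    space. *)

(** * Complex numbers *)
Section ComplexAux.
Context {R : realType}.
Implicit Types z w : R[i].

Lemma normc_ge0 z : 0 <= normc z.
Proof. by case: z => a b; exact: sqrtr_ge0. Qed.

Lemma sqr_normcE z : normc z ^+ 2 = complex.Re z ^+ 2 + complex.Im z ^+ 2.
Proof. by case: z => a b /=; rewrite sqr_sqrtr// addr_ge0// sqr_ge0. Qed.

Lemma Re_mulJ z : complex.Re (z * z^*%C) = normc z ^+ 2.
Proof. by rewrite sqr_normcE; case: z => a b /=; ring. Qed.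

Lemma mulJ_normc z : z * z^*%C = (normc z ^+ 2)%:C%C.
Proof.
by rewrite sqr_normcE; case: z => a b; apply/eqP; rewrite eq_complex /=;
  apply/andP; split; apply/eqP; ring.
Qed.

Lemma normcJ z : normc z^*%C = normc z.
Proof. by case: z => a b /=; rewrite sqrrN. Qed.

Lemma ler_Re_normc z : complex.Re z <= normc z.
Proof.
case: z => a b /=; apply: (le_trans (ler_norm a)).
by rewrite -sqrtr_sqr ler_sqrt ?addr_ge0 ?sqr_ge0// lerDl sqr_ge0.
Qed.

Lemma ler_normRe_normc z : `|complex.Re z| <= normc z.
Proof.
by case: z => a b /=; rewrite -sqrtr_sqr ler_sqrt ?addr_ge0 ?sqr_ge0// lerDl sqr_ge0.
Qed.

Lemma ler_normIm_normc z : `|complex.Im z| <= normc z.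
Proof.
by case: z => a b /=; rewrite -sqrtr_sqr ler_sqrt ?addr_ge0 ?sqr_ge0// lerDr sqr_ge0.
Qed.

Lemma normc_le_ReIm z : normc z <= `|complex.Re z| + `|complex.Im z|.
Proof.
rewrite -(@ler_pXn2r _ 2)// ?nnegrE ?normc_ge0 ?addr_ge0//.
rewrite sqr_normcE sqrrD !real_normK ?num_real//.
by rewrite -subr_ge0; have := mulr_ge0 (normr_ge0 (complex.Re z)) (normr_ge0 (complex.Im z)); lra.
Qed.

Lemma normcR (r : R) : normc r%:C%C = `|r|.
Proof. by rewrite /= expr0n /= addr0 sqrtr_sqr. Qed.

Lemma normcX z n : normc (z ^+ n) = normc z ^+ n.
Proof. by elim: n => [|n IH]; rewrite ?expr0 ?normc1// !exprS normcM IH. Qed.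

Lemma normc_gt0 z : (0 < normc z) = (z != 0).
Proof.
rewrite lt_def normc_ge0 andbT; congr (~~ _).
by apply/eqP/eqP => [/eq0_normc//|->]; rewrite normc0.
Qed.

Lemma normcE z : `|z| = (normc z)%:C%C. Proof. by case: z. Qed.

Lemma ReD z w : complex.Re (z + w) = complex.Re z + complex.Re w.
Proof. by case: z; case: w. Qed.

Lemma ImD z w : complex.Im (z + w) = complex.Im z + complex.Im w.
Proof. by case: z; case: w. Qed.

Lemma ReN z : complex.Re (- z) = - complex.Re z.
Proof. by case: z. Qed.

Lemma ReJ z : complex.Re z^*%C = complex.Re z.
Proof. by case: z. Qed.

Lemma Re_sum n (F : nat -> R[i]) :
  complex.Re (\sum_(k < n) F k) = \sum_(k < n) complex.Re (F k).
Proof. by elim: n => [|n IH]; rewrite ?big_ord0// !big_ord_recr/= ReD IH. Qed.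

Lemma eq_of_normc_le (a b : R[i]) (u : R^nat) :
  u @ \oo --> 0 -> (forall n, normc (a - b) <= u n) -> a = b.
Proof.
move=> u0 h; apply/eqP; rewrite -subr_eq0; apply/eqP/eq0_normc/eqP.
rewrite eq_le normc_ge0 andbT.
rewrite -(cvg_lim _ u0)//; apply: limr_ge; last exact: nearW.
by apply/cvg_ex; exists 0.
Qed.

End ComplexAux.

(** * Inner product spaces *)
(** Functions count up to almost everywhere equality, and only some functions or
    sequences are square summable: so the inner product is specified on a subset [D]
    of [V], and definiteness is not part of the axioms. *)
Record prehilbert {R : realType} (V : lmodType R[i]) (D : V -> Prop)
    (dot : V -> V -> R[i]) : Prop := PreHilbert {
  ph0 : D 0;
  phD : forall x y, D x -> D y -> D (x + y);
  phZ : forall a x, D x -> D (a *: x);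
  ph_dotDl : forall x y z, D x -> D y -> D z -> dot (x + y) z = dot x z + dot y z;
  ph_dotZl : forall a x y, D x -> D y -> dot (a *: x) y = a * dot x y;
  ph_dotC : forall x y, D x -> D y -> dot y x = (dot x y)^*%C;
  ph_dot_ge0 : forall x, D x -> 0 <= complex.Re (dot x x)
}.

Section PreHilbertTheory.
Context {R : realType} {V : lmodType R[i]} {D : V -> Prop} {dot : V -> V -> R[i]}.
Hypothesis ph : prehilbert D dot.
Implicit Types x y z : V.

Definition sqn x : R := complex.Re (dot x x).
Definition nrm x : R := Num.sqrt (sqn x).

Lemma D0 : D 0. Proof. exact: ph0 ph. Qed.
Lemma DD x y : D x -> D y -> D (x + y). Proof. exact: (phD ph). Qed.
Lemma DZ a x : D x -> D (a *: x). Proof. exact: (phZ ph). Qed.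
Lemma DN x : D x -> D (- x). Proof. by rewrite -scaleN1r; apply: DZ. Qed.
Lemma DB x y : D x -> D y -> D (x - y).
Proof. by move=> Dx Dy; apply: DD => //; exact: DN. Qed.
Lemma Dsum n (F : nat -> V) :
  (forall k, (k < n)%N -> D (F k)) -> D (\sum_(k < n) F k).
Proof.
move=> DF; apply: (big_ind D) => //; [exact: D0|exact: DD|].
by move=> k _; exact: DF.
Qed.
Hint Resolve D0 : core.

Lemma dotDl x y z : D x -> D y -> D z -> dot (x + y) z = dot x z + dot y z.
Proof. exact: (ph_dotDl ph). Qed.
Lemma dotZl a x y : D x -> D y -> dot (a *: x) y = a * dot x y.
Proof. exact: (ph_dotZl ph). Qed.
Lemma dotC x y : D x -> D y -> dot y x = (dot x y)^*%C.
Proof. exact: (ph_dotC ph). Qed.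
Lemma dotDr x y z : D x -> D y -> D z -> dot z (x + y) = dot z x + dot z y.
Proof.
by move=> Dx Dy Dz; rewrite dotC ?dotDl ?rmorphD/= -?dotC//; exact: DD.
Qed.
Lemma dotZr a x y : D x -> D y -> dot y (a *: x) = a^*%C * dot y x.
Proof.
by move=> Dx Dy; rewrite dotC ?dotZl ?rmorphM/= -?dotC//; exact: DZ.
Qed.
Lemma dotNl x y : D x -> D y -> dot (- x) y = - dot x y.
Proof. by move=> Dx Dy; rewrite -scaleN1r dotZl// mulN1r. Qed.
Lemma dotNr x y : D x -> D y -> dot y (- x) = - dot y x.
Proof. by move=> Dx Dy; rewrite -scaleN1r dotZr// rmorphN1 mulN1r. Qed.
Lemma dotBl x y z : D x -> D y -> D z -> dot (x - y) z = dot x z - dot y z.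
Proof. by move=> Dx Dy Dz; rewrite dotDl ?dotNl//; exact: DN. Qed.
Lemma dotBr x y z : D x -> D y -> D z -> dot z (x - y) = dot z x - dot z y.
Proof. by move=> Dx Dy Dz; rewrite dotDr ?dotNr//; exact: DN. Qed.
Lemma dot0l x : D x -> dot 0 x = 0.
Proof. by move=> Dx; rewrite -(scale0r x) dotZl// mul0r. Qed.
Lemma dot0r x : D x -> dot x 0 = 0.
Proof. by move=> Dx; rewrite dotC// dot0l// rmorph0. Qed.
Lemma dot_suml n (F : nat -> V) x : (forall k, (k < n)%N -> D (F k)) -> D x ->
  dot (\sum_(k < n) F k) x = \sum_(k < n) dot (F k) x.
Proof.
elim: n => [|n IH] DF Dx; first by rewrite !big_ord0 dot0l.
have DF' k : (k < n)%N -> D (F k) by move=> kn; apply: DF; apply: ltnW.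
by rewrite !big_ord_recr/= dotDl ?IH//; [exact: Dsum|exact: DF].
Qed.
Lemma dot_sumr n (F : nat -> V) x : (forall k, (k < n)%N -> D (F k)) -> D x ->
  dot x (\sum_(k < n) F k) = \sum_(k < n) dot x (F k).
Proof.
elim: n => [|n IH] DF Dx; first by rewrite !big_ord0 dot0r.
have DF' k : (k < n)%N -> D (F k) by move=> kn; apply: DF; apply: ltnW.
by rewrite !big_ord_recr/= dotDr ?IH//; [exact: Dsum|exact: DF].
Qed.

Lemma sqn_ge0 x : D x -> 0 <= sqn x. Proof. exact: (ph_dot_ge0 ph). Qed.

Lemma dotxx x : D x -> dot x x = (sqn x)%:C%C.
Proof.
move=> Dx; have := dotC Dx Dx; rewrite /sqn.
by case: (dot x x) => a b [] /= /eqP; rewrite -subr_eq0 opprK -mulr2n mulrn_eq0/=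
  => /eqP ->.
Qed.

Lemma sqnD x y : D x -> D y ->
  sqn (x + y) = sqn x + sqn y + 2 * complex.Re (dot x y).
Proof.
move=> Dx Dy; have Dxy := DD Dx Dy.
rewrite /sqn dotDl// !dotDr// (dotC Dx Dy) !ReD ReJ; ring.
Qed.

Lemma sqnZ a x : D x -> sqn (a *: x) = normc a ^+ 2 * sqn x.
Proof.
move=> Dx; rewrite /sqn dotZl ?dotZr//; last exact: DZ.
by rewrite mulrA mulJ_normc dotxx// -rmorphM.
Qed.

Lemma sqnN x : D x -> sqn (- x) = sqn x.
Proof. by move=> Dx; rewrite -scaleN1r sqnZ// normcN normc1 expr1n mul1r. Qed.

Lemma sqnB x y : D x -> D y ->
  sqn (x - y) = sqn x + sqn y - 2 * complex.Re (dot x y).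
Proof.
by move=> Dx Dy; rewrite sqnD ?sqnN ?dotNr ?ReN//; [ring|exact: DN].
Qed.

Lemma sqnD_orth x y : D x -> D y -> dot x y = 0 -> sqn (x + y) = sqn x + sqn y.
Proof. by move=> Dx Dy xy0; rewrite sqnD// xy0/= mulr0 addr0. Qed.

Lemma parallelogram x y : D x -> D y ->
  sqn (x + y) + sqn (x - y) = 2 * sqn x + 2 * sqn y.
Proof. by move=> Dx Dy; rewrite sqnD// sqnB//; ring. Qed.

Lemma nrm_ge0 x : 0 <= nrm x. Proof. exact: sqrtr_ge0. Qed.
Lemma sqr_nrm x : D x -> nrm x ^+ 2 = sqn x.
Proof. by move=> Dx; rewrite sqr_sqrtr// sqn_ge0. Qed.
Lemma nrm0 : nrm 0 = 0. Proof. by rewrite /nrm /sqn dot0l// sqrtr0. Qed.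

Lemma nrmZ a x : D x -> nrm (a *: x) = normc a * nrm x.
Proof.
move=> Dx; rewrite /nrm sqnZ// sqrtrM ?sqr_ge0// sqrtr_sqr ger0_norm//.
exact: normc_ge0.
Qed.
Lemma nrmN x : D x -> nrm (- x) = nrm x. Proof. by move=> Dx; rewrite /nrm sqnN. Qed.
Lemma nrmBC x y : D x -> D y -> nrm (x - y) = nrm (y - x).
Proof. by move=> Dx Dy; rewrite -nrmN ?opprB//; exact: DB. Qed.

(** The quadratic [t |-> sqn (x - t <x,y> y)] is nonnegative; it is evaluated at its
    minimum [1 / sqn y], or at a large [t] when [sqn y = 0]. *)
Lemma cauchy_schwarz x y : D x -> D y -> normc (dot x y) <= nrm x * nrm y.
Proof.
move=> Dx Dy; set c := dot x y.
have key (t : R) : 0 <= sqn x - 2 * t * normc c ^+ 2 + t ^+ 2 * normc c ^+ 2 * sqn y.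
  have := sqn_ge0 (DB Dx (DZ (t%:C%C * c) Dy)).
  rewrite sqnB ?sqnZ ?dotZr//; last exact: DZ.
  rewrite -/c normcM normcR exprMn real_normK ?num_real// rmorphM.
  rewrite [X in X * _ * c]conjc_real -mulrA [c^*%C * c]mulrC mulJ_normc -rmorphM/=.
  by set u := normc c ^+ 2 => h; apply: (le_trans h); rewrite le_eqVlt; apply/orP; left;
    apply/eqP; ring.
have h : normc c ^+ 2 * normc c ^+ 2 <= normc c ^+ 2 * (sqn x * sqn y).
  have [y0|y0] := eqVneq (sqn y) 0.
    have [c0|c0] := eqVneq (normc c) 0; first by rewrite c0 !expr0n /= !mul0r.
    have := key ((sqn x + 1) / normc c ^+ 2).
    rewrite y0 mulr0 addr0 -mulrA divfK ?expf_neq0// => h.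
    by have := sqn_ge0 Dx; lra.
  have ygt0 : 0 < sqn y by rewrite lt_def y0 sqn_ge0.
  have := key ((sqn y)^-1); rewrite -(pmulr_rge0 _ ygt0).
  set u := normc c ^+ 2.
  have -> : sqn y * (sqn x - 2 / sqn y * u + (sqn y)^-1 ^+ 2 * u * sqn y)
    = sqn x * sqn y - u by field.
  by move=> h; rewrite ler_wpM2l ?sqr_ge0//; lra.
rewrite -(@ler_pXn2r _ 2) ?nnegrE ?normc_ge0 ?mulr_ge0 ?nrm_ge0//.
rewrite exprMn !sqr_nrm//.
have [c0|c0] := eqVneq (normc c) 0.
  by rewrite c0 expr0n /= mulr_ge0 ?sqn_ge0.
by rewrite -(@ler_pM2l _ (normc c ^+ 2))// exprn_gt0// lt_def c0 normc_ge0.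
Qed.

Lemma nrmD x y : D x -> D y -> nrm (x + y) <= nrm x + nrm y.
Proof.
move=> Dx Dy; rewrite -(@ler_pXn2r _ 2) ?nnegrE ?addr_ge0 ?nrm_ge0//.
rewrite sqr_nrm ?sqnD//; last exact: DD.
rewrite sqrrD !sqr_nrm//.
have := le_trans (ler_Re_normc _) (cauchy_schwarz Dx Dy); lra.
Qed.

Lemma nrm_dist x y z : D x -> D y -> D z -> nrm (x - z) <= nrm (x - y) + nrm (y - z).
Proof.
move=> Dx Dy Dz; have -> : x - z = (x - y) + (y - z) by rewrite addrA subrK.
by apply: nrmD; exact: DB.
Qed.

Lemma nrm_le x y : D x -> D y -> nrm x <= nrm (x - y) + nrm y.
Proof. by move=> Dx Dy; rewrite -{1}(subrK y x); apply: nrmD => //; exact: DB. Qed.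

(** [V] carries no topology attached to [dot], so limits go through real norms. *)
Definition tends (u : nat -> V) (l : V) := (fun n => nrm (u n - l)) @ \oo --> 0.
Definition cauchy_nrm (u : nat -> V) := forall e : R, 0 < e ->
  exists N, forall m n, (N <= m)%N -> (N <= n)%N -> nrm (u m - u n) < e.

Lemma tends_dot u l x : (forall n, D (u n)) -> D l -> D x -> tends u l ->
  forall (a : nat -> R[i]) (b : R[i]), (forall n, dot (u n) x = a n) ->
  (fun n => normc (a n - b)) @ \oo --> 0 -> dot l x = b.
Proof.
move=> Du Dl Dx ul a b ua ab.
apply: (@eq_of_normc_le _ _ _ (fun n => nrm (u n - l) * nrm x + normc (a n - b))).
  rewrite -[X in _ --> X](addr0 0) -{1}(mul0r (nrm x)).
  by apply: cvgD => //; apply: cvgMr_tmp.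
move=> n; have -> : dot l x - b = - dot (u n - l) x + (a n - b).
  by rewrite dotBl// ua; ring.
apply: (le_trans (le_normcD _ _)); apply: lerD => //; rewrite normcN.
by apply: cauchy_schwarz => //; exact: DB.
Qed.

Lemma tends_dot_cst u l x b : (forall n, D (u n)) -> D l -> D x -> tends u l ->
  (\forall n \near \oo, dot (u n) x = b) -> dot l x = b.
Proof.
move=> Du Dl Dx ul ub; apply: (tends_dot Du Dl Dx ul (fun n => erefl)).
apply: cvg_near_cst; near=> n.
by rewrite (near ub n)// subrr normc0.
Unshelve. all: by end_near. Qed.

Lemma tends_nrm_le u l (M : R) : (forall n, D (u n)) -> D l -> tends u l ->
  (forall n, nrm (u n) <= M) -> nrm l <= M.
Proof.
move=> Du Dl ul uM; rewrite -[M]add0r.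
suff : 0 + M >= nrm l by [].
have c : (fun n => nrm (u n - l) + M) @ \oo --> 0 + M by apply: cvgD => //; exact: cvg_cst.
rewrite -(cvg_lim _ c)//; apply: limr_ge; first by apply/cvg_ex; exists (0 + M).
apply: nearW => n; apply: (le_trans (nrm_le Dl (Du n))).
by rewrite nrmBC//; apply: lerD.
Qed.

Lemma tends_cauchy u l : (forall n, D (u n)) -> D l -> tends u l -> cauchy_nrm u.
Proof.
move=> Du Dl ul e e0.
have e20 : 0 < e / 2 by rewrite divr_gt0.
have [N _ h] := (cvgrPdist_lt _ _).1 ul _ e20; exists N => m n Nm Nn.
have hk k : (N <= k)%N -> nrm (u k - l) < e / 2.
  by move=> Nk; have := h _ Nk; rewrite sub0r normrN ger0_norm ?nrm_ge0.
apply: (le_lt_trans (nrm_dist (Du m) Dl (Du n))).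
by rewrite (nrmBC Dl)//; have := hk _ Nm; have := hk _ Nn; lra.
Qed.

End PreHilbertTheory.

(** * Orthogonal projections and orthonormal series *)
Section Hilbert.
Context {R : realType} {V : lmodType R[i]} {D : V -> Prop} {dot : V -> V -> R[i]}.
Hypothesis ph : prehilbert D dot.
Local Notation nrm := (@nrm R V dot).
Local Notation sqn := (@sqn R V dot).
Local Notation tends := (@tends R V dot).

Definition complete_nrm := forall u : nat -> V, (forall n, D (u n)) ->
  cauchy_nrm (dot := dot) u -> exists2 l, D l & tends u l.
Hypothesis complete : complete_nrm.

Lemma lt_nrm_sqn x (e : R) : D x -> 0 <= e -> (nrm x < e) = (sqn x < e ^+ 2).
Proof.
by move=> Dx e0; rewrite -(sqr_nrm ph Dx) ltr_pXn2r// nnegrE nrm_ge0.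
Qed.

Lemma cauchy_geometric (u : nat -> V) (B q : R) : (forall n, D (u n)) ->
  0 <= q < 1 -> (forall n, nrm (u n.+1 - u n) <= B * q ^+ n) -> cauchy_nrm (dot := dot) u.
Proof.
move=> hu /andP[q0 q1] uB.
have B0 : 0 <= B by have := uB 0%N; rewrite expr0 mulr1; apply: le_trans; exact: nrm_ge0.
have tail n j : nrm (u (n + j)%N - u n) <= B * q ^+ n * (1 - q ^+ j) / (1 - q).
  elim: j => [|j IH]; first by rewrite addn0 expr0 !subrr mulr0 mul0r (nrm0 ph).
  rewrite addnS; apply: (le_trans (nrm_dist ph (hu _) (hu (n + j)%N) (hu _))).
  apply: (le_trans (lerD (uB _) IH)); rewrite le_eqVlt; apply/orP; left; apply/eqP.
  rewrite exprD exprS; field; lra.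
have key n j : nrm (u (n + j)%N - u n) <= B / (1 - q) * q ^+ n.
  apply: (le_trans (tail n j)).
  have -> : B / (1 - q) * q ^+ n = B * q ^+ n * 1 / (1 - q) by rewrite mulr1 mulrAC.
  apply: ler_wpM2r; first by rewrite invr_ge0; lra.
  apply: ler_wpM2l; first by apply: mulr_ge0 => //; exact: exprn_ge0.
  by rewrite gerBl exprn_ge0.
have cv : (fun n => B / (1 - q) * q ^+ n) @ \oo --> 0.
  rewrite -[X in _ --> X](mulr0 (B / (1 - q))); apply: cvgMl_tmp; apply: cvg_expr.
  by rewrite ger0_norm.
move=> e e0; have e20 : 0 < e / 2 by rewrite divr_gt0.
have [N _ hN] := (cvgrPdist_lt _ _).1 cv _ e20; exists N => m n Nm Nn.
have half k : (N <= k)%N -> nrm (u k - u N) < e / 2.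
  move=> Nk; rewrite -(subnKC Nk); apply: (le_lt_trans (key _ _)).
  by have := hN _ (leqnn N); rewrite /= sub0r normrN; apply: le_lt_trans; exact: ler_norm.
apply: (le_lt_trans (nrm_dist ph (hu m) (hu N) (hu n))).
by rewrite (nrmBC ph (hu N) (hu n)); have := half _ Nm; have := half _ Nn; lra.
Qed.

(** A sequence in [M] that minimises the distance to [x] is Cauchy by the
    parallelogram law, and perturbing its limit in the direction [y] gives the
    orthogonality. *)
Lemma projection_exists (M : V -> Prop) :
  (forall x, M x -> D x) -> M 0 -> (forall x y, M x -> M y -> M (x + y)) ->
  (forall a x, M x -> M (a *: x)) ->
  (forall u l, (forall n, M (u n)) -> D l -> tends u l -> M l) ->
  forall x, D x -> exists2 m, M m & forall y, M y -> dot (x - m) y = 0.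
Proof.
move=> MD M0 MA MZ Mcl x Dx.
have DBx m : M m -> D (x - m) by move=> /MD Dm; apply: (DB ph).
pose A := [set nrm (x - m) | m in [set m | M m]].
have A0 : has_inf A.
  split; first by exists (nrm (x - 0)), 0.
  by exists 0 => _ [m _ <-]; exact: nrm_ge0.
pose d := inf A.
have dle m : M m -> d <= nrm (x - m).
  by move=> Mm; apply: ge_inf; [exact: A0.2|exists m].
have d0 : 0 <= d by apply: lb_le_inf; [exact: A0.1|move=> _ [m _ <-]; exact: nrm_ge0].
have /choice[u hu] : forall n : nat, exists m, M m /\ nrm (x - m) < d + n.+1%:R^-1.
  move=> n; have e0 : (0 : R) < n.+1%:R^-1 by rewrite invr_gt0.
  by have [_ [m Mm <-] h] := inf_adherent e0 A0; exists m.
have Mu n := (hu n).1.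
have cau : cauchy_nrm (dot := dot) u.
  move=> e e0.
  (* If both [nrm (x - u i)] and [nrm (x - u j)] are below [d + q], the parallelogram
     law bounds [sqn (u i - u j)] by [8 d q + 4 q^2]; the choice [q = min c 1] makes
     this less than [e^2]. *)
  pose c := e ^+ 2 / (8 * d + 8).
  have c0 : 0 < c by rewrite divr_gt0 ?exprn_gt0//; lra.
  have [N _ hN] := (cvgrPdist_lt _ _).1 (@cvg_harmonic R) _ c0.
  have small k : (N <= k)%N -> nrm (x - u k) < d + Num.min c 1.
    move=> Nk; apply: (lt_le_trans (hu k).2); rewrite lerD2l le_min.
    have := hN _ Nk; rewrite sub0r normrN ger0_norm ?invr_ge0// => /ltW -> /=.
    by rewrite invf_le1// ler1n.
  pose q := Num.min c 1.
  have q0 : 0 < q by rewrite lt_min c0 ltr01.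
  have qc : q <= c by rewrite ge_min lexx.
  have q1 : q <= 1 by rewrite ge_min lexx orbT.
  exists N => i j Ni Nj.
  have Dij : D (u i - u j) by apply: (DB ph); exact: MD.
  rewrite lt_nrm_sqn ?ltW//.
  have Di := DBx _ (Mu i); have Dj := DBx _ (Mu j).
  have := parallelogram ph Di Dj.
  have -> : (x - u i) - (x - u j) = - (u i - u j) by rewrite !opprB addrC addrA subrK.
  rewrite (sqnN ph)//.
  have half : (2 : R[i]) * 2^-1 = 1 by rewrite divff ?pnatr_eq0.
  have -> : (x - u i) + (x - u j) = 2 *: (x - 2^-1 *: (u i + u j)).
    rewrite scalerBr scalerA half scale1r addrACA -opprD.
    by rewrite -mulr2n -scaler_nat.
  have Mm : M (2^-1 *: (u i + u j)) by apply: MZ; exact: MA.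
  rewrite (sqnZ ph); last exact: DBx.
  have -> : normc (2 : R[i]) = 2.
    by rewrite -[X in normc X]/(2%:R) -(rmorph_nat (real_complex R)) normcR ger0_norm.
  have := dle _ Mm => h1.
  have h2 : d ^+ 2 <= sqn (x - 2^-1 *: (u i + u j)).
    by rewrite -(sqr_nrm ph) ?ler_pXn2r ?nnegrE ?nrm_ge0//; exact: DBx.
  have h3 k : (N <= k)%N -> sqn (x - u k) < (d + q) ^+ 2.
    by move=> Nk; rewrite -lt_nrm_sqn ?small//; [exact: DBx|lra].
  have := h3 _ Ni; have := h3 _ Nj.
  have h4 : 8 * d * q + 4 * q ^+ 2 < e ^+ 2.
    have ce : c * (8 * d + 8) = e ^+ 2 by rewrite divfK//; lra.
    rewrite -ce; have : q * (8 * d + 8) <= c * (8 * d + 8) by rewrite ler_wpM2r//; lra.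
    have q2 : q ^+ 2 <= q by rewrite expr2 ger_pMl.
    lra.
  move: h2 h4; set S := sqn (x - 2^-1 *: _); set Si := sqn (x - u i).
  set Sj := sqn (x - u j); set T := sqn (u i - u j) => h2 h4 hj hi eqn.
  lra.
have [m Dm um] := complete (fun n => MD _ (Mu n)) cau.
have Mm := Mcl _ _ Mu Dm um.
exists m => // y My; have Dy := MD _ My.
have dm : nrm (x - m) <= d.
  have c : (fun n => d + n.+1%:R^-1 + nrm (u n - m)) @ \oo --> d + 0 + 0.
    apply: cvgD => //; apply: cvgD; first exact: cvg_cst.
    exact: cvg_harmonic.
  rewrite -[d]addr0 -[d + 0]addr0 -(cvg_lim _ c)//.
  apply: limr_ge; first by apply/cvg_ex; eexists; exact: c.
  apply: nearW => n; apply: (le_trans (nrm_dist ph Dx (MD _ (Mu n)) Dm)).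
  by rewrite lerD2r ltW// (hu n).2.
set c := dot (x - m) y.
have Dxm := DBx _ Mm.
(* Moving [m] by [t <x - m, y> y] cannot decrease the distance to [x]; comparing the
   terms of order [t] and [t^2] leaves [<x - m, y> = 0] as soon as [t sqn y <= 1]. *)
pose t := (sqn y + 1)^-1.
have y0 := sqn_ge0 ph Dy.
have t0 : 0 < t by rewrite invr_gt0; lra.
have Mz : M (m + (t%:C%C * c) *: y) by apply: MA => //; exact: MZ.
have h : sqn (x - m) <= sqn (x - m - (t%:C%C * c) *: y).
  rewrite -addrA -opprD -(sqr_nrm ph)// -(sqr_nrm ph); last exact: DBx.
  by rewrite ler_pXn2r ?nnegrE ?nrm_ge0//; apply: (le_trans dm); exact: dle.
move: h; rewrite (sqnB ph Dxm (DZ ph _ Dy)).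
rewrite (sqnZ ph)// (dotZr ph)// -/c.
rewrite normcM normcR exprMn real_normK ?num_real// rmorphM.
rewrite [X in X * _ * c]conjc_real -mulrA [c^*%C * c]mulrC mulJ_normc -rmorphM/=.
set v := normc c ^+ 2 => h.
have ty : t * sqn y <= 1.
  by rewrite /t mulrC ler_pdivrMr ?mul1r; lra.
have v0 : 0 <= v by exact: sqr_ge0.
have : t * (2 * v) <= t * (v * (t * sqn y)) by move: h; lra.
rewrite ler_pM2l// => h'.
have h'' : v * (t * sqn y) <= v by rewrite ler_piMr.
 have v00 : v = 0 by apply/eqP; rewrite eq_le v0 andbT; lra.
by apply/eq0_normc/eqP; rewrite -sqrf_eq0 -/v v00.
Qed.

Section Orthonormal.
Variable e : nat -> V.
Hypothesis De : forall n, D (e n).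
Hypothesis e_orth : forall i j, dot (e i) (e j) = (i == j)%:R.
Implicit Type a : nat -> R[i].

Definition psum a n := \sum_(k < n) a k *: e k.

Lemma D_psum a n : D (psum a n).
Proof. by apply: (Dsum ph (F := fun k => a k *: e k)) => k _; exact: (DZ ph). Qed.

Lemma dot_psum_e a n k : dot (psum a n) (e k) = if (k < n)%N then a k else 0.
Proof.
rewrite (dot_suml ph (F := fun k => a k *: e k))//; last by move=> *; exact: (DZ ph).
under eq_bigr => i _ do rewrite (dotZl ph)// e_orth.
elim: n => [|n IH]; first by rewrite big_ord0.
rewrite big_ord_recr/= IH ltnS [(k <= n)%N]leq_eqVlt [k == n]eq_sym.
by have [->|nk] := eqVneq n k; rewrite ?ltnn ?mulr1 ?add0r// mulr0 addr0.
Qed.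

Lemma sqn_psum_tail a n j :
  sqn (psum a (n + j) - psum a n) = \sum_(k < n + j) normc (a k) ^+ 2 - \sum_(k < n) normc (a k) ^+ 2.
Proof.
elim: j => [|j IH].
  by rewrite addn0 !subrr /sqn (dot0l ph)//; exact: (D0 ph).
rewrite addnS /psum !big_ord_recr/= -/(psum a (n + j)) -/(psum a n).
have Dd : D (psum a (n + j) - psum a n) by apply: (DB ph); exact: D_psum.
rewrite addrAC (sqnD_orth ph)//; first last.
- rewrite (dotZr ph)// (dotBl ph)//; try exact: D_psum.
  by rewrite !dot_psum_e ltnn ltnNge leq_addr/= subrr mulr0.
- exact: (DZ ph).
rewrite IH (sqnZ ph)// /sqn e_orth eqxx mulr1; ring.
Qed.

Lemma sqn_psum a n : sqn (psum a n) = \sum_(k < n) normc (a k) ^+ 2.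
Proof.
by have := sqn_psum_tail a 0 n; rewrite add0n /psum !big_ord0 !subr0.
Qed.

Lemma bessel x n : D x -> \sum_(k < n) normc (dot x (e k)) ^+ 2 <= sqn x.
Proof.
move=> Dx; pose a k := dot x (e k); have Ds := D_psum a n.
have := sqn_ge0 ph (DB ph Dx Ds).
rewrite (sqnB ph)// sqn_psum -/(a _).
rewrite /psum (dot_sumr ph (F := fun k => a k *: e k))//; last first.
  by move=> *; exact: (DZ ph).
rewrite (Re_sum n (fun k => dot x (a k *: e k))); under [X in _ - 2 * X]eq_bigr => k _.
  rewrite (dotZr ph)// -/(a k) mulrC Re_mulJ; over.
lra.
Qed.

Lemma orthonormal_series a (B : R) :
  (forall n, \sum_(k < n) normc (a k) ^+ 2 <= B) ->
  exists y, [/\ D y, tends (psum a) y & forall k, dot y (e k) = a k].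
Proof.
move=> aB; pose A n := \sum_(k < n) normc (a k) ^+ 2.
have Acvg : cvgn A.
  apply: nondecreasing_is_cvgn.
    by apply/nondecreasing_seqP => n; rewrite /A big_ord_recr/= lerDl sqr_ge0.
  by exists B => _ [n _ <-]; exact: aB.
have cau : cauchy_nrm (dot := dot) (psum a).
  have key r : 0 < r -> exists N, forall m n, (N <= n)%N -> (n <= m)%N ->
      nrm (psum a m - psum a n) < r.
    move=> r0; have r20 : 0 < r ^+ 2 / 2 by rewrite divr_gt0 ?exprn_gt0.
    have [N _ hN] := (cvgrPdist_lt _ _).1 Acvg _ r20; exists N => m n Nn nm.
    rewrite lt_nrm_sqn ?ltW//; last by apply: (DB ph); exact: D_psum.
    have := hN _ Nn; have := hN _ (leq_trans Nn nm).
    rewrite -(subnKC nm) sqn_psum_tail -!/(A _) /=.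
    set x := A _; set y := A n; set l := lim _.
    by rewrite !ltr_norml => /andP[h1 h2] /andP[h3 h4]; lra.
  move=> r r0; have [N hN] := key _ r0; exists N => m n Nm Nn.
  case/orP: (leq_total n m) => [nm|mn]; first exact: hN.
  by rewrite (nrmBC ph); [exact: hN|exact: D_psum|exact: D_psum].
have [y Dy ty] := complete (D_psum a) cau.
exists y; split=> // k; apply: (tends_dot_cst ph (D_psum a) Dy (De k) ty).
by exists k.+1 => // n /= kn; rewrite dot_psum_e kn.
Qed.

(** The series of Fourier coefficients converges by Bessel's inequality, and its sum
    differs from [x] by a vector orthogonal to the whole system. *)
Lemma expansion_tends x : (forall y, D y -> (forall k, dot y (e k) = 0) -> y = 0) ->
  D x -> tends (psum (fun k => dot x (e k))) x.
Proof.
move=> total Dx.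
have [y [Dy ty ye]] := @orthonormal_series (fun k => dot x (e k)) _ (fun n => bessel n Dx).
suff xy : y = x by move: ty; rewrite xy.
apply/esym/eqP; rewrite -subr_eq0; apply/eqP/total; first exact: (DB ph).
by move=> k; rewrite (dotBl ph)// ye subrr.
Qed.

End Orthonormal.
End Hilbert.

(** * Integration over the circle *)
Section CircleIntegral.
Context {R : realType}.
Local Notation C := R[i].
Local Notation mu := (@lebesgue_measure R).
Local Notation I := (`[- pi, pi]%classic : set R).
Implicit Types (f g h : C -> C) (u v : R -> R).

Lemma ae_imp (P Q : R -> Prop) : (forall t, P t -> Q t) ->
  {ae mu, forall t, P t} -> {ae mu, forall t, Q t}.
Proof. by move=> PQ; apply: filterS => //; exact: (ae_filter_ringOfSetsType mu). Qed.

Lemma ae_imp2 (P Q S : R -> Prop) : (forall t, P t -> Q t -> S t) ->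
  {ae mu, forall t, P t} -> {ae mu, forall t, Q t} -> {ae mu, forall t, S t}.
Proof. by move=> PQ; apply: filterS2 => //; exact: (ae_filter_ringOfSetsType mu). Qed.

Lemma ae_all (P : R -> Prop) : (forall t, P t) -> {ae mu, forall t, P t}.
Proof. by move=> h; apply: aeW. Qed.

Lemma measurable_I : measurable I. Proof. exact: measurable_itv. Qed.
Hint Resolve measurable_I : core.

Lemma mu_I : mu I = (2 * pi)%:E.
Proof.
rewrite lebesgue_measure_itv/= lte_fin; have p := pi_gt0 R.
by rewrite ifT; [congr (_%:E); ring|lra].
Qed.

Definition cint u : R := (pi - - pi)^-1 * \int[mu]_(t in I) u t.
Definition int1 u := mu.-integrable I (EFin \o u).
Definition meas u := measurable_fun [set: R] u.

Lemma measI u : meas u -> measurable_fun I u.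
Proof. by move=> h; exact: measurable_funTS. Qed.

Lemma meas_continuous u : continuous u -> meas u.
Proof. exact: continuous_measurable_fun. Qed.

Lemma int1_le u v : meas u -> (forall t, `|u t| <= v t) -> int1 v -> int1 u.
Proof.
move=> mu_ uv iv; apply: (@le_integrable _ _ R mu I measurable_I (EFin \o u) (EFin \o v)) => //.
  by apply/measurable_EFinP; exact: measI.
move=> t _; rewrite /= lee_fin; apply: (le_trans (uv t)); exact: ler_norm.
Qed.

Lemma int1_cst (c : R) : int1 (cst c).
Proof.
apply: (@measurable_bounded_integrable _ _ R mu (cst c) I measurable_I).
- by rewrite -[X in (X < _)%E]/(mu I) mu_I ltry.
- exact: measurable_cst.
by exists `|c|; split => // M cM t _ /=; exact: ltW.
Qed.

Lemma int1D u v : int1 u -> int1 v -> int1 (fun t => u t + v t).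
Proof. by move=> iu iv; exact: (@integrableD _ _ R mu I measurable_I _ _ iu iv). Qed.

Lemma int1Z c u : int1 u -> int1 (fun t => c * u t).
Proof. by move=> iu; exact: (@integrableZl _ _ R mu I measurable_I c _ iu). Qed.

Lemma int1N u : int1 u -> int1 (fun t => - u t).
Proof. by move=> iu; exact: (@integrableN _ _ R mu I _ iu). Qed.

Lemma int1_norm u : int1 u -> int1 (fun t => `|u t|).
Proof. by move=> iu; exact: (@integrable_norm _ _ R mu I _ iu). Qed.

Lemma cintD u v : int1 u -> int1 v -> cint (fun t => u t + v t) = cint u + cint v.
Proof. by move=> iu iv; rewrite /cint RintegralD// mulrDr. Qed.

Lemma cintZ c u : int1 u -> cint (fun t => c * u t) = c * cint u.
Proof. by move=> iu; rewrite /cint RintegralZl// mulrCA. Qed.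

Lemma cintN u : int1 u -> cint (fun t => - u t) = - cint u.
Proof.
move=> iu; rewrite -mulN1r -cintZ//; congr (_ * _); apply: eq_Rintegral => t _.
by rewrite mulN1r.
Qed.

Lemma cintB u v : int1 u -> int1 v -> cint (fun t => u t - v t) = cint u - cint v.
Proof. by move=> iu iv; rewrite cintD ?cintN//; exact: int1N. Qed.

Lemma eq_cint u v : (forall t, t \in I -> u t = v t) -> cint u = cint v.
Proof. by move=> uv; congr (_ * _); apply: eq_Rintegral => t It; exact: uv. Qed.

Lemma twopi_inv_ge0 : 0 <= (pi - - pi : R)^-1.
Proof. by rewrite invr_ge0; have := pi_gt0 R; lra. Qed.

Lemma cint_ge0 u : (forall t, 0 <= u t) -> 0 <= cint u.
Proof. by move=> h; apply: mulr_ge0; [exact: twopi_inv_ge0|exact: Rintegral_ge0]. Qed.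

Lemma ler_cint u v : int1 u -> int1 v -> (forall t, u t <= v t) -> cint u <= cint v.
Proof.
move=> iu iv uv; apply: ler_wpM2l; first exact: twopi_inv_ge0.
exact: le_Rintegral.
Qed.

Lemma ler_norm_cint u : int1 u -> `|cint u| <= cint (fun t => `|u t|).
Proof.
move=> iu; rewrite normrM ger0_norm ?twopi_inv_ge0//.
by apply: ler_wpM2l; [exact: twopi_inv_ge0|exact: le_normr_Rintegral].
Qed.

Lemma cint_cst (c : R) : cint (cst c) = c.
Proof.
rewrite /cint Rintegral_cst// -[X in fine X]/(mu I) mu_I /=; have := pi_gt0 R => p0.
by field; lra.
Qed.

Lemma ae_cint u v : meas u -> meas v -> {ae mu, forall t, u t = v t} ->
  cint u = cint v.
Proof.
move=> mu_ mv uv; congr (_ * fine _); apply: ae_eq_integral => //.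
- by apply/measurable_EFinP; exact: measI.
- by apply/measurable_EFinP; exact: measI.
by move: uv; apply: ae_imp => t -> _.
Qed.

Lemma cint_eq0_ae u : int1 u -> (forall t, 0 <= u t) -> cint u = 0 ->
  {ae mu, forall t, I t -> u t = 0}.
Proof.
move=> iu u0 h; have p0 := pi_gt0 R.
have h0 : (\int[mu]_(x in I) (u x)%:E = 0)%E.
  have : \int[mu]_(t in I) u t = 0.
    by move/eqP: h; rewrite mulf_eq0 invr_eq0 => /orP[/eqP|/eqP//]; lra.
  move=> hR; rewrite -[LHS]fineK; last exact: integrable_fin_num.
  by rewrite -[X in X%:E]/(\int[mu]_(t in I) u t) hR.
have h1 : (\int[mu]_(x in I) `|(EFin \o u) x| = 0)%E.
  by rewrite -{}h0; apply: eq_integral => t _; rewrite /= ger0_norm.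
have := (ae_eq_integral_abs mu measurable_I (measurable_int _ iu)).1 h1.
by apply: ae_imp => t h' It; have := h' It; case.
Qed.

(** Real and imaginary parts are treated separately, in accordance with [intT] and
    [L2]. *)
Definition mT f := meas (fun t => complex.Re (f (expi t))) /\
  meas (fun t => complex.Im (f (expi t))).

Lemma mT_cst (c : C) : mT (cst c). Proof. by split; exact: measurable_cst. Qed.
Lemma mT_id : mT id.
Proof. by split; apply: meas_continuous; [exact: continuous_cos|exact: continuous_sin]. Qed.
Lemma mTD f g : mT f -> mT g -> mT (fun z => f z + g z).
Proof.
move=> [f1 f2] [g1 g2]; split.
  rewrite (_ : (fun _ => _) = (fun t => complex.Re (f (expi t)) + complex.Re (g (expi t)))).
    exact: measurable_funD.
  by apply/funext => t; rewrite ReD.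
rewrite (_ : (fun _ => _) = (fun t => complex.Im (f (expi t)) + complex.Im (g (expi t)))).
  exact: measurable_funD.
by apply/funext => t; rewrite ImD.
Qed.
Lemma mTM f g : mT f -> mT g -> mT (fun z => f z * g z).
Proof.
move=> [f1 f2] [g1 g2]; split.
  rewrite (_ : (fun _ => _) = (fun t => complex.Re (f (expi t)) * complex.Re (g (expi t))
     - complex.Im (f (expi t)) * complex.Im (g (expi t)))).
    by apply: measurable_funB; exact: measurable_funM.
  by apply/funext => t; case: (f _); case: (g _).
rewrite (_ : (fun _ => _) = (fun t => complex.Re (f (expi t)) * complex.Im (g (expi t))
     + complex.Im (f (expi t)) * complex.Re (g (expi t)))).
  by apply: measurable_funD; exact: measurable_funM.
by apply/funext => t; case: (f _); case: (g _).
Qed.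
Lemma mTJ f : mT f -> mT (fun z => (f z)^*%C).
Proof.
move=> [f1 f2]; split.
  by rewrite (_ : (fun _ => _) = (fun t => complex.Re (f (expi t))))//; apply/funext => t; case: (f _).
rewrite (_ : (fun _ => _) = (\- (fun t => complex.Im (f (expi t))))).
  exact: measurable_funN.
by apply/funext => t /=; case: (f _).
Qed.
Lemma mTZ c f : mT f -> mT (fun z => c * f z).
Proof. by move=> mf; apply: mTM => //; exact: mT_cst. Qed.
Lemma mTB f g : mT f -> mT g -> mT (fun z => f z - g z).
Proof.
move=> mf mg; rewrite (_ : (fun _ => _) = (fun z => f z + (-1) * g z)).
  by apply: mTD => //; exact: mTZ.
by apply/funext => z; rewrite mulN1r.
Qed.
Lemma mTX n : mT (fun z => z ^+ n).
Proof.
elim: n => [|n IH]; first exact: (mT_cst 1).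
rewrite (_ : (fun _ => _) = (fun z : C => z * z ^+ n)); first exact: mTM mT_id IH.
by apply/funext => z; rewrite exprS.
Qed.
Lemma mT_normc f : mT f -> meas (fun t => normc (f (expi t))).
Proof.
move=> [f1 f2].
rewrite (_ : (fun _ => _) = Num.sqrt \o
  (fun t => complex.Re (f (expi t)) ^+ 2 + complex.Im (f (expi t)) ^+ 2)).
  apply: measurableT_comp; first exact: (meas_continuous (@sqrt_continuous R)).
  by apply: measurable_funD; exact: measurable_funX.
by apply/funext => t /=; case: (f _).
Qed.
Lemma mT_real u : meas u -> forall f, (forall t, f (expi t) = (u t)%:C%C) -> mT f.
Proof.
move=> mu_ f fu; split.
  by rewrite (_ : (fun _ => _) = u)//; apply/funext => t; rewrite fu.
rewrite (_ : (fun _ => _) = cst 0); first exact: measurable_cst.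
by apply/funext => t; rewrite fu.
Qed.
Lemma mT_circle f g : (forall t, f (expi t) = g (expi t)) -> mT f -> mT g.
Proof.
move=> fg [f1 f2]; split.
  by rewrite (_ : (fun _ => _) = (fun t => complex.Re (f (expi t))))//; apply/funext => t; rewrite fg.
by rewrite (_ : (fun _ => _) = (fun t => complex.Im (f (expi t))))//; apply/funext => t; rewrite fg.
Qed.

Definition L1T f := mT f /\ int1 (fun t => normc (f (expi t))).

Lemma L1T_le f v : mT f -> int1 v -> (forall t, normc (f (expi t)) <= v t) -> L1T f.
Proof.
move=> mf iv fv; split=> //; apply: (int1_le (mT_normc mf) _ iv) => t.
by rewrite ger0_norm ?normc_ge0.
Qed.
Lemma L1T_Re f : L1T f -> int1 (fun t => complex.Re (f (expi t))).
Proof. by move=> [[m1 m2] i]; apply: (int1_le m1 _ i) => t; exact: ler_normRe_normc. Qed.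
Lemma L1T_Im f : L1T f -> int1 (fun t => complex.Im (f (expi t))).
Proof. by move=> [[m1 m2] i]; apply: (int1_le m2 _ i) => t; exact: ler_normIm_normc. Qed.

Lemma L1TD f g : L1T f -> L1T g -> L1T (fun z => f z + g z).
Proof.
move=> [mf f1] [mg g1]; apply: (L1T_le (mTD mf mg) (int1D f1 g1)) => t; exact: le_normcD.
Qed.
Lemma L1T_bounded_mul f g (M : R) : mT g -> (forall t, normc (g (expi t)) <= M) ->
  L1T f -> L1T (fun z => g z * f z).
Proof.
move=> mg gM [mf f1]; apply: (L1T_le (mTM mg mf) (int1Z M f1)) => t.
by rewrite normcM; apply: ler_wpM2r => //; exact: normc_ge0.
Qed.
Lemma L1TZ c f : L1T f -> L1T (fun z => c * f z).
Proof. by apply: (@L1T_bounded_mul f (cst c) (normc c)) => //; exact: mT_cst. Qed.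
Lemma L1TB f g : L1T f -> L1T g -> L1T (fun z => f z - g z).
Proof.
move=> mf mg; rewrite (_ : (fun _ => _) = (fun z => f z + (-1) * g z)).
  by apply: L1TD => //; exact: L1TZ.
by apply/funext => z; rewrite mulN1r.
Qed.
Lemma L1T_cst c : L1T (cst c).
Proof. by split; [exact: mT_cst|exact: int1_cst]. Qed.
Lemma L1TJ f : L1T f -> L1T (fun z => (f z)^*%C).
Proof. by move=> [mf f1]; apply: (L1T_le (mTJ mf) f1) => t; rewrite normcJ. Qed.

Lemma intTE f : intT f = Complex (cint (fun t => complex.Re (f (expi t))))
  (cint (fun t => complex.Im (f (expi t)))).
Proof. by []. Qed.

Lemma intTD f g : L1T f -> L1T g -> intT (fun z => f z + g z) = intT f + intT g.
Proof.
move=> f1 g1; rewrite !intTE; apply/eqP; rewrite eq_complex /= -!cintD.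
- by apply/andP; split; apply/eqP; apply: eq_cint => t _; rewrite (ReD, ImD).
- exact: L1T_Im.
- exact: L1T_Im.
- exact: L1T_Re.
- exact: L1T_Re.
Qed.
Lemma intTZ c f : L1T f -> intT (fun z => c * f z) = c * intT f.
Proof.
move=> f1; have r := L1T_Re f1; have i := L1T_Im f1.
rewrite !intTE; case: c => a b; apply/eqP; rewrite eq_complex /= -!cintZ//.
rewrite -cintB -?cintD; try exact: int1Z.
by apply/andP; split; apply/eqP; apply: eq_cint => t _; case: (f _).
Qed.
Lemma intTB f g : L1T f -> L1T g -> intT (fun z => f z - g z) = intT f - intT g.
Proof.
move=> f1 g1; rewrite -mulN1r -intTZ// -intTD//; last exact: L1TZ.
by congr intT; apply/funext => z; rewrite mulN1r.
Qed.
Lemma intTJ f : L1T f -> intT (fun z => (f z)^*%C) = (intT f)^*%C.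
Proof.
move=> f1; rewrite !intTE /=; congr Complex; last rewrite -cintN; last exact: L1T_Im.
  by apply: eq_cint => t _; case: (f _).
by apply: eq_cint => t _; case: (f _).
Qed.
Lemma ae_intT f g : mT f -> mT g -> aeT f g -> intT f = intT g.
Proof.
move=> [f1 f2] [g1 g2] fg; rewrite !intTE; congr Complex; apply: ae_cint => //;
  by move: fg; apply: ae_imp => t ->.
Qed.
Lemma eq_intT f g : (forall t, f (expi t) = g (expi t)) -> intT f = intT g.
Proof. by move=> fg; rewrite !intTE; congr Complex; apply: eq_cint => t _; rewrite fg. Qed.
(** The factor 2 comes from estimating the real and the imaginary part separately. *)
Lemma normc_intT f : L1T f -> normc (intT f) <= 2 * cint (fun t => normc (f (expi t))).
Proof.
move=> f1; apply: (le_trans (normc_le_ReIm _)); rewrite mulr_natl mulr2n intTE /=.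
have n1 := f1.2.
have r := L1T_Re f1; have i := L1T_Im f1.
apply: lerD.
  apply: (le_trans (ler_norm_cint r)); apply: ler_cint => //; first exact: int1_norm.
  by move=> t; exact: ler_normRe_normc.
apply: (le_trans (ler_norm_cint i)); apply: ler_cint => //; first exact: int1_norm.
by move=> t; exact: ler_normIm_normc.
Qed.
Lemma intT_cst (c : C) : intT (cst c) = c.
Proof. by rewrite intTE/=; case: c => a b /=; rewrite -/(cst a) -/(cst b) !cint_cst. Qed.

End CircleIntegral.

(** * The parametrisation of the circle and its symmetries *)
Section CircleSymmetry.
Context {R : realType}.
Local Notation C := R[i].
Local Notation mu := (@lebesgue_measure R).
Local Notation I := (`[- pi, pi]%classic : set R).
Implicit Types (f g h : C -> C) (u v : R -> R).

Lemma expiD (s t : R) : expi (s + t) = expi s * expi t.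
Proof.
rewrite /expi cosD sinD; apply/eqP; rewrite eq_complex /=.
by apply/andP; split; apply/eqP; ring.
Qed.
Lemma expiN (t : R) : expi (- t) = (expi t)^*%C.
Proof. by rewrite /expi cosN sinN. Qed.
Lemma expi_mulJ (t : R) : expi t * (expi t)^*%C = 1.
Proof.
rewrite mulJ_normc sqr_normcE /= cos2Dsin2; exact/eqP.
Qed.
Lemma normc_expi (t : R) : normc (expi t) = 1.
Proof. by rewrite /= cos2Dsin2 sqrtr1. Qed.
Lemma expi_neq0 (t : R) : expi t != 0.
Proof. by rewrite -normc_gt0 normc_expi ltr01. Qed.
Lemma expi2pi (t : R) : expi (t + 2 * pi) = expi t.
Proof.
have -> : t + 2 * pi = t + pi *+ 2 by rewrite mulr_natl.
by rewrite /expi cosD2pi sinD2pi.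
Qed.
Lemma expiV (t : R) : (expi t)^-1 = (expi t)^*%C.
Proof. by apply: (mulfI (expi_neq0 t)); rewrite expi_mulJ divff// expi_neq0. Qed.
Lemma expiMn (n : nat) (t : R) : expi (n%:R * t) = expi t ^+ n.
Proof.
elim: n => [|n IH]; first by rewrite mul0r expr0 /expi cos0 sin0.
by rewrite exprS -IH -expiD -(natr1 n); congr (expi _); ring.
Qed.
Lemma expiXz_conj (n : int) (t : R) : (expi t ^ n)^*%C = expi t ^ (- n).
Proof.
have key m : (expi t ^+ m)^*%C = expi t ^- m by rewrite -exprVn expiV rmorphXn.
case: n => n.
  by rewrite -exprnN -exprnP key.
by rewrite NegzE opprK -exprnN -!exprnP -key conjcK.
Qed.
Lemma normc_expiXz (n : int) (t : R) : normc (expi t ^ n) = 1.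
Proof.
case: n => n; rewrite ?NegzE -?exprnN -?exprnP ?normcV normcX normc_expi expr1n//.
by rewrite invr1.
Qed.

Lemma measurable_shift (a : R) :
  measurable_fun [set: R] ((fun t => t + a) : R -> measurableTypeR R).
Proof.
by apply: (@continuous_measurable_fun R) => t; apply: cvgD; [exact: cvg_id|exact: cvg_cst].
Qed.

Lemma measurable_opp : measurable_fun [set: R] ((fun t => - t) : R -> measurableTypeR R).
Proof. by apply: (@continuous_measurable_fun R) => t; apply: cvgN; exact: cvg_id. Qed.

(** Lebesgue measure is determined by its values on half-open intervals. *)
Lemma lebesgue_measure_shift (a : R) (A : set R) : measurable A ->
  pushforward mu ((fun t => t + a) : R -> measurableTypeR R) A = mu A.
Proof.
move=> mA; apply/esym/lebesgue_measure_unique => //=; first exact: measurable_shift.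
move=> mf _ [[x y]] _ <-; rewrite /pushforward.
rewrite (_ : _ @^-1` _ = `]x - a, y - a]%classic).
  by rewrite !lebesgue_measure_itv/= !lte_fin ltrD2r; case: ifP => // _; congr (_%:E); ring.
by apply/seteqP; split => t /=; rewrite !in_itv/=; lra.
Qed.

Lemma ae_pushforward (phi : R -> measurableTypeR R) (P : R -> Prop) :
  measurable_fun [set: R] phi ->
  (forall A : set R, measurable A -> pushforward mu phi A = mu A) ->
  {ae mu, forall t, P t} -> {ae mu, forall t, P (phi t)}.
Proof.
move=> mphi h [A [mA A0 PA]]; exists (phi @^-1` A); split.
- by rewrite -[X in measurable X]setTI; exact: mphi.
- by rewrite -A0 -[RHS]h.
- by move=> t /= nP; exact: PA.
Qed.

Lemma ae_opp (P : R -> Prop) : {ae mu, forall t, P t} -> {ae mu, forall t, P (- t)}.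
Proof.
apply: ae_pushforward; first exact: measurable_opp.
by move=> A mA; exact: lebesgue_measureN.
Qed.

Lemma ae_shift (a : R) (P : R -> Prop) :
  {ae mu, forall t, P t} -> {ae mu, forall t, P (t + a)}.
Proof.
apply: (@ae_pushforward (fun t => t + a)); first exact: measurable_shift.
by move=> A mA; exact: lebesgue_measure_shift.
Qed.

Lemma expi_period (k : int) (t : R) : expi (t + k%:~R * (2 * pi)) = expi t.
Proof.
have pos (m : nat) (s : R) : expi (s + m%:R * (2 * pi)) = expi s.
  elim: m s => [|m IH] s; first by rewrite mul0r addr0.
  by rewrite -(natr1 m) mulrDl mul1r addrA expi2pi IH.
case: k => m; first exact: pos.
by rewrite NegzE mulrNz mulNr; have := pos m.+1 (t - m.+1%:R * (2 * pi)); rewrite subrK => ->.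
Qed.

(** The translates of one period by multiples of [2 pi] cover the line, and countably
    many null sets have a null union. *)
Lemma ae_one_period (Q : C -> Prop) :
  {ae mu, forall t, I t -> Q (expi t)} -> {ae mu, forall t, Q (expi t)}.
Proof.
move=> h.
have hk (k : int) := ae_shift (k%:~R * (2 * pi)) h.
have all_k : {ae mu, forall t, forall k : int, I (t + k%:~R * (2 * pi)) -> Q (expi t)}.
  rewrite /= /almost_everywhere.
  apply: (@negligibleS _ _ _ mu (\bigcup_(n : nat) (\bigcup_(m : nat)
     [set t | ~ (I (t + (n%:Z - m%:Z)%:~R * (2 * pi)) -> Q (expi t))]))).
    move=> t /= /existsNP[k hkt].
    case: k hkt => n hkt; first by exists n => //; exists 0%N => //=; rewrite subr0.
    by exists 0%N => //; exists n.+1 => //=; rewrite sub0r -NegzE.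
  apply: negligible_bigcup => n; apply: negligible_bigcup => m.
  apply: negligibleS (hk (n%:Z - m%:Z)) => t /=.
  by rewrite expi_period.
move: all_k; apply: ae_imp => t ht.
have p0 := pi_gt0 R; have p20 : 0 < 2 * (pi : R) by lra.
pose k : int := - Num.floor ((t + pi) / (2 * pi)).
apply: (ht k); rewrite /= in_itv/= /k mulrNz mulNr.
have /andP[] := floor_itv ((t + pi) / (2 * pi)).
rewrite ler_pdivlMr// ltr_pdivrMr// intrD.
set x := (Num.floor _)%:~R; nra.
Qed.

Lemma int1_opp u : meas u -> int1 u -> int1 (fun t => u (- t)).
Proof.
move=> mu_ iu.
have preI : (fun t : R => - t) @^-1` I = I.
  by apply/seteqP; split => t /=; rewrite !in_itv/=; lra.
apply/integrableP; split.
  by apply/measurable_EFinP; apply: measurable_funTS; apply: measurableT_comp => //; exact: measurable_opp.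
have /integrableP[_] := iu.
rewrite -(@eq_measure_integral _ (measurableTypeR R) R I mu (pushforward mu (-%R : R -> measurableTypeR R))).
  rewrite (@ge0_integral_pushforward _ _ (measurableTypeR R) (measurableTypeR R) R _ measurable_opp mu I (fun x => `|(u x)%:E|%E)) //=.
    by rewrite preI.
  apply/measurable_EFinP; apply: measI.
  exact: (measurableT_comp (@normr_measurable R setT) mu_).
by move=> A mA _; exact: lebesgue_measureN.
Qed.

Lemma cint_opp u : meas u -> int1 u -> cint (fun t => u (- t)) = cint u.
Proof.
move=> mu_ iu; congr (_ * fine _).
have preI : (fun t : R => - t) @^-1` I = I.
  by apply/seteqP; split => t /=; rewrite !in_itv/=; lra.
have iu' := int1_opp mu_ iu.
have := @integral_pushforward _ _ (measurableTypeR R) (measurableTypeR R) R _ measurable_opp mu I (EFin \o u).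
rewrite preI => <- //.
- apply: eq_measure_integral; first exact: measurable_opp.
  by move=> mo A mA _; exact: lebesgue_measureN.
- exact/measurable_EFinP.
Qed.

End CircleSymmetry.

(** * Square integrable functions *)
Section SquareIntegrable.
Context {R : realType}.
Local Notation C := R[i].
Local Notation V := (C -> C^o).
Implicit Types (f g h : C -> C).

Lemma expi_npi (n : nat) : complex.Im (expi (n%:R * pi) : C) = 0.
Proof.
rewrite expiMn; have -> : expi pi = -1 :> C.
  by rewrite /expi cospi sinpi; apply/eqP; rewrite eq_complex /= oppr0 !eqxx.
by elim: n => [|n]; rewrite ?expr0// exprS mulN1r; case: (_ ^+ n) => a b /= ->; rewrite oppr0.
Qed.

Lemma sin_npi (n : nat) : sin (n%:R * pi) = 0 :> R.
Proof. exact: expi_npi. Qed.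

Lemma cint_cos (n : nat) : (0 < n)%N -> cint (fun t => cos (n%:R * t)) = 0 :> R.
Proof.
move=> n0; have n0' : n%:R != 0 :> R by rewrite pnatr_eq0 -lt0n.
pose F (t : R) : R := n%:R^-1 * sin (n%:R * t).
have dF (t : R) : is_derive t (1 : R) F (cos (n%:R * t)).
  apply: is_derive_eq; by rewrite /GRing.scale/=; field.
rewrite /cint /Rintegral (@continuous_FTC2 R _ F).
- rewrite /F mulrN sinN sin_npi/=; ring.
- by have := pi_gt0 R; lra.
- apply: continuous_subspaceT => t; apply: continuous_comp; last exact: continuous_cos.
  by apply: cvgMl_tmp; exact: cvg_id.
- have cF : continuous F by move=> t; apply: differentiable_continuous; apply/derivable1_diffP; exact: (@ex_derive _ _ _ _ _ _ _ (dF t)).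
  split.
  + by move=> t _; exact: (@ex_derive _ _ _ _ _ _ _ (dF t)).
  + by apply: cvg_at_right_filter; exact: cF.
  + by apply: cvg_at_left_filter; exact: cF.
- by move=> t _; rewrite derive1E; exact: (@derive_val _ _ _ _ _ _ _ (dF t)).
Qed.

Lemma mT_Xz (n : int) : mT (fun z : C => z ^ n).
Proof.
case: n => n; first exact: mTX.
rewrite NegzE; apply: (mT_circle _ (mTJ (mTX n.+1))) => t.
by rewrite -expiXz_conj.
Qed.

Lemma L1T_Xz (n : int) : L1T (fun z : C => z ^ n).
Proof.
by apply: (L1T_le (mT_Xz n) (int1_cst 1)) => t; rewrite normc_expiXz.
Qed.

(** The cosine has a primitive vanishing at both ends of the period; the sine is odd. *)
Lemma intT_Xz (n : int) : intT (fun z : C => z ^ n) = (n == 0)%:R.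
Proof.
have pos (m : nat) : (0 < m)%N -> intT (fun z : C => z ^+ m) = 0.
  move=> m0; rewrite intTE; apply/eqP; rewrite eq_complex /=; apply/andP; split; apply/eqP.
    by rewrite -[RHS](cint_cos m0); apply: eq_cint => t _; rewrite -expiMn.
  pose u (t : R) : R := sin (m%:R * t).
  have mu_ : meas u.
    apply: meas_continuous => t; apply: continuous_comp; last exact: continuous_sin.
    by apply: cvgMl_tmp; exact: cvg_id.
  have iu : int1 u.
    by apply: (int1_le mu_ _ (int1_cst 1)) => t; rewrite ler_norml sin_geN1 sin_le1.
  have : cint u = - cint u.
    rewrite -{1}(cint_opp mu_ iu) -cintN//; apply: eq_cint => t _.
    by rewrite /u mulrN sinN.
  move=> /eqP; rewrite -addr_eq0 -mulr2n mulrn_eq0/= => /eqP h.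
  by rewrite -[RHS]h; apply: eq_cint => t _; rewrite -expiMn.
case: n => [[|n]|n].
- by rewrite -[RHS](intT_cst 1); apply: eq_intT => t; rewrite expr0z.
- exact: pos.
rewrite NegzE oppr_eq0; transitivity ((intT (fun z : C => z ^+ n.+1))^*%C).
  rewrite -intTJ; last exact: (L1T_Xz n.+1).
  by apply: eq_intT => t; rewrite -expiXz_conj.
by rewrite pos// rmorph0.
Qed.

Lemma L2E f : L2 f <-> mT f /\ int1 (fun t => normc (f (expi t)) ^+ 2).
Proof. by split=> [[]|[[]]]. Qed.

Lemma L2_mT f : L2 f -> mT f. Proof. by case. Qed.

Lemma L2_le f g (M : R) : mT f -> L2 g -> (forall t, normc (f (expi t)) <= M * normc (g (expi t))) -> L2 f.
Proof.
move=> mf /L2E[mg ig] fg; apply/L2E; split=> //.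
apply: (int1_le _ _ (int1Z (M ^+ 2) ig)) => [|t].
  by apply: measurable_funX; exact: mT_normc.
rewrite ger0_norm ?sqr_ge0// -exprMn ler_pXn2r ?nnegrE ?normc_ge0//.
exact: (le_trans (normc_ge0 _) (fg t)).
Qed.

Lemma L2D f g : L2 f -> L2 g -> L2 (fun z => f z + g z).
Proof.
move=> /L2E[mf f2] /L2E[mg g2]; apply/L2E; split; first exact: mTD.
apply: (int1_le _ _ (int1Z 2 (int1D f2 g2))) => [|t].
  by apply: measurable_funX; exact: (mT_normc (mTD mf mg)).
rewrite ger0_norm ?sqr_ge0//.
set a := normc (f _); set b := normc (g _).
apply: (@le_trans _ _ ((a + b) ^+ 2)).
  by rewrite ler_pXn2r ?nnegrE ?addr_ge0 ?normc_ge0// le_normcD.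
by have := sqr_ge0 (a - b); lra.
Qed.

Lemma L2_bounded_mul f g (M : R) : mT g -> (forall t, normc (g (expi t)) <= M) ->
  L2 f -> L2 (fun z => g z * f z).
Proof.
move=> mg gM f2; apply: (@L2_le _ f M) => //; first exact: mTM mg (L2_mT f2).
by move=> t; rewrite normcM ler_wpM2r// normc_ge0.
Qed.

Lemma L2Z c f : L2 f -> L2 (fun z => c * f z).
Proof. by apply: (@L2_bounded_mul f (cst c) (normc c)) => //; exact: mT_cst. Qed.

Lemma L2_cst (c : C) : L2 (cst c).
Proof. by apply/L2E; split; [exact: mT_cst|exact: (int1_cst (normc c ^+ 2))]. Qed.

Lemma L2J f : L2 f -> L2 (fun z => (f z)^*%C).
Proof.
move=> f2; apply: (@L2_le _ f 1) => //; first exact: mTJ (L2_mT f2).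
by move=> t; rewrite mul1r normcJ.
Qed.

Lemma L2_Xz n : L2 (fun z : C => z ^ n).
Proof.
apply: (@L2_le _ (cst 1) 1); [exact: mT_Xz|exact: L2_cst|].
by move=> t; rewrite normc_expiXz mul1r normc1.
Qed.

Lemma L2_Xz_mul n f : L2 f -> L2 (fun z => z ^ n * f z).
Proof.
by apply: (@L2_bounded_mul f (fun z => z ^ n) 1); [exact: mT_Xz|move=> t; rewrite normc_expiXz].
Qed.

Lemma L2_circle f g : (forall t, f (expi t) = g (expi t)) -> L2 f -> L2 g.
Proof.
move=> fg f2; apply: (@L2_le _ f 1) => //; first exact: mT_circle fg (L2_mT f2).
by move=> t; rewrite mul1r fg.
Qed.

Lemma L2M f g : L2 f -> L2 g -> L1T (fun z => f z * g z).
Proof.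
move=> /L2E[mf f2] /L2E[mg g2]; apply: (L1T_le (mTM mf mg) (int1D f2 g2)) => t.
rewrite normcM; set a := normc (f _); set b := normc (g _).
by have := sqr_ge0 (a - b); have := mulr_ge0 (normc_ge0 (f (expi t))) (normc_ge0 (g (expi t)));
  rewrite -/a -/b; have := sqr_ge0 a; have := sqr_ge0 b; lra.
Qed.

Lemma L2MJ f g : L2 f -> L2 g -> L1T (fun z => f z * (g z)^*%C).
Proof. by move=> f2 g2; apply: L2M => //; exact: L2J. Qed.

Lemma L2_L1 f : L2 f -> L1T f.
Proof.
move=> f2; rewrite (_ : f = (fun z => f z * (cst 1) z)); first by apply: L2M => //; exact: L2_cst.
by apply/funext => z; rewrite mulr1.
Qed.

Lemma dotT_sqn f : complex.Re (dotT f f) = cint (fun t => normc (f (expi t)) ^+ 2).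
Proof. by rewrite /dotT intTE /=; apply: eq_cint => t _; rewrite Re_mulJ. Qed.

Lemma L2_prehilbert : @prehilbert R V L2 dotT.
Proof.
split.
- exact: (L2_cst 0).
- by move=> f g; exact: L2D.
- by move=> a f; exact: L2Z.
- move=> f g h f2 g2 h2; rewrite /dotT -intTD; try exact: L2MJ.
  by apply: eq_intT => t; rewrite -mulrDl.
- move=> a f g f2 g2; rewrite /dotT -intTZ; last exact: L2MJ.
  by apply: eq_intT => t; rewrite mulrA.
- move=> f g f2 g2; rewrite /dotT -intTJ; last exact: L2MJ.
  by apply: eq_intT => t; rewrite rmorphM/= conjcK mulrC.
- by move=> f f2; rewrite dotT_sqn; apply: cint_ge0 => t; exact: sqr_ge0.
Qed.

Lemma ae_dotT f f' g g' : L2 f -> L2 f' -> L2 g -> L2 g' ->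
  aeT f f' -> aeT g g' -> dotT f g = dotT f' g'.
Proof.
move=> f2 f2' g2 g2' ff gg; apply: ae_intT; try exact: (L2MJ _ _).1.
by move: ff gg; apply: ae_imp2 => t -> ->.
Qed.

Lemma aeT_refl f : aeT f f. Proof. exact: ae_all. Qed.
Lemma aeT_sym f g : aeT f g -> aeT g f. Proof. by apply: ae_imp => t ->. Qed.
Lemma aeT_trans f g h : aeT f g -> aeT g h -> aeT f h.
Proof. by apply: ae_imp2 => t -> ->. Qed.

Lemma dotT_definite f : L2 f -> dotT f f = 0 -> aeT f (fun=> 0).
Proof.
move=> /L2E[mf f2] f0.
have : cint (fun t => normc (f (expi t)) ^+ 2) = 0 by rewrite -dotT_sqn f0.
move=> /(cint_eq0_ae f2) h.
have := ae_one_period (Q := fun z => f z = 0); apply.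
have /h : forall t, 0 <= normc (f (expi t)) ^+ 2 by move=> t; exact: sqr_ge0.
by apply: ae_imp => t ft It; apply/eq0_normc/eqP; rewrite -sqrf_eq0; apply/eqP/ft.
Qed.

Lemma fourierE f (n : int) : fourier f n = dotT f (fun z => z ^ n).
Proof. by apply: eq_intT => t; rewrite expiXz_conj. Qed.

Lemma fourier_Xz n m : fourier (fun z => z ^ n) m = (n == m)%:R :> C.
Proof.
rewrite -subr_eq0 -intT_Xz; apply: eq_intT => t.
by rewrite -expfzDr// expi_neq0.
Qed.

Lemma fourier_Xz_mul f n m : fourier (fun z => z ^ n * f z) m = fourier f (m - n).
Proof.
apply: eq_intT => t; rewrite mulrAC mulrC -expfzDr ?expi_neq0//.
by rewrite opprB addrC.
Qed.

Lemma L1T_Xz_mul n f : L1T f -> L1T (fun z => z ^ n * f z).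
Proof.
by apply: (@L1T_bounded_mul _ f (fun z => z ^ n) 1); [exact: mT_Xz|move=> t; rewrite normc_expiXz].
Qed.

Lemma L1T_mul_Xz n f : L1T f -> L1T (fun z => f z * z ^ n).
Proof.
by move=> f1; rewrite (_ : (fun _ => _) = (fun z => z ^ n * f z)); [exact: L1T_Xz_mul|apply/funext => z; rewrite mulrC].
Qed.

Lemma fourierD f g n : L1T f -> L1T g -> fourier (fun z => f z + g z) n = fourier f n + fourier g n.
Proof.
move=> f1 g1; rewrite /fourier -intTD; try exact: L1T_mul_Xz.
by apply: eq_intT => t; rewrite mulrDl.
Qed.

Lemma fourierZ c f n : L1T f -> fourier (fun z => c * f z) n = c * fourier f n.
Proof.
move=> f1; rewrite /fourier -intTZ; last exact: L1T_mul_Xz.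
by apply: eq_intT => t; rewrite mulrA.
Qed.

Lemma fourierB f g n : L1T f -> L1T g -> fourier (fun z => f z - g z) n = fourier f n - fourier g n.
Proof.
move=> f1 g1; rewrite /fourier -intTB; try exact: L1T_mul_Xz.
by apply: eq_intT => t; rewrite mulrBl.
Qed.

Lemma ae_fourier f g n : mT f -> mT g -> aeT f g -> fourier f n = fourier g n.
Proof.
move=> mf mg fg; apply: ae_intT; try by apply: mTM => //; exact: mT_Xz.
by move: fg; apply: ae_imp => t ->.
Qed.

Lemma fourierJ f n : L1T f -> fourier (fun z => (f z)^*%C) n = (fourier f (- n))^*%C.
Proof.
move=> f1; rewrite /fourier -intTJ; last exact: L1T_mul_Xz.
by apply: eq_intT => t; rewrite rmorphM/= expiXz_conj opprK.
Qed.

Lemma normc_fourier f n : L1T f -> normc (fourier f n) <= 2 * cint (fun t => normc (f (expi t))).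
Proof.
move=> f1; apply: (le_trans (normc_intT (L1T_mul_Xz _ f1))).
rewrite le_eqVlt; apply/orP; left; apply/eqP; congr (_ * _); apply: eq_cint => t _.
by rewrite normcM normc_expiXz mulr1.
Qed.

Lemma mT_reflect f : mT f -> mT (fun z => f z^*%C).
Proof.
move=> [f1 f2]; split.
  rewrite (_ : (fun _ => _) = (fun t => complex.Re (f (expi t))) \o -%R).
    exact: (measurableT_comp f1 measurable_opp).
  by apply/funext => t /=; rewrite expiN.
rewrite (_ : (fun _ => _) = (fun t => complex.Im (f (expi t))) \o -%R).
  exact: (measurableT_comp f2 measurable_opp).
by apply/funext => t /=; rewrite expiN.
Qed.

Lemma L1T_reflect f : L1T f -> L1T (fun z => f z^*%C).
Proof.
move=> [mf f1]; split; first exact: mT_reflect.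
by have := int1_opp (mT_normc mf) f1; under [X in int1 X]eq_fun do rewrite expiN.
Qed.

Lemma L2_reflect f : L2 f -> L2 (fun z => f z^*%C).
Proof.
move=> /L2E[mf f2]; apply/L2E; split; first exact: mT_reflect.
have mn : meas (fun t => normc (f (expi t)) ^+ 2) by apply: measurable_funX; exact: mT_normc.
by have := int1_opp mn f2; under [X in int1 X]eq_fun do rewrite expiN.
Qed.

Lemma intT_reflect f : L1T f -> intT (fun z => f z^*%C) = intT f.
Proof.
move=> f1; rewrite !intTE; congr Complex.
  rewrite -[RHS](cint_opp f1.1.1 (L1T_Re f1)); apply: eq_cint => t _.
  by rewrite expiN.
rewrite -[RHS](cint_opp f1.1.2 (L1T_Im f1)); apply: eq_cint => t _.
by rewrite expiN.
Qed.

Lemma L2_invC f : L2 f -> L2 (invC f).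
Proof. by move=> f2; apply: L2J (L2_reflect f2). Qed.

Lemma fourier_invC f n : L1T f -> fourier (invC f) n = (fourier f n)^*%C.
Proof.
move=> f1; rewrite /invC fourierJ; last exact: L1T_reflect.
congr (_^*%C); rewrite /fourier -intT_reflect; last first.
  by apply: L1T_mul_Xz; exact: L1T_reflect.
by apply: eq_intT => t; rewrite conjcK opprK -expiV exprz_inv.
Qed.

Lemma aeT_invC f g : aeT f g -> aeT (invC f) (invC g).
Proof.
by move=> fg; have := ae_opp fg; apply: ae_imp => t; rewrite /invC expiN => ->.
Qed.

Lemma invCK f : invC (invC f) = f.
Proof. by apply/funext => z; rewrite /invC !conjcK. Qed.

End SquareIntegrable.

(** * Completeness of the space of square integrable functions *)
Section L2Complete.
Context {R : realType}.
Local Notation C := R[i].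
Local Notation mu := (@lebesgue_measure R).
Local Notation V := (C -> C^o).
Local Notation I := (`[- pi, pi]%classic : set R).
Local Notation nrm := (@nrm R V dotT).
Local Notation sqn := (@sqn R V dotT).
Implicit Types (f g h : C -> C).

Lemma cvgn_geometric_increments (x : R^nat) (B : R) :
  (forall k, `|x k.+1 - x k| <= B * 2^-1 ^+ k) -> cvgn x.
Proof.
move=> xB.
have -> : x = (fun n => x 0%N + series (telescope x) n).
  by apply/funext => n; exact: eq_sum_telescope.
apply: is_cvgD; first exact: is_cvg_cst.
apply: normed_cvg; apply: (@series_le_cvg _ _ (geometric B 2^-1)).
- by move=> n; exact: normr_ge0.
- by move=> n; apply: le_trans (xB n); exact: normr_ge0.
- by move=> n; exact: xB.
- apply: is_cvg_geometric_series; rewrite ger0_norm ?invr_ge0//.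
  by rewrite invf_lt1// ltr1n.
Qed.

Lemma integral_normc2 f : L2 f ->
  (\int[mu]_(t in I) (normc (f (expi t)) ^+ 2)%:E = (2 * pi * sqn f)%:E)%E.
Proof.
move=> /L2E[mf f2]; rewrite -[LHS]fineK; last exact: (@integrable_fin_num _ _ R mu I).
congr (_%:E); rewrite /sqn dotT_sqn /cint /Rintegral.
have := pi_gt0 R => p0; rewrite mulrA; have -> : 2 * pi * (pi - - pi)^-1 = 1 :> R by field; lra.
by rewrite mul1r.
Qed.

Lemma limn_einf_le (u : (\bar R)^nat) (M : \bar R) K :
  (forall k, (K <= k)%N -> (u k <= M)%E) -> (limn_einf u <= M)%E.
Proof.
move=> uM; rewrite limn_einf_lim; apply: lime_le; first exact: is_cvg_einfs.
exists K => // n /= Kn; apply: (le_trans _ (uM _ Kn)).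
by apply: ereal_inf_lbound; exists n => /=.
Qed.

Lemma geometric4_sum (n : nat) : \sum_(k < n) (4^-1 : R) ^+ k <= 2.
Proof.
have -> : \sum_(k < n) (4^-1 : R) ^+ k = 4 / 3 * (1 - 4^-1 ^+ n).
  elim: n => [|n IH]; first by rewrite big_ord0 expr0 subrr mulr0.
  by rewrite big_ord_recr/= IH exprS; field.
have : 0 <= (4^-1 : R) ^+ n by apply: exprn_ge0; rewrite invr_ge0.
lra.
Qed.

(** The series of the [4^k |v_(k+1) - v_k|^2] has a finite integral, hence a finite
    sum almost everywhere, and there the increments are [O(2^-k)]. *)
Lemma rapid_cauchy_ae (v : nat -> C -> C) : (forall k, L2 (v k)) ->
  (forall k, nrm (v k.+1 - v k) <= 4^-1 ^+ k) ->
  {ae mu, forall t, I t -> cvgn (fun k => complex.Re (v k (expi t))) /\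
     cvgn (fun k => complex.Im (v k (expi t)))}.
Proof.
move=> v2 vc.
have d2 k : L2 (fun z => v k.+1 z - v k z) by exact: (DB L2_prehilbert (v2 _) (v2 _)).
pose d k t := normc (v k.+1 (expi t) - v k (expi t)) ^+ 2.
pose w k t := 4 ^+ k * d k t.
have w0 k t : 0 <= w k t by apply: mulr_ge0; [exact: exprn_ge0|exact: sqr_ge0].
have mw k : measurable_fun I (fun t => (w k t)%:E).
  apply/measurable_EFinP; apply: measI; apply: measurable_funM => //.
  by apply: measurable_funX; exact: (mT_normc (L2_mT (d2 k))).
pose G t := (\sum_(0 <= k <oo) (w k t)%:E)%E.
have G0 t : (0 <= G t)%E by apply: nneseries_ge0 => k _ _; rewrite lee_fin.
have mG : measurable_fun I G.
  by apply: ge0_emeasurable_sum => [k t It _|k _]; [rewrite lee_fin|exact: mw].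
have intG : (\int[mu]_(t in I) G t < +oo)%E.
  rewrite integral_nneseries//; last by move=> n x _; rewrite lee_fin.
  apply: (@le_lt_trans _ _ (2 * pi * 2)%:E); last exact: ltry.
  apply: lime_le.
    by apply: is_cvg_nneseries => n _ _; apply: integral_ge0 => t _; rewrite lee_fin.
  apply: nearW => n; rewrite big_mkord.
  apply: (@le_trans _ _ (\sum_(k < n) (2 * pi * 4^-1 ^+ k)%:E)%E).
    apply: lee_sum => k _; under eq_integral do rewrite EFinM.
    rewrite ge0_integralZl_EFin//; last 2 first.
    - by move=> t _; rewrite lee_fin sqr_ge0.
    - apply/measurable_EFinP; apply: measI.
      by apply: measurable_funX; exact: (mT_normc (L2_mT (d2 k))).
    rewrite (integral_normc2 (d2 k)) -EFinM lee_fin mulrCA.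
    apply: ler_wpM2l; first by have := pi_gt0 R; lra.
    rewrite -(sqr_nrm L2_prehilbert (d2 k)).
    have n0 := nrm_ge0 (dot := dotT) (v k.+1 - v k); have nk := vc k.
    have -> : (4^-1 : R) ^+ k = 4 ^+ k * (4^-1 ^+ k) ^+ 2.
      by rewrite expr2 mulrA -exprMn mulfV ?expr1n ?mul1r// pnatr_eq0.
    apply: ler_wpM2l; first exact: exprn_ge0.
    by rewrite ler_pXn2r ?nnegrE ?exprn_ge0// invr_ge0.
  rewrite sumEFin lee_fin -mulr_sumr; apply: ler_wpM2l; last exact: geometric4_sum.
  by have := pi_gt0 R; lra.
have iG : mu.-integrable I G.
  by apply/integrableP; split => //; under eq_integral => t _ do rewrite gee0_abs//.
have := @integrable_ae _ _ R mu I (@measurable_I R) _ iG.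
apply: ae_imp => t Gfin It; have {}Gfin := Gfin It.
pose B := fine (G t).
have wB k : w k t <= B.
  rewrite -lee_fin /B fineK//.
  apply: (@le_trans _ _ (\sum_(0 <= i < k.+1) (w i t)%:E)%E).
    by rewrite big_nat_recr//= leeDr// sume_ge0// => i _; rewrite lee_fin.
  by apply: nneseries_lim_ge => i _ _; rewrite lee_fin.
have dB k : normc (v k.+1 (expi t) - v k (expi t)) <= Num.sqrt B * 2^-1 ^+ k.
  have B0 : 0 <= B by apply: le_trans (w0 0%N t) (wB 0%N).
  rewrite -(@ler_pXn2r _ 2) ?nnegrE ?normc_ge0 ?mulr_ge0 ?sqrtr_ge0 ?exprn_ge0 ?invr_ge0//.
  rewrite exprMn sqr_sqrtr// -/(d k t).
  have p4 : (0 : R) < 4 ^+ k by rewrite exprn_gt0.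
  rewrite -(ler_pM2l p4); apply: (le_trans (wB k)).
  have -> : (4 : R) ^+ k * (B * (2^-1 ^+ k) ^+ 2) = B * (4 ^+ k * (2^-1 ^+ k * 2^-1 ^+ k)) by ring.
  rewrite -!exprMn (_ : 4 * (2^-1 * 2^-1) = 1 :> R); last by field.
  by rewrite expr1n mulr1.
split.
  apply: (@cvgn_geometric_increments _ (Num.sqrt B)) => k; apply: le_trans (dB k).
  by rewrite -ReN -ReD; exact: ler_normRe_normc.
apply: (@cvgn_geometric_increments _ (Num.sqrt B)) => k; apply: le_trans (dB k).
rewrite (_ : complex.Im _ - complex.Im _ = complex.Im (v k.+1 (expi t) - v k (expi t))).
  exact: ler_normIm_normc.
by case: (v k.+1 _); case: (v k _).
Qed.

(** A subsequence with geometrically small increments converges almost everywhere, and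
    Fatou's lemma shows that its pointwise limit is the limit in norm. *)
Lemma L2_complete : @complete_nrm R V L2 dotT.
Proof.
move=> u u2 uc.
have e0 k : (0 : R) < 4^-1 ^+ k by rewrite exprn_gt0// invr_gt0.
have /choice[N hN] := fun k => uc _ (e0 k).
(* [M] is monotone and dominates both [N] and the identity, so that [u \o M] has
   increments below [4^-k]. *)
pose M := fix M k := if k is k'.+1 then maxn (M k') (maxn (N k) k) else N 0%N.
have NM k : (N k <= M k)%N by case: k => //= k; rewrite !leq_max leqnn orbT.
have kM k : (k <= M k)%N by case: k => //= k; rewrite !leq_max leqnn !orbT.
have MM k : (M k <= M k.+1)%N by exact: leq_maxl.
pose v k := u (M k).
have v2 k : L2 (v k) by exact: u2.
have vc k : nrm (v k.+1 - v k) <= 4^-1 ^+ k.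
  by apply: ltW; apply: (hN k) => //; apply: leq_trans (NM k) (MM k).
(* The upper limit is measurable even where the sequence diverges. *)
pose lR z := fine (limn_esup (fun k => (complex.Re (v k z))%:E)).
pose lI z := fine (limn_esup (fun k => (complex.Im (v k z))%:E)).
pose l : C -> C := fun z => Complex (lR z) (lI z).
have ml : mT l.
  have mf (F : nat -> C -> R) : (forall k, meas (fun t => F k (expi t))) ->
      meas (fun t => fine (limn_esup (fun k => (F k (expi t))%:E))).
    move=> mF; apply: (measurableT_comp (fine_measurable measurableT)).
    by apply: measurable_fun_limn_esup => k; apply/measurable_EFinP; exact: mF.
  by split; apply: (mf (fun k z => _ (v k z))) => k; [exact: (L2_mT (v2 k)).1|exact: (L2_mT (v2 k)).2].
have ae_lim : {ae mu, forall t, I t -> (fun k => complex.Re (v k (expi t))) @ \oo --> lR (expi t) /\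
     (fun k => complex.Im (v k (expi t))) @ \oo --> lI (expi t)}.
  have := rapid_cauchy_ae v2 vc; apply: ae_imp => t h It.
  have key (x : R^nat) : cvgn x -> x @ \oo --> fine (limn_esup (fun k => (x k)%:E)).
    move=> cx; have cx' : (fun k => (x k)%:E) @ \oo --> (lim (x @ \oo))%:E by apply/fine_cvgP; split; [exact: nearW|exact: cx].
    rewrite is_cvg_limn_esupE; last by apply/cvg_ex; eexists; exact: cx'.
    by rewrite (cvg_lim _ cx').
  by have [h1 h2] := h It; split; exact: key.
have bound n (e : R) K : (forall k, (K <= k)%N -> sqn (v k - u n) <= e) ->
    (\int[mu]_(t in I) (normc (l (expi t) - u n (expi t)) ^+ 2)%:E <= (2 * pi * e)%:E)%E.
  move=> hK.
  pose F k t := (normc (v k (expi t) - u n (expi t)) ^+ 2)%:E.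
  have D2 k : L2 (fun z => v k z - u n z) by exact: (DB L2_prehilbert (v2 _) (u2 _)).
  have mF k : measurable_fun I (F k).
    apply/measurable_EFinP; apply: measI; apply: measurable_funX.
    exact: (mT_normc (L2_mT (D2 k))).
  have -> : (\int[mu]_(t in I) (normc (l (expi t) - u n (expi t)) ^+ 2)%:E =
     \int[mu]_(t in I) limn_einf (F^~ t))%E.
    apply: ae_eq_integral => //.
    - apply/measurable_EFinP; apply: measI; apply: measurable_funX.
      exact: (mT_normc (mTB ml (L2_mT (u2 n)))).
    - rewrite (_ : (fun _ => _) = (-%E \o (fun t => limn_esup (fun k => (- F k t)%E)))).
        apply: measurableT_comp => //; apply: measurable_fun_limn_esup => k.
        exact: (measurableT_comp _ (mF k)).
      apply/funext => t /=; rewrite -limn_einfN; congr limn_einf.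
      by apply/funext => k; rewrite /comp /F /= opprK.
    - move: ae_lim; apply: ae_imp => t h It; have [hR hI] := h It.
      have c : F^~ t @ \oo --> (normc (l (expi t) - u n (expi t)) ^+ 2)%:E.
        under eq_fun do rewrite /F sqr_normcE.
        rewrite sqr_normcE; apply/fine_cvgP; split; first exact: nearW.
        have Re_B (a b : C) : complex.Re (a - b) = complex.Re a - complex.Re b.
          by rewrite ReD ReN.
        have Im_B (a b : C) : complex.Im (a - b) = complex.Im a - complex.Im b.
          by rewrite ImD; case: b.
        rewrite /comp /= !Re_B !Im_B; under eq_fun do rewrite Re_B Im_B.
        by apply: cvgD; (apply: cvgM; apply: cvgB; [done|exact: cvg_cst|done|exact: cvg_cst]).
      by rewrite is_cvg_limn_einfE; [rewrite (cvg_lim _ c)|apply/cvg_ex; eexists; exact: c].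
  have F0 k t : I t -> (0 <= F k t)%E by rewrite lee_fin sqr_ge0.
  apply: (le_trans (@fatou _ _ R mu I (@measurable_I R) F mF F0)).
  apply: (@limn_einf_le _ _ K) => k Kk; rewrite (integral_normc2 (D2 k)) lee_fin.
  by apply: ler_wpM2l; [have := pi_gt0 R; lra|exact: hK].
have close (e : R) : 0 < e -> exists K, forall n, (K <= n)%N ->
    L2 (fun z => l z - u n z) /\ nrm (l - u n) <= e.
  move=> e0'; have [K hK] := uc _ e0'; exists K => n Kn.
  have := bound n (e ^+ 2) K; set J := (\int[_]_(_ in _) _)%E => hb.
  have {}hb : (J <= (2 * pi * e ^+ 2)%:E)%E.
    apply: hb => k Kk; apply: ltW; rewrite -(lt_nrm_sqn L2_prehilbert) ?ltW//.
      by apply: hK => //; exact: leq_trans Kk (kM k).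
    exact: (DB L2_prehilbert (v2 _) (u2 _)).
  have ml' := mTB ml (L2_mT (u2 n)).
  have l2 : L2 (fun z => l z - u n z).
    apply/L2E; split=> //; apply/integrableP; split.
      by apply/measurable_EFinP; apply: measI; apply: measurable_funX; exact: (mT_normc ml').
    apply: le_lt_trans (ltry (2 * pi * e ^+ 2)); apply: le_trans hb.
    by rewrite le_eqVlt; apply/orP; left; apply/eqP; apply: eq_integral => t _ /=; rewrite ger0_norm ?sqr_ge0.
  split=> //; move: hb; rewrite /J (integral_normc2 l2) lee_fin ler_pM2l; last by have := pi_gt0 R; lra.
  by rewrite -(sqr_nrm L2_prehilbert l2) ler_pXn2r // nnegrE ?nrm_ge0 ?(ltW e0').
have l2 : L2 l.
  have [K hK] := close 1 ltr01; have [h _] := hK _ (leqnn K).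
  by rewrite (_ : l = (fun z => l z - u K z + u K z)); [exact: L2D|apply/funext => z; rewrite subrK].
exists l => //; apply/cvgrPdist_le => e e0'; have [K hK] := close _ e0'.
exists K => // n /= Kn; rewrite sub0r normrN ger0_norm ?nrm_ge0//.
by rewrite (nrmBC L2_prehilbert)//; exact: (hK _ Kn).2.
Qed.

End L2Complete.

(** * Uniqueness of Fourier coefficients *)
Section SmoothStep.
Context {R : realType}.

(** The polynomial [3 y^2 - 2 y^3] maps [0, 1] to itself, and under iteration attracts
    the points below [1/2] to [0] and those above to [1]. It is needed both for real
    values and for complex trigonometric polynomials, hence the generic ring. *)
Definition smoothstep (K : pzRingType) (y : K) : K := y * y * (3%:R - (y + y)).

Lemma smoothstep01 (y : R) : 0 <= y <= 1 -> 0 <= smoothstep y <= 1.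
Proof.
move=> /andP[y0 y1]; apply/andP; split; rewrite /smoothstep.
  by apply: mulr_ge0; [exact: mulr_ge0|lra].
have -> : y * y * (3%:R - (y + y)) = 1 - (1 - y) ^+ 2 * (1 + 2 * y) by ring.
by rewrite gerBl; apply: mulr_ge0; [exact: sqr_ge0|lra].
Qed.

Lemma iter_smoothstep01 n (y : R) : 0 <= y <= 1 -> 0 <= iter n (@smoothstep R) y <= 1.
Proof. by move=> y01; elim: n => //= n IH; exact: smoothstep01. Qed.

Lemma iter_smoothstep_lt (y : R) : 0 <= y < 2^-1 -> (fun n => iter n (@smoothstep R) y) @ \oo --> 0.
Proof.
(* On [0, y] the map contracts towards 0 by the factor [q]. *)
move=> /andP[y0 yh]; pose q := y * (3 - 2 * y).
have q0 : 0 <= q by apply: mulr_ge0 => //; lra.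
have q1 : q < 1.
  have -> : q = 1 - (1 - 2 * y) * (1 - y) by rewrite /q; ring.
  by rewrite gtrBl; apply: mulr_gt0; lra.
have h n : 0 <= iter n (@smoothstep R) y <= y * q ^+ n.
  elim: n => [|n /andP[i0 iy]]; first by rewrite expr0 mulr1 y0 lexx.
  have qn : q ^+ n <= 1 by apply: exprn_ile1 => //; exact: ltW.
  set z := iter n _ _ in i0 iy *.
  have zy : z <= y by apply: (le_trans iy); rewrite ler_piMr.
  rewrite iterS -/z /smoothstep; apply/andP; split.
    by apply: mulr_ge0; [exact: mulr_ge0|lra].
  rewrite exprSr mulrA -mulrA; apply: ler_pM => //; first by apply: mulr_ge0 => //; lra.
  have -> : 3%:R - (z + z) = 3 - 2 * z by ring.
  rewrite /q -subr_ge0.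
  have -> : y * (3 - 2 * y) - z * (3 - 2 * z) = (y - z) * (3 - 2 * (y + z)) by ring.
  by apply: mulr_ge0; lra.
apply: (squeeze_cvgr _ (cvg_cst 0)); first by apply: nearW => n; exact: h.
rewrite -[X in _ --> X](mulr0 y); apply: cvgMl_tmp.
by apply: cvg_expr; rewrite ger0_norm.
Qed.

Lemma smoothstep_sym (y : R) : smoothstep (1 - y) = 1 - smoothstep y.
Proof. rewrite /smoothstep; ring. Qed.

Lemma iter_smoothstep_gt (y : R) : 2^-1 < y <= 1 -> (fun n => iter n (@smoothstep R) y) @ \oo --> (1 : R).
Proof.
move=> /andP[y0 yh].
have h n : iter n (@smoothstep R) y = 1 - iter n (@smoothstep R) (1 - y).
  by elim: n => [|n IH] /=; rewrite ?IH ?smoothstep_sym; ring.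
under eq_fun do rewrite h.
have c : (fun n => 1 - iter n (@smoothstep R) (1 - y)) @ \oo --> (1 - 0 : R).
  apply: cvgB; first exact: cvg_cst.
  by apply: iter_smoothstep_lt; lra.
by rewrite subr0 in c.
Qed.

End SmoothStep.

Section L1Uniqueness.
Context {R : realType}.
Local Notation C := R[i].
Local Notation mu := (@lebesgue_measure R).
Local Notation I := (`[- pi, pi]%classic : set R).
Implicit Types (f g h P Q : C -> C).

Definition fnull h := L1T h /\ forall n : int, fourier h n = 0.

(** The multipliers of [fnull] form an algebra that contains the monomials [z ^ m], so
    polynomials in trigonometric polynomials need not be expanded. *)
Definition fmult P := [/\ mT P, exists M : R, forall t, normc (P (expi t)) <= M &
  forall h, fnull h -> fnull (fun z => P z * h z)].

Lemma fnullD f g : fnull f -> fnull g -> fnull (fun z => f z + g z).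
Proof.
move=> [f1 f0] [g1 g0]; split; first exact: L1TD.
by move=> n; rewrite fourierD// f0 g0 addr0.
Qed.

Lemma fmult_cst (c : C) : fmult (cst c).
Proof.
split; [exact: mT_cst|by exists (normc c)|].
by move=> h [h1 h0]; split; [exact: L1TZ|move=> n; rewrite fourierZ// h0 mulr0].
Qed.

Lemma fmult_Xz (m : int) : fmult (fun z => z ^ m).
Proof.
split; [exact: mT_Xz|by exists 1 => t; rewrite normc_expiXz|].
by move=> h [h1 h0]; split; [exact: L1T_Xz_mul|move=> n; rewrite fourier_Xz_mul].
Qed.

Lemma fmultD P Q : fmult P -> fmult Q -> fmult (fun z => P z + Q z).
Proof.
move=> [mP [MP bP] hP] [mQ [MQ bQ] hQ]; split; first exact: mTD.
  by exists (MP + MQ) => t; apply: (le_trans (le_normcD _ _)); exact: lerD.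
move=> h h0; rewrite (_ : (fun _ => _) = (fun z => P z * h z + Q z * h z)).
  by apply: fnullD; [exact: hP|exact: hQ].
by apply/funext => z; rewrite mulrDl.
Qed.

Lemma fmultM P Q : fmult P -> fmult Q -> fmult (fun z => P z * Q z).
Proof.
move=> [mP [MP bP] hP] [mQ [MQ bQ] hQ]; split; first exact: mTM.
  by exists (MP * MQ) => t; rewrite normcM; apply: ler_pM => //; exact: normc_ge0.
move=> h h0; rewrite (_ : (fun _ => _) = (fun z => P z * (Q z * h z))).
  by apply: hP; exact: hQ.
by apply/funext => z; rewrite mulrA.
Qed.

Lemma fmult_smoothstep P n : fmult P -> fmult (fun z => iter n (@smoothstep C) (P z)).
Proof.
elim: n P => //= n IH P mP; have mQ := IH _ mP.
rewrite /smoothstep; apply: fmultM; first exact: fmultM.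
apply: fmultD; first exact: (fmult_cst 3%:R).
rewrite (_ : (fun _ => _) = (fun z => cst (-1) z * (iter n (@smoothstep C) (P z) + iter n (@smoothstep C) (P z)))).
  by apply: fmultM; [exact: fmult_cst|exact: fmultD].
by apply/funext => z; rewrite mulN1r.
Qed.

(** An affine function of [cos (t - c)] with values in [0, 1], which exceeds [1/2]
    exactly on the arc of centre [c] and half-length [d]; [arc_poly] writes it as a
    trigonometric polynomial. *)
Definition arc_level (c d : R) (t : R) : R := 2^-1 + (cos (t - c) - cos d) / 4.
Definition arc_poly (c d : R) (z : C) : C :=
  (2^-1 - cos d / 4)%:C%C + (8^-1)%:C%C * ((expi c)^*%C * z ^ 1 + expi c * z ^ (-1)).

Lemma fmult_arc_poly c d : fmult (arc_poly c d).
Proof.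
apply: fmultD; first exact: fmult_cst.
apply: (@fmultM (cst _)); first exact: fmult_cst.
by apply: fmultD; (apply: (@fmultM (cst _)); [exact: fmult_cst|exact: fmult_Xz]).
Qed.

Lemma arc_polyE c d t : arc_poly c d (expi t) = (arc_level c d t)%:C%C.
Proof.
rewrite /arc_poly /arc_level expr1z -expiXz_conj expr1z /expi cosB.
by apply/eqP; rewrite eq_complex /=; apply/andP; split; apply/eqP; field => //; rewrite ?pnatr_eq0.
Qed.

Lemma arc_level01 c d t : 0 <= arc_level c d t <= 1.
Proof.
have := cos_le1 (t - c); have := cos_geN1 (t - c).
have := cos_le1 d; have := cos_geN1 d; rewrite /arc_level; lra.
Qed.

Lemma iter_smoothstep_real n (y : R) :
  iter n (@smoothstep C) y%:C%C = (iter n (@smoothstep R) y)%:C%C.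
Proof.
elim: n => //= n ->; by rewrite /smoothstep !(rmorphM, rmorphB, rmorphD, rmorph_nat).
Qed.

Lemma cos_arc_lt (x t : R) : - pi < x -> x < pi -> - pi < t < x ->
  cos ((x + pi) / 2) < cos (t - (x - pi) / 2).
Proof.
move=> x1 x2 /andP[t1 t2]; have p0 := pi_gt0 R.
have key (u : R) : 0 <= u -> u < (x + pi) / 2 -> cos ((x + pi) / 2) < cos u.
  by move=> u0 ux; rewrite ltr_cos// in_itv/=; apply/andP; split; lra.
case: (lerP 0 (t - (x - pi) / 2)) => h; first by apply: key => //; lra.
by rewrite -(cosN (t - _)); apply: key; lra.
Qed.

Lemma cos_arc_gt (x t : R) : - pi < x -> x < pi -> x < t < pi ->
  cos (t - (x - pi) / 2) < cos ((x + pi) / 2).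
Proof.
move=> x1 x2 /andP[t1 t2]; have p0 := pi_gt0 R.
have key (u : R) : (x + pi) / 2 < u -> u <= pi -> cos u < cos ((x + pi) / 2).
  by move=> u0 ux; rewrite ltr_cos// in_itv/=; apply/andP; split; lra.
case: (lerP (t - (x - pi) / 2) pi) => h; first by apply: key => //; lra.
have -> : t - (x - pi) / 2 = - (2 * pi - (t - (x - pi) / 2)) + pi *+ 2.
  by rewrite mulr2n; ring.
by rewrite cosD2pi cosN; apply: key; lra.
Qed.

Lemma ae_neq (a : R) : {ae mu, forall t, t != a}.
Proof.
exists [set a]; split; [exact: measurable_set1|exact: lebesgue_measure_set1|].
by move=> t /= /negP; rewrite negbK => /eqP.
Qed.

(** The iterates of [smoothstep] turn the trigonometric polynomial [arc_poly] into the
    indicator of an arc, boundedly and almost everywhere. *)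
Lemma fnull_integral_arc h (x : R) (u : R -> R) : fnull h -> - pi < x < pi ->
  u = (fun t => complex.Re (h (expi t))) \/ u = (fun t => complex.Im (h (expi t))) ->
  \int[mu]_(t in `[- pi, x]) u t = 0.
Proof.
move=> hn /andP[x1 x2] hu; have p0 := pi_gt0 R.
(* The arc from [- pi] to [x] has centre [c] and half-length [d]. *)
pose c := (x - pi) / 2; pose d := (x + pi) / 2.
pose S n t := iter n (@smoothstep R) (arc_level c d t).
have iu : int1 u by case: hu => ->; [exact: L1T_Re hn.1|exact: L1T_Im hn.1].
have mu_ : meas u by case: hu => ->; [exact: hn.1.1.1|exact: hn.1.1.2].
have SE n t : iter n (@smoothstep C) (arc_poly c d (expi t)) = (S n t)%:C%C.
  by rewrite arc_polyE iter_smoothstep_real.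
have S01 n t : 0 <= S n t <= 1 by apply: iter_smoothstep01; exact: arc_level01.
have mS n : meas (S n).
  have [[m _] _ _] := fmult_smoothstep n (fmult_arc_poly c d).
  by rewrite (_ : S n = (fun t => complex.Re (iter n (@smoothstep C) (arc_poly c d (expi t)))))//;
    apply/funext => t; rewrite SE.
have cS n : cint (fun t => S n t * u t) = 0.
  have [_ _ hP] := fmult_smoothstep n (fmult_arc_poly c d).
  have [_ /(_ 0)] := hP _ hn.
  rewrite /fourier intTE => /eqP; rewrite eq_complex /= => /andP[/eqP hR /eqP hI].
  case: hu => ->.
    rewrite -[RHS]hR; apply: eq_cint => t _.
    by rewrite SE oppr0 expr0z mulr1; case: (h _) => a b /=; rewrite mul0r subr0.
  rewrite -[RHS]hI; apply: eq_cint => t _.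
  by rewrite SE oppr0 expr0z mulr1; case: (h _) => a b /=; rewrite mul0r addr0.
have intS n : (\int[mu]_(t in I) (S n t * u t)%:E = 0)%E.
  have iSu : int1 (fun t => S n t * u t).
    apply: (int1_le (measurable_funM (mS n) mu_) _ (int1_norm iu)) => t.
    by have /andP[s0 s1] := S01 n t; rewrite normrM ger0_norm// ler_piMl.
  rewrite -[LHS]fineK; last exact: (@integrable_fin_num _ _ R mu I).
  congr (_%:E); have := cS n; rewrite /cint => /eqP; rewrite mulf_eq0 invr_eq0.
  by move=> /orP[/eqP|/eqP]; [lra|].
pose l t : R := if t <= x then 1 else 0.
have ml : meas l.
  rewrite (_ : l = \1_(`]-oo, x]%classic)).
    by apply: measurable_indic; exact: measurable_itv.
  by apply/funext => t; rewrite indicE /l mem_setE in_itv/=; case: ifP.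
have lim : {ae mu, forall t, I t -> (fun n => (S n t * u t)%:E) @ \oo --> (l t * u t)%:E}.
  have n1 := ae_neq (- pi); have n2 := ae_neq x; have n3 := ae_neq pi.
  have := ae_imp2 (fun t a b => conj a b) n1 (ae_imp2 (fun t a b => conj a b) n2 n3).
  apply: ae_imp => t [t1 [t2 t3]]; rewrite /= in_itv/= => /andP[tp tp'].
  have {t1 tp} tp : - pi < t by rewrite lt_def t1.
  have {t3 tp'} tp' : t < pi by rewrite lt_def eq_sym t3.
  apply/fine_cvgP; split; first exact: nearW.
  rewrite /comp /=; apply: cvgMr_tmp.
  have /andP[a0 a1] := arc_level01 c d t.
  rewrite /l; case: (ltgtP t x) t2 => // h' _.
    apply: iter_smoothstep_gt; rewrite a1 andbT /arc_level.
    have := @cos_arc_lt x t x1 x2; rewrite tp h' => /(_ isT); rewrite -/c -/d; lra.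
  apply: iter_smoothstep_lt; rewrite a0 /arc_level.
  have := @cos_arc_gt x t x1 x2; rewrite tp' h' => /(_ isT); rewrite -/c -/d; lra.
have dom : {ae mu, forall t, forall n, I t -> (`|(S n t * u t)%:E| <= `|u t|%:E)%E}.
  apply: ae_all => t n _; rewrite lee_fin.
  by have /andP[s0 s1] := S01 n t; rewrite normrM ger0_norm// ler_piMl.
have [_ _ c0] := @dominated_convergence _ _ R mu I (@measurable_I R)
   (fun n t => (S n t * u t)%:E) (fun t => (l t * u t)%:E) (fun t => `|u t|%:E)
   (fun n => (measurable_EFinP _ _).2 (measI (measurable_funM (mS n) mu_)))
   ((measurable_EFinP _ _).2 (measI (measurable_funM ml mu_))) lim (int1_norm iu) dom.
move: c0; rewrite /=; under eq_fun do rewrite intS.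
move=> c0; have il0 : (\int[mu]_(t in I) (l t * u t)%:E = 0)%E.
  by have := cvg_lim _ c0; rewrite lim_cst// => ->.
rewrite /Rintegral; suff -> : (\int[mu]_(t in `[(- pi)%R, x]) (u t)%:E = \int[mu]_(t in I) (l t * u t)%:E)%E.
  by rewrite il0.
have -> : `[- pi, x]%classic = I `&` `]-oo, x]%classic.
  by apply/seteqP; split => t /=; rewrite !in_itv/=; [move=> /andP[-> h'] | move=> [/andP[-> _] ->]]; split=> //; lra.
rewrite integral_mkcondr; apply: eq_integral => t _.
by rewrite patchE mem_setE in_itv/= /l; case: ifP; rewrite ?mul1r ?mul0r.
Qed.

(** All integrals of [h] from [- pi] to [x] vanish, and Lebesgue's differentiation
    theorem recovers [h] from them. *)
Lemma fnull_ae0 h : fnull h -> aeT h (fun=> 0).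
Proof.
move=> hn; have p0 := pi_gt0 R.
have key u : u = (fun t => complex.Re (h (expi t))) \/ u = (fun t => complex.Im (h (expi t))) ->
    {ae mu, forall t, I t -> u t = 0}.
  move=> hu; have iu : int1 u by case: hu => ->; [exact: L1T_Re hn.1|exact: L1T_Im hn.1].
  have loc := integrable_locally_restrict (@measurable_I R) iu.
  have intf y : mu.-integrable [set` Interval (BLeft (- pi)) (BRight y)] (EFin \o (u \_ I)).
    have : mu.-integrable setT (EFin \o (u \_ I)).
      by rewrite -restrict_EFin; apply/(integrable_mkcond _ _).1 => //; exact: measurable_I.
    by apply: integrableS.
  have := FTC1 intf loc.
  apply: ae_imp2 (ae_imp2 (fun t a b => conj a b) (ae_neq (- pi)) (ae_neq pi)) => t.
  move=> [t1 t2] h1; rewrite /= in_itv/= => /andP[tp tp'].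
  have {t1 tp} tp : - pi < t by rewrite lt_def t1.
  have {t2 tp'} tp' : t < pi by rewrite lt_def eq_sym t2.
  have h2 : ((- pi)%:E < t%:E)%E by rewrite lte_fin.
  have [_] := h1 h2.
  rewrite derive1E (@near_eq_derive _ _ _ _ (cst 0)).
    by rewrite derive_cst patchE ifT// inE/= in_itv/= !ltW.
  near=> y; rewrite /=.
  have y2 : y < pi by near: y; exact: lt_nbhsl.
  rewrite (_ : \int[mu]_(t0 in _) _ = \int[mu]_(t0 in `[- pi, y]) u t0).
    apply: (fnull_integral_arc hn) => //.
    by apply/andP; split => //; near: y; exact: lt_nbhsr.
  apply: eq_Rintegral => r; rewrite inE/= in_itv/= => /andP[r1 r2].
  rewrite patchE ifT// inE/= in_itv/= r1/=; exact: (le_trans r2 (ltW y2)).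
have hR := key _ (or_introl erefl); have hI := key _ (or_intror erefl).
apply: (@ae_one_period _ (fun z => h z = 0)).
move: hR hI; apply: ae_imp2 => t h1 h2 It; have := h1 It; have := h2 It.
by case: (h _) => a b /= -> ->.
Unshelve. all: by end_near. Qed.

Lemma fourier_inj f g : L1T f -> L1T g -> (forall n, fourier f n = fourier g n) -> aeT f g.
Proof.
move=> f1 g1 fg; have : fnull (fun z => f z - g z).
  by split; [exact: L1TB|move=> n; rewrite fourierB// fg subrr].
by move=> /fnull_ae0; apply: ae_imp => t /eqP; rewrite subr_eq0 => /eqP.
Qed.

End L1Uniqueness.

(** * Hardy functions as coefficient sequences *)
Section HardySequences.
Context {R : realType}.
Local Notation C := R[i].
Local Notation V := (C -> C^o).
Local Notation seqC := (nat -> C^o).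
Implicit Types (f g h : C -> C) (a b c d : seqC).

Lemma H2_L2 f : H2 f -> L2 f. Proof. by case. Qed.
Lemma H2_mT f : H2 f -> mT f. Proof. by case=> /L2_mT. Qed.
Lemma H2_L1 f : H2 f -> L1T f. Proof. by case=> /L2_L1. Qed.

Lemma H2D f g : H2 f -> H2 g -> H2 (fun z => f z + g z).
Proof.
move=> [f2 f0] [g2 g0]; split; first exact: L2D.
by move=> n n0; rewrite fourierD ?f0 ?g0 ?addr0//; exact: L2_L1.
Qed.
Lemma H2Z k f : H2 f -> H2 (fun z => k * f z).
Proof.
move=> [f2 f0]; split; first exact: L2Z.
by move=> n n0; rewrite fourierZ ?f0 ?mulr0//; exact: L2_L1.
Qed.
Lemma H2B f g : H2 f -> H2 g -> H2 (fun z => f z - g z).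
Proof.
move=> [f2 f0] [g2 g0]; split; first exact: (DB L2_prehilbert f2 g2).
by move=> n n0; rewrite fourierB ?f0 ?g0 ?subrr//; exact: L2_L1.
Qed.
Lemma H2_Xn (n : nat) : H2 (fun z : C => z ^ n%:Z).
Proof.
split; first exact: L2_Xz.
by move=> m m0; rewrite fourier_Xz; case: m m0.
Qed.
Lemma H2_cst (k : C) : H2 (cst k).
Proof.
have := H2Z k (H2_Xn 0); congr H2; apply/funext => z.
by rewrite expr0z mulr1.
Qed.
Lemma H2_ae f g : L2 g -> aeT f g -> H2 f -> H2 g.
Proof.
move=> g2 fg [f2 f0]; split=> // n n0.
by rewrite -(f0 n n0); apply: ae_fourier; [exact: L2_mT|exact: L2_mT|exact: aeT_sym].
Qed.
Lemma H2_Xn_mul (n : nat) f : H2 f -> H2 (fun z => z ^ n%:Z * f z).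
Proof.
move=> [f2 f0]; split; first exact: L2_Xz_mul.
move=> m m0; rewrite fourier_Xz_mul f0//.
by rewrite subr_lt0; apply: (lt_le_trans m0).
Qed.
Lemma H2_invC f : H2 f -> H2 (invC f).
Proof.
move=> [f2 f0]; split; first exact: L2_invC.
by move=> n n0; rewrite fourier_invC ?f0 ?rmorph0//; exact: L2_L1.
Qed.

Definition coef f : seqC := fun n => fourier f n%:Z.

Lemma coef_inj f g : H2 f -> H2 g -> coef f = coef g -> aeT f g.
Proof.
move=> hf hg fg; apply: fourier_inj; [exact: H2_L1|exact: H2_L1|].
move=> [n|n]; first exact: (congr1 (fun c : seqC => c n) fg).
by rewrite hf.2 ?hg.2.
Qed.

Lemma ae_coef f g : mT f -> mT g -> aeT f g -> coef f = coef g.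
Proof. by move=> mf mg fg; apply/funext => n; exact: ae_fourier. Qed.

Lemma coefD f g : L1T f -> L1T g -> coef (fun z => f z + g z) = coef f + coef g.
Proof. by move=> f1 g1; apply/funext => n; rewrite /coef fourierD. Qed.
Lemma coefZ k f : L1T f -> coef (fun z => k * f z) = k *: coef f.
Proof. by move=> f1; apply/funext => n; rewrite /coef fourierZ. Qed.
Lemma coefB f g : L1T f -> L1T g -> coef (fun z => f z - g z) = coef f - coef g.
Proof. by move=> f1 g1; apply/funext => n; rewrite /coef fourierB. Qed.

(** Coefficient sequences serve as canonical representatives of Hardy functions:
    equality of sequences is equality almost everywhere, and [bd] goes back to a
    boundary function. *)
Definition h2 c := exists2 f, H2 f & coef f = c.
Definition bd c : C -> C := xget (fun=> 0) [set f | H2 f /\ coef f = c].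
Definition dotS c d : C := dotT (bd c) (bd d).

Lemma h2_coef f : H2 f -> h2 (coef f). Proof. by exists f. Qed.
Lemma bdP c : h2 c -> H2 (bd c) /\ coef (bd c) = c.
Proof. by case=> f hf fc; apply: (@xgetPex _ _ [set f | H2 f /\ coef f = c]); exists f. Qed.
Lemma bd_H2 c : h2 c -> H2 (bd c). Proof. by move=> /bdP[]. Qed.
Lemma bd_L2 c : h2 c -> L2 (bd c). Proof. by move=> /bd_H2[]. Qed.
Lemma coef_bd c : h2 c -> coef (bd c) = c. Proof. by move=> /bdP[]. Qed.
Lemma bd_coef f : H2 f -> aeT (bd (coef f)) f.
Proof.
move=> hf; have hc := h2_coef hf; apply: coef_inj => //; first exact: bd_H2.
exact: coef_bd.
Qed.

Lemma dotS_coef f g : H2 f -> H2 g -> dotS (coef f) (coef g) = dotT f g.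
Proof.
move=> hf hg; apply: ae_dotT; try exact: bd_coef; try exact: H2_L2.
- exact/bd_L2/h2_coef.
- exact/bd_L2/h2_coef.
Qed.

Lemma h2D c d : h2 c -> h2 d -> h2 (c + d).
Proof.
move=> [f hf <-] [g hg <-]; exists (fun z => f z + g z); first exact: H2D.
by rewrite coefD//; exact: H2_L1.
Qed.
Lemma h2Z k c : h2 c -> h2 (k *: c).
Proof.
move=> [f hf <-]; exists (fun z => k * f z); first exact: H2Z.
by rewrite coefZ//; exact: H2_L1.
Qed.
Lemma bdD c d : h2 c -> h2 d -> aeT (bd (c + d)) (fun z => bd c z + bd d z).
Proof.
move=> hc hd; have hcd := h2D hc hd; apply: coef_inj; first exact: bd_H2.
  by apply: H2D; exact: bd_H2.
by rewrite coefD ?coef_bd//; exact/H2_L1/bd_H2.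
Qed.
Lemma bdZ k c : h2 c -> aeT (bd (k *: c)) (fun z => k * bd c z).
Proof.
move=> hc; have hkc := h2Z k hc; apply: coef_inj; first exact: bd_H2.
  by apply: H2Z; exact: bd_H2.
by rewrite coefZ ?coef_bd//; exact/H2_L1/bd_H2.
Qed.

Lemma h2_prehilbert : @prehilbert R seqC h2 dotS.
Proof.
split.
- exists (cst 0); first exact: H2_cst.
  apply/funext => n; rewrite /coef -[X in fourier X](_ : (fun z : C => 0 * (cst 0) z) = _).
    by rewrite fourierZ ?mul0r//; exact: L1T_cst.
  by apply/funext => z; rewrite mul0r.
- exact: h2D.
- exact: h2Z.
- move=> x y z hx hy hz; have hxy := h2D hx hy.
  rewrite /dotS -(ph_dotDl L2_prehilbert); try exact: bd_L2.
  apply: ae_dotT; try exact: bd_L2.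
  + by apply: L2D; exact: bd_L2.
  + exact: bdD.
  + exact: aeT_refl.
- move=> k x y hx hy; have hkx := h2Z k hx.
  rewrite /dotS -(ph_dotZl L2_prehilbert); try exact: bd_L2.
  apply: ae_dotT; try exact: bd_L2.
  + by apply: L2Z; exact: bd_L2.
  + exact: bdZ.
  + exact: aeT_refl.
- by move=> x y hx hy; apply: (ph_dotC L2_prehilbert); exact: bd_L2.
- by move=> x hx; apply: (ph_dot_ge0 L2_prehilbert); exact: bd_L2.
Qed.
Local Notation ph := h2_prehilbert.
Local Notation nrmT := (@nrm R V dotT).
Local Notation tendsT := (@tends R V dotT).
Local Notation nrm := (@nrm R seqC dotS).
Local Notation sqn := (@sqn R seqC dotS).
Local Notation tends := (@tends R seqC dotS).

Lemma bdB c d : h2 c -> h2 d -> aeT (bd (c - d)) (fun z => bd c z - bd d z).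
Proof.
move=> hc hd; have hcd := DB ph hc hd; apply: coef_inj; first exact: bd_H2.
  by apply: H2B; exact: bd_H2.
by rewrite coefB ?coef_bd//; exact/H2_L1/bd_H2.
Qed.

Lemma nrm_coef f : H2 f -> nrm (coef f) = normT f.
Proof. by move=> hf; rewrite /nrm /sqn dotS_coef. Qed.

Lemma nrm_bdB c d : h2 c -> h2 d -> nrmT (bd c - bd d) = nrm (c - d).
Proof.
move=> hc hd; have hcd := DB ph hc hd; congr (Num.sqrt (complex.Re _)).
have L2B := DB L2_prehilbert (bd_L2 hc) (bd_L2 hd).
by apply: ae_dotT => //; try exact: bd_L2; apply: aeT_sym; exact: bdB.
Qed.

Definition delta (n : nat) : seqC := fun k => (n == k)%:R.

Lemma coef_Xn n : coef (fun z => z ^ n%:Z) = delta n.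
Proof. by apply/funext => k; rewrite /coef fourier_Xz. Qed.
Lemma h2_delta n : h2 (delta n).
Proof. by rewrite -coef_Xn; apply: h2_coef; exact: H2_Xn. Qed.
Lemma bd_delta n : aeT (bd (delta n)) (fun z => z ^ n%:Z).
Proof. by rewrite -coef_Xn; apply: bd_coef; exact: H2_Xn. Qed.

Lemma dot_delta c n : h2 c -> dotS c (delta n) = c n.
Proof.
move=> hc; rewrite -{1}(coef_bd hc) -coef_Xn dotS_coef; try exact: H2_Xn; try exact: bd_H2.
by rewrite -fourierE -{2}(coef_bd hc).
Qed.

Lemma delta_orth i j : dotS (delta i) (delta j) = (i == j)%:R.
Proof. by rewrite dot_delta//; exact: h2_delta. Qed.

Lemma h2_complete : @complete_nrm R seqC h2 dotS.
Proof.
move=> u hu cu.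
have hb n : L2 (bd (u n)) by exact: bd_L2.
have [l l2 lt] : exists2 l, L2 l & tendsT (fun n => bd (u n)) l.
  apply: L2_complete => // e e0; have [N hN] := cu _ e0; exists N => m n Nm Nn.
  by rewrite nrm_bdB//; exact: hN.
have Hl : H2 l.
  split=> // n n0; rewrite fourierE.
  apply: (tends_dot_cst L2_prehilbert hb l2 (L2_Xz n) lt).
  by apply: nearW => k; rewrite -fourierE (bd_H2 (hu k)).2.
exists (coef l); first exact: h2_coef.
rewrite /tends; have -> // : (fun n => nrm (u n - coef l)) = (fun n => nrmT (bd (u n) - l)).
apply/funext => n; have Hu := bd_H2 (hu n).
rewrite -{1}(coef_bd (hu n)) -coefB; try exact: H2_L1.
by rewrite nrm_coef//; exact: H2B.
Qed.

Lemma h2_total c : h2 c -> (forall k, dotS c (delta k) = 0) -> c = 0.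
Proof. by move=> hc c0; apply/funext => k; rewrite -(dot_delta k hc) c0. Qed.

Lemma h2_definite c : h2 c -> sqn c = 0 -> c = 0.
Proof.
move=> hc c0; apply: h2_total => // k; apply/eq0_normc/eqP.
rewrite eq_le normc_ge0 andbT; apply: (le_trans (cauchy_schwarz ph hc (h2_delta k))).
by rewrite /nrm c0 sqrtr0 mul0r.
Qed.

Definition trunc c n : seqC := psum delta c n.

Lemma h2_trunc c n : h2 (trunc c n).
Proof. by apply: (D_psum ph); exact: h2_delta. Qed.

Lemma trunc_tends c : h2 c -> tends (trunc c) c.
Proof.
move=> hc; have E : (fun k => dotS c (delta k)) = c.
  by apply/funext => k; exact: dot_delta.
by have := expansion_tends ph h2_complete h2_delta delta_orth h2_total hc; rewrite E.
Qed.

(** Finite sequences are dense, so a bounded additive map is determined by its values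
    on the multiples of the basis vectors. *)
Lemma additive_eq0 (F : seqC -> C) (M : R) :
  (forall c d, h2 c -> h2 d -> F (c + d) = F c + F d) ->
  (forall c, h2 c -> normc (F c) <= M * nrm c) ->
  (forall (k : C) n, F (k *: delta n) = 0) -> forall c, h2 c -> F c = 0.
Proof.
move=> FD FM F0 c hc.
have F00 : F 0 = 0 by rewrite -(F0 0 0%N) scale0r.
have Ft N : F (trunc c N) = 0.
  elim: N => [|N IH]; first by rewrite /trunc /psum big_ord0.
  have -> : trunc c N.+1 = trunc c N + c N *: delta N by rewrite /trunc /psum big_ord_recr.
  by rewrite (FD _ _ (h2_trunc c N) (h2Z _ (h2_delta N))) IH F0 addr0.
have e2 N : h2 (c - trunc c N) := DB ph hc (h2_trunc c N).
apply: (@eq_of_normc_le _ _ _ (fun N => M * nrm (trunc c N - c))).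
  have M0 (v : R^nat) : v @ \oo --> 0 -> (fun N => M * v N) @ \oo --> 0.
    by move=> v0; rewrite -[X in _ --> X](mulr0 M); apply: cvgMl_tmp.
  exact: M0 (trunc_tends hc).
move=> N; rewrite subr0 (nrmBC ph (h2_trunc c N) hc).
have -> : F c = F (c - trunc c N).
  by rewrite -{1}(subrK (trunc c N) c) (FD _ _ (e2 N) (h2_trunc c N)) Ft addr0.
exact: FM.
Qed.

Lemma riesz_fischer c (B : R) : (forall n, \sum_(k < n) normc (c k) ^+ 2 <= B) ->
  h2 c /\ sqn c <= B.
Proof.
move=> cB; have [y [hy ty yc]] := orthonormal_series ph h2_complete h2_delta delta_orth cB.
have -> : c = y by apply/funext => k; rewrite -yc dot_delta.
split=> //.
have B0 : 0 <= B by have := cB 0%N; rewrite big_ord0.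
have : nrm y <= Num.sqrt B.
  apply: (tends_nrm_le ph _ hy ty) => n; first exact: h2_trunc.
  by rewrite /nrm (sqn_psum ph h2_delta delta_orth) ler_sqrt.
by rewrite ler_sqrt ?(sqn_ge0 ph).
Qed.

Definition shiftS c : seqC := fun n => if n is k.+1 then c k else 0.
Definition bshift c : seqC := fun n => c n.+1.
Definition conjS c : seqC := fun n => (c n)^*%C.

Lemma coef_Xmul f : H2 f -> coef (fun z => z ^ 1 * f z) = shiftS (coef f).
Proof.
move=> hf; apply/funext => -[|n]; rewrite /coef fourier_Xz_mul /=.
  by rewrite hf.2.
by congr fourier; rewrite -addn1 PoszD addrK.
Qed.
Lemma h2_shiftS c : h2 c -> h2 (shiftS c).
Proof.
move=> [f hf <-]; exists (fun z => z ^ 1 * f z); first exact: (H2_Xn_mul 1).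
exact: coef_Xmul.
Qed.
Lemma bd_shiftS c : h2 c -> aeT (bd (shiftS c)) (fun z => z ^ 1 * bd c z).
Proof.
move=> hc; have hsc := h2_shiftS hc; apply: coef_inj; first exact: bd_H2.
  by apply: (H2_Xn_mul 1); exact: bd_H2.
by rewrite coef_Xmul ?coef_bd//; exact: bd_H2.
Qed.

Lemma bshiftP f : H2 f ->
  H2 (fun z => z ^ (-1) * (f z - fourier f 0)) /\
  coef (fun z => z ^ (-1) * (f z - fourier f 0)) = bshift (coef f).
Proof.
move=> hf; set k := fourier f 0.
have fc n : fourier (fun z => f z - k) n = fourier f n - k * (0 == n)%:R.
  rewrite -fourier_Xz -(fourierZ _ _ (L1T_Xz 0)) -fourierB; try exact: H2_L1.
    by apply: eq_intT => t; rewrite expr0z mulr1.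
  exact: L1TZ (L1T_Xz 0).
split; last first.
  apply/funext => n; rewrite /coef fourier_Xz_mul fc opprK.
  by rewrite /bshift /= -PoszD addn1 mulr0 subr0.
split; first by apply: L2_Xz_mul; exact: (DB L2_prehilbert (H2_L2 hf) (L2_cst k)).
move=> n n0; rewrite fourier_Xz_mul fc opprK.
have [->|n1] := eqVneq n (-1); first by rewrite addNr eqxx mulr1 subrr.
have n2 : n + 1 < 0 by rewrite lt_neqAle lezD1 n0 andbT addr_eq0.
by rewrite hf.2// gt_eqF ?mulr0 ?subr0.
Qed.
Lemma h2_bshift c : h2 c -> h2 (bshift c).
Proof. by move=> [f hf <-]; have [h1 h3] := bshiftP hf; exists (fun z => z ^ (-1) * (f z - fourier f 0)). Qed.

Lemma bshiftK c : c = c 0%N *: delta 0 + shiftS (bshift c).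
Proof.
apply/funext => -[|n].
  by rewrite -[RHS]/(c 0%N * (0%N == 0%N)%:R + 0) mulr1 addr0.
by rewrite -[RHS]/(c 0%N * (0%N == n.+1)%:R + c n.+1) mulr0 add0r.
Qed.

Lemma shiftSD c d : shiftS (c + d) = shiftS c + shiftS d.
Proof. by apply/funext => -[|n] //; rewrite -[RHS]/(0 + 0) addr0. Qed.
Lemma shiftSZ k c : shiftS (k *: c) = k *: shiftS c.
Proof. by apply/funext => -[|n] //; rewrite -[RHS]/(k * 0) mulr0. Qed.
Lemma bshiftD c d : bshift (c + d) = bshift c + bshift d. Proof. by []. Qed.
Lemma bshiftZ k c : bshift (k *: c) = k *: bshift c. Proof. by []. Qed.
Lemma shiftSB c d : shiftS (c - d) = shiftS c - shiftS d.
Proof. by apply/funext => -[|n] //; rewrite -[RHS]/(0 - 0) subr0. Qed.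

Lemma dot_shiftS c d : h2 c -> h2 d -> dotS (shiftS c) (shiftS d) = dotS c d.
Proof.
move=> hc hd; have h1 := H2_Xn_mul 1 (bd_H2 hc); have h3 := H2_Xn_mul 1 (bd_H2 hd).
rewrite -{1}(coef_bd hc) -{1}(coef_bd hd) -!coef_Xmul; try exact: bd_H2.
rewrite dotS_coef//; apply: eq_intT => t.
by rewrite rmorphM mulrACA [X in X * _]mulJ_normc normc_expiXz expr1n mul1r.
Qed.

Lemma dot_shiftS_delta0 c : h2 c -> dotS (shiftS c) (delta 0) = 0.
Proof. by move=> hc; rewrite dot_delta//; exact: h2_shiftS. Qed.

Lemma dot_shiftSr c d : h2 c -> h2 d -> dotS (shiftS c) d = dotS c (bshift d).
Proof.
move=> hc hd; have hsc := h2_shiftS hc; have hbd := h2_bshift hd.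
rewrite {1}(bshiftK d) (dotDr ph)//; first last.
- exact: h2_shiftS.
- by apply: h2Z; exact: h2_delta.
rewrite (dotZr ph)//; last exact: h2_delta.
by rewrite dot_shiftS_delta0// mulr0 add0r dot_shiftS.
Qed.

Lemma sqn_shiftS c : h2 c -> sqn (shiftS c) = sqn c.
Proof. by move=> hc; rewrite /sqn dot_shiftS. Qed.

Lemma sqn_bshift c : h2 c -> sqn c = normc (c 0%N) ^+ 2 + sqn (bshift c).
Proof.
move=> hc; have hb := h2_bshift hc; rewrite {1}(bshiftK c) (sqnD_orth ph).
- by rewrite (sqnZ ph) ?sqn_shiftS//; [rewrite /sqn delta_orth eqxx mulr1|exact: h2_delta].
- by apply: h2Z; exact: h2_delta.
- exact: h2_shiftS.
rewrite (dotZl ph); [|exact: h2_delta|exact: h2_shiftS].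
rewrite (dotC ph); [|exact: h2_shiftS|exact: h2_delta].
by rewrite dot_shiftS_delta0// rmorph0 mulr0.
Qed.

Lemma coef_invC f : H2 f -> coef (invC f) = conjS (coef f).
Proof. by move=> hf; apply/funext => n; rewrite /coef fourier_invC//; exact: H2_L1. Qed.
Lemma h2_conjS c : h2 c -> h2 (conjS c).
Proof. by move=> [f hf <-]; rewrite -coef_invC//; apply: h2_coef; exact: H2_invC. Qed.
Lemma conjSK c : conjS (conjS c) = c.
Proof. by apply/funext => n; rewrite /conjS conjcK. Qed.
Lemma dot_conjS c d : h2 c -> h2 d -> dotS (conjS c) (conjS d) = (dotS c d)^*%C.
Proof.
move=> [f hf <-] [g hg <-]; rewrite -!coef_invC// !dotS_coef//; try exact: H2_invC.
rewrite /dotT -intTJ; last by apply: L2MJ; exact: H2_L2.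
rewrite -[RHS]intT_reflect; last by apply: L1TJ; apply: L2MJ; exact: H2_L2.
by apply: eq_intT => t; rewrite rmorphM/= /invC.
Qed.

End HardySequences.

(** * Analytic extension and products *)
Section Extension.
Context {R : realType}.
Local Notation C := R[i].
Local Notation V := (C -> C^o).
Local Notation seqC := (nat -> C^o).
Implicit Types (f g h : C -> C) (a b c d : seqC) (w : C).
Local Notation ph := (@h2_prehilbert R).
Local Notation nrmT := (@nrm R V dotT).
Local Notation tendsT := (@tends R V dotT).
Local Notation nrm := (@nrm R seqC dotS).
Local Notation sqn := (@sqn R seqC dotS).
Local Notation tends := (@tends R seqC dotS).
Let De := @h2_delta R.

Lemma cvg_succ (u : R^nat) (l : R) : u @ \oo --> l -> (fun n => u n.+1) @ \oo --> l.
Proof. by move=> h; rewrite (cvg_shiftS u). Qed.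

Lemma cvg_pred (u : R^nat) (l : R) : (fun n => u n.+1) @ \oo --> l -> u @ \oo --> l.
Proof. by rewrite (cvg_shiftS u). Qed.

Lemma normc_coord c n : h2 c -> normc (c n) <= nrm c.
Proof.
move=> hc; rewrite -(dot_delta n hc); apply: (le_trans (cauchy_schwarz ph hc (De n))).
by rewrite {2}/nrm /sqn delta_orth eqxx /= sqrtr1 mulr1.
Qed.

Lemma nrm_bshift c : h2 c -> nrm (bshift c) <= nrm c.
Proof.
move=> hc; have hb := h2_bshift hc; rewrite ler_sqrt ?(sqn_ge0 ph)//.
by rewrite (sqn_bshift hc) lerDr sqr_ge0.
Qed.

Lemma h2_iter_bshift c n : h2 c -> h2 (iter n bshift c).
Proof. by move=> hc; elim: n => //= n IH; exact: h2_bshift. Qed.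

Lemma nrm_iter_bshift c n : h2 c -> nrm (iter n bshift c) <= nrm c.
Proof.
move=> hc; elim: n => //= n IH; apply: le_trans IH.
by apply: nrm_bshift; exact: h2_iter_bshift.
Qed.

Lemma iter_bshiftE c n k : iter n bshift c k = c (n + k)%N.
Proof. by elim: n k => //= n IH k; rewrite /bshift IH addnS. Qed.

(** The Neumann series converges because [bshift] is a contraction. *)
Lemma resolvent c w : h2 c -> normc w < 1 ->
  exists2 x, h2 x & x = c + w *: bshift x.
Proof.
move=> hc w1.
have w0 := normc_ge0 w.
pose u N : seqC := \sum_(k < N) w ^+ k *: iter k bshift c.
have ht k : h2 (w ^+ k *: iter k bshift c) by apply: h2Z; exact: h2_iter_bshift.
have hu n : h2 (u n) by apply: (Dsum ph (F := fun k => w ^+ k *: iter k bshift c)).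
have cu : cauchy_nrm (dot := dotS) u.
  apply: (@cauchy_geometric _ _ _ _ ph u (nrm c) (normc w)) => //; first by rewrite w0.
  move=> n; have -> : u n.+1 - u n = w ^+ n *: iter n bshift c.
    by rewrite /u big_ord_recr /= addrAC subrr add0r.
  rewrite (nrmZ ph); last exact: h2_iter_bshift.
  rewrite normcX mulrC; apply: ler_wpM2r; first exact: exprn_ge0.
  exact: nrm_iter_bshift.
have [x hx ux] := h2_complete hu cu.
exists x => //; apply/funext => n.
have uS N : u N.+1 n = c n + w * u N n.+1.
  rewrite /u big_ord_recl /= expr0 scale1r; congr (_ + _).
  have sumE (F : nat -> seqC) M k : (\sum_(i < M) F i) k = \sum_(i < M) F i k.
    by elim: M => [|M IH]; rewrite ?big_ord0// !big_ord_recr/= -IH.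
  rewrite !fct_sumE mulr_sumr; apply: eq_bigr => i _.
  rewrite -[LHS]/(w ^+ i.+1 * _ ) -[RHS]/(w * (w ^+ i * _)) mulrA -exprS.
  by rewrite [iter _ _ _]/= !iter_bshiftE /bshift iter_bshiftE addnS.
have bnd N k : normc (u N k - x k) <= nrm (u N - x) by apply: (normc_coord k (DB ph (hu N) hx)).
apply: (@eq_of_normc_le _ _ _ (fun N => nrm (u N.+1 - x) + normc w * nrm (u N - x))).
  rewrite -[X in _ --> X](addr0 0) -{2}(mulr0 (normc w)); apply: cvgD.
    exact: (cvg_succ (u := fun n => nrm (u n - x))).
  exact: cvgMl_tmp.
move=> N; have -> : x n - (c + w *: bshift x) n = - (u N.+1 n - x n) + w * (u N n.+1 - x n.+1).
  by rewrite uS -[(c + w *: bshift x) n]/(c n + w * x n.+1); ring.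
apply: (le_trans (le_normcD _ _)); rewrite normcN normcM; apply: lerD => //.
by apply: ler_wpM2l.
Qed.

(** If [x = c + w S^* x], where [S^* ] is [bshift], then [c = x - w S^* x] equals
    [x(0) + (S - w) S^* x]: this divides [f - f(w)] by [z - w] inside the Hardy space. *)
Lemma divide_at c w : h2 c -> normc w < 1 ->
  exists l b, [/\ h2 b, c = l *: delta 0 + (shiftS b - w *: b) &
    normc l <= nrm c / (1 - normc w)] /\ nrm b <= nrm c / (1 - normc w).
Proof.
move=> hc w1; have [x hx xE] := resolvent hc w1.
have hb := h2_bshift hx.
have xc : nrm x <= nrm c / (1 - normc w).
  rewrite ler_pdivlMr ?subr_gt0// mulrBr mulr1.
  have : nrm x <= nrm c + normc w * nrm x.
    rewrite {1}xE; apply: (le_trans (nrmD ph hc (h2Z _ hb))); rewrite lerD2l (nrmZ ph)//.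
    by apply: ler_wpM2l; [exact: normc_ge0|exact: nrm_bshift].
  by rewrite lerBlDr [nrm x * _]mulrC.
exists (x 0%N), (bshift x); split; last exact: le_trans (nrm_bshift hx) xc.
split=> //; last exact: le_trans (normc_coord 0 hx) xc.
have -> : c = x - w *: bshift x by rewrite {1}xE addrK.
by rewrite addrA -bshiftK.
Qed.

(** A statement about real distances, independent of the topology of [C]; [ext_psum]
    relates it to [ext]. *)
Definition psum_tends (a : nat -> C) w l :=
  (fun N => normc (\sum_(k < N) a k * w ^+ k - l)) @ \oo --> 0.

Lemma ext_psum f w l : psum_tends (coef f) w l -> ext f w = l.
Proof.
move=> h; rewrite /ext; apply: (@cvg_lim C^o); first exact: norm_hausdorff.
apply/cvgrPdist_lt => /= e e0.
have er : e = (complex.Re e)%:C%C by rewrite RRe_real// gtr0_real.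
have e0' : 0 < complex.Re e by rewrite -ltcR -er.
have [N _ hN] := (cvgrPdist_lt _ _).1 h _ e0'.
exists N => // n /= Nn; have := hN _ Nn; rewrite sub0r normrN ger0_norm ?normc_ge0//.
rewrite -ltcR -er -normcE distrC /series/= big_mkord.
by apply: le_lt_trans.
Qed.

Lemma cvg_bounded_geometric (u : nat -> C) (B : R) w : normc w < 1 ->
  (forall n, normc (u n) <= B) -> (fun n => normc (u n * w ^+ n)) @ \oo --> 0.
Proof.
move=> w1 uB.
have c : (fun n => B * normc w ^+ n) @ \oo --> 0.
  rewrite -[X in _ --> X](mulr0 B); apply: cvgMl_tmp; apply: cvg_expr.
  by rewrite ger0_norm ?normc_ge0.
apply: (squeeze_cvgr _ (cvg_cst 0) c); apply: nearW => n.
by rewrite normc_ge0/= normcM normcX ler_wpM2r// exprn_ge0// normc_ge0.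
Qed.

(** The terms with [b] telescope at the point [w]. *)
Lemma psum_divide (c a b : nat -> C) w l : (forall n, a n = l * c n + ((if n is k.+1 then b k else 0) - w * b n)) ->
  forall N, \sum_(k < N.+1) a k * w ^+ k = l * (\sum_(k < N.+1) c k * w ^+ k) - b N * w ^+ N.+1.
Proof.
move=> ha; elim=> [|N IH].
  by rewrite !big_ord_recr !big_ord0/= ha; ring.
by rewrite big_ord_recr/= IH [in RHS]big_ord_recr/= ha !exprS; ring.
Qed.

Lemma psum_divide_tends (c a b : nat -> C) w l m (B : R) : normc w < 1 ->
  (forall n, a n = l * c n + ((if n is k.+1 then b k else 0) - w * b n)) ->
  (forall n, normc (b n) <= B) -> psum_tends c w m -> psum_tends a w (l * m).
Proof.
move=> w1 ha bB cm; apply: cvg_pred.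
have h1 := cvg_bounded_geometric w1 bB.
have h2 : (fun N => normc (\sum_(k < N.+1) c k * w ^+ k - m)) @ \oo --> 0.
  exact: (cvg_succ (u := fun N => normc (\sum_(k < N) c k * w ^+ k - m))).
have c0 : (fun N => normc l * normc (\sum_(k < N.+1) c k * w ^+ k - m) + normc w * normc (b N * w ^+ N)) @ \oo --> (normc l * 0 + normc w * 0 : R).
  by apply: cvgD; exact: cvgMl_tmp.
rewrite !mulr0 addr0 in c0.
apply: (squeeze_cvgr _ (cvg_cst 0) c0); apply: nearW => N; rewrite normc_ge0/=.
rewrite (psum_divide ha).
have -> : l * (\sum_(k < N.+1) c k * w ^+ k) - b N * w ^+ N.+1 - l * m =
  l * (\sum_(k < N.+1) c k * w ^+ k - m) + - (w * (b N * w ^+ N)) by rewrite exprS; ring.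
by apply: (le_trans (le_normcD _ _)); rewrite normcN !normcM.
Qed.

Lemma psum_tends_delta w : psum_tends (@delta R 0) w 1.
Proof.
apply: cvg_pred.
rewrite (_ : (fun _ => _) = cst 0); first exact: cvg_cst.
apply/funext => N; rewrite big_ord_recl big1 ?addr0; last by move=> i _; rewrite mul0r.
by rewrite mulr1 subrr normc0.
Qed.

(** The bounds come from [1 / (1 - |w|)] bounding the norm of the resolvent. *)
Lemma ext_divide f w : H2 f -> normc w < 1 ->
  exists g, [/\ H2 g, aeT f (fun z => ext f w + (z ^ 1 * g z - w * g z)),
    psum_tends (coef f) w (ext f w),
    normc (ext f w) <= normT f / (1 - normc w) & normT g <= normT f / (1 - normc w)].
Proof.
move=> hf w1; have [l [b [[hb cE lB] bB]]] := divide_at (h2_coef hf) w1.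
have ps : psum_tends (coef f) w (l * 1).
  apply: (@psum_divide_tends (@delta R 0) _ b _ _ _ (nrm b)) => //.
  - by move=> n; rewrite cE; case: n.
  - by move=> n; exact: normc_coord.
  - exact: psum_tends_delta.
rewrite mulr1 in ps; have El := ext_psum ps.
have Hb := bd_H2 hb; exists (bd b); rewrite El; split=> //; first last.
- by rewrite -nrm_coef// coef_bd// -(nrm_coef hf).
- by rewrite -(nrm_coef hf).
have Hzb := H2_Xn_mul 1 Hb; have Hwb := H2Z w Hb.
apply: coef_inj => //; first by apply: (H2D (H2_cst l)); exact: H2B.
rewrite coefD; [|exact: L1T_cst|exact: H2_L1 (H2B Hzb Hwb)].
rewrite coefB; [|exact: H2_L1|exact: H2_L1].
rewrite coef_Xmul// coefZ ?coef_bd//; last exact: H2_L1.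
rewrite {1}cE; congr (_ + _).
rewrite -coef_Xn -coefZ; last exact: L1T_Xz.
by apply/funext => n; apply: eq_intT => t; rewrite expr0z mulr1.
Qed.

(** The monomials span a dense subspace of the Hardy space. *)
Lemma dotT_bd_eq0 (w : C -> C) c : L2 w -> (forall n : nat, dotT (fun z => z ^ n%:Z) w = 0) ->
  h2 c -> dotT (bd c) w = 0.
Proof.
move=> w2 w0 hc.
apply: (@additive_eq0 _ (fun c => dotT (bd c) w) (nrmT w) _ _ _ _ hc) => [a b ha hb|a ha|k n].
- rewrite -(dotDl L2_prehilbert (bd_L2 ha) (bd_L2 hb) w2).
  apply: ae_dotT => //; [exact: bd_L2 (h2D ha hb)|exact: L2D (bd_L2 ha) (bd_L2 hb)| |exact: aeT_refl].
  exact: bdD.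
- have := cauchy_schwarz L2_prehilbert (bd_L2 ha) w2; rewrite mulrC.
  by rewrite -[X in _ * X](nrm_coef (bd_H2 ha)) (coef_bd ha).
have hn := @h2_delta R n.
transitivity (dotT (fun z => k * z ^ n%:Z) w).
  apply: ae_dotT => //; [exact: bd_L2 (h2Z k hn)|exact: L2Z (L2_Xz _)| |exact: aeT_refl].
  by apply: (aeT_trans (bdZ k hn)); move: (@bd_delta R n); apply: ae_imp => t ->.
by rewrite (dotZl L2_prehilbert k (L2_Xz n%:Z) w2) w0 mulr0.
Qed.

(** The coefficient is an inner product of [f] with a square integrable function that is
    orthogonal to all monomials. *)
Lemma fourier_mul_neg f g (n : int) : H2 f -> H2 g -> n < 0 -> fourier (fun z => f z * g z) n = 0.
Proof.
move=> hf hg n0.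
pose v z := (g z * z ^ (- n))^*%C.
have v2 : L2 v.
  by apply: L2J; apply: (L2_circle _ (L2_Xz_mul (- n) (H2_L2 hg))) => t; rewrite mulrC.
have hc := h2_coef hf.
have -> : fourier (fun z => f z * g z) n = dotT f v.
  by apply: eq_intT => t; rewrite /v conjcK mulrA.
have -> : dotT f v = dotT (bd (coef f)) v.
  apply: ae_dotT => //; [exact: H2_L2|exact: bd_L2|exact: aeT_sym (bd_coef hf)|exact: aeT_refl].
apply: (dotT_bd_eq0 v2 _ hc) => k; transitivity (fourier g (n - k%:Z)).
  apply: eq_intT => t; rewrite /v conjcK mulrCA; congr (_ * _).
  by rewrite -expfzDr ?expi_neq0// opprB.
by rewrite hg.2// subr_lt0; apply: (lt_le_trans n0).
Qed.

Lemma H2M f g : H2 f -> H2 g -> L2 (fun z => f z * g z) -> H2 (fun z => f z * g z).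
Proof. by move=> hf hg fg2; split=> // n n0; exact: fourier_mul_neg. Qed.

(** If [f = f(w) + (z - w) q], then [f g = f(w) g + (z - w) q g], and the last term
    contributes nothing at [w]. *)
Lemma ext_mul f g h w : H2 f -> H2 g -> mT h -> aeT h (fun z => f z * g z) -> normc w < 1 ->
  psum_tends (coef h) w (ext f w * ext g w).
Proof.
move=> hf hg mh hfg w1.
have [q [hq fE _ _ _]] := ext_divide hf w1.
have [_ [_ _ gp _ _]] := ext_divide hg w1.
have kL1 : L1T (fun z => q z * g z) by apply: L2M; exact: H2_L2.
have mfg : mT (fun z => f z * g z) by apply: mTM; exact: H2_mT.
apply: (psum_divide_tends (b := fun n => fourier (fun z => q z * g z) n%:Z) w1 _ _ gp); last first.
  by move=> n; exact: normc_fourier.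
have g1 := H2_L1 hg; have q1 := H2_L1 hq.
move=> n; rewrite /coef.
have L1a := L1TZ (ext f w) g1; have L1z := L1T_Xz_mul 1 kL1; have L1w := L1TZ w kL1.
have L1b := L1TB L1z L1w.
rewrite -(fourierZ (ext f w))// -(fourierZ w)//.
have -> : (if n is k.+1 then fourier (fun z => q z * g z) k%:Z else 0) =
   fourier (fun z => z ^ 1 * (q z * g z)) n%:Z.
  rewrite fourier_Xz_mul; case: n => [|n]; first by rewrite fourier_mul_neg.
  by congr fourier; rewrite -addn1 PoszD addrK.
rewrite -fourierB// -fourierD//; apply: ae_fourier => //; first exact: (L1TD L1a L1b).1.
move: hfg fE; apply: ae_imp2 => t -> ->; ring.
Qed.

(** For small [r], the lowest nonzero term of the series would dominate all the
    others. *)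
Lemma power_series_unique (a : nat -> C) (B : R) : (forall n, normc (a n) <= B) ->
  (forall r : R, 0 < r < 1 -> psum_tends a r%:C%C 0) -> forall n, a n = 0.
Proof.
move=> aB a0 n; have B0 : 0 <= B by apply: le_trans (normc_ge0 _) (aB 0%N).
elim/ltn_ind: n => n IH.
have key (r : R) : 0 < r < 1 -> normc (a n) <= B * r / (1 - r).
  move=> r01; have /andP[r0 r1] := r01.
  have tail j : normc (\sum_(k < n.+1 + j) a k * r%:C%C ^+ k - a n * r%:C%C ^+ n) <=
      B * r ^+ n.+1 * (1 - r ^+ j) / (1 - r).
    elim: j => [|j IHj].
      rewrite addn0 big_ord_recr/= big1 ?add0r ?subrr ?normc0 ?expr0 ?subrr ?mulr0 ?mul0r//.
      by move=> i _; rewrite IH ?mul0r.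
    rewrite addnS big_ord_recr/= addrAC; apply: (le_trans (le_normcD _ _)).
    have hj : normc (a (n.+1 + j)%N * r%:C%C ^+ (n.+1 + j)) <= B * r ^+ (n.+1 + j).
      rewrite normcM normcX normcR (ger0_norm (ltW r0)).
      by apply: ler_wpM2r => //; apply: exprn_ge0; exact: ltW.
    apply: (le_trans (lerD IHj hj)); rewrite le_eqVlt; apply/orP; left; apply/eqP.
    by rewrite exprD (exprS r j); field; lra.
  have lim := a0 r r01; rewrite /psum_tends in lim.
  have h : normc (a n * r%:C%C ^+ n) <= B * r ^+ n.+1 / (1 - r).
    have c : (fun N => normc (\sum_(k < N) a k * r%:C%C ^+ k - 0) + B * r ^+ n.+1 / (1 - r)) @ \oo --> 0 + B * r ^+ n.+1 / (1 - r).
      by apply: cvgD => //; exact: cvg_cst.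
    rewrite -[leRHS]add0r -(cvg_lim _ c)//; apply: limr_ge; first by apply/cvg_ex; eexists; exact: c.
    exists n.+1 => // N /= nN; rewrite -(subnKC nN) subr0; set S := \sum_(_ < _) _.
    have -> : a n * r%:C%C ^+ n = S + - (S - a n * r%:C%C ^+ n) by ring.
    apply: (le_trans (le_normcD _ _)); rewrite normcN lerD2l; apply: (le_trans (tail _)).
    apply: ler_wpM2r; first by rewrite invr_ge0; lra.
    rewrite ler_piMr//; first by apply: mulr_ge0 => //; apply: exprn_ge0; exact: ltW.
    by rewrite gerBl exprn_ge0// ltW.
  move: h; rewrite normcM normcX normcR (ger0_norm (ltW r0)) exprS.
  have rn : 0 < r ^+ n by exact: exprn_gt0.
  move=> h; rewrite -(ler_pM2r rn); apply: (le_trans h); rewrite le_eqVlt; apply/orP; left; apply/eqP; ring.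
apply/eq0_normc/eqP; rewrite eq_le normc_ge0 andbT leNgt; apply/negP => an0.
(* With this [r], the bound [B r / (1 - r)] is less than [m]. *)
pose m := normc (a n); pose r := m / (2 * (B + m)).
have m0 : 0 < m by [].
have Bm : 0 < 2 * (B + m) by lra.
have rE : r * (2 * (B + m)) = m by rewrite divfK// gt_eqF.
have r0 : 0 < r by exact: divr_gt0.
have r1 : r <= 2^-1 by nra.
have := key r; rewrite r0 /=.
rewrite -/m ler_pdivlMr; last by lra.
nra.
Qed.

(** Stated for integrable functions, because the product of two Hardy functions need
    not be square integrable. *)
Lemma ext_inj f g : L1T f -> L1T g -> (forall n : int, n < 0 -> fourier f n = 0) ->
  (forall n : int, n < 0 -> fourier g n = 0) ->
  (forall w, normc w < 1 -> exists2 l, psum_tends (coef f) w l & psum_tends (coef g) w l) -> aeT f g.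
Proof.
move=> f1 g1 f0 g0 fg; apply: fourier_inj => // -[n|n]; last by rewrite f0 ?g0.
apply/eqP; rewrite -subr_eq0; apply/eqP.
have d1 := L1TB f1 g1.
apply: (@power_series_unique (fun n => fourier f n%:Z - fourier g n%:Z) (2 * cint (fun t => normc (f (expi t) - g (expi t))))).
  by move=> k; rewrite -fourierB//; exact: normc_fourier.
move=> r /andP[r0 r1]; have hr : normc r%:C%C < 1 by rewrite normcR ger0_norm ?ltW.
have [l hl hl'] := fg _ hr.
have c0 : (fun N => normc (\sum_(k < N) coef f k * r%:C%C ^+ k - l) + normc (\sum_(k < N) coef g k * r%:C%C ^+ k - l)) @ \oo --> 0.
  by rewrite -[X in _ --> X](addr0 0); apply: cvgD.
apply: (squeeze_cvgr _ (cvg_cst 0) c0); apply: nearW => N; rewrite normc_ge0/=.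
rewrite -(normcN (\sum_(k < N) coef g k * r%:C%C ^+ k - l)); apply: le_trans (le_normcD _ _).
rewrite le_eqVlt; apply/orP; left; apply/eqP; congr normc.
under eq_bigr do rewrite mulrBl; rewrite sumrB /coef; ring.
Qed.

End Extension.

(** * Multipliers and inner functions *)
Lemma derivable_intro (K : numFieldType) (f : K^o -> K^o) (z l : K) :
  (forall e : K, 0 < e -> exists2 d : K, 0 < d & forall h : K, h != 0 -> `|h| < d ->
     `|l - h^-1 * (f (h + z) - f z)| < e) -> derivable f z 1.
Proof.
move=> H; apply/cvg_ex; exists l; apply/cvgrPdist_lt => /= e e0.
have [d d0 hd] := H e e0; near=> h.
have h0 : h != 0 by near: h; exact: nbhs_dnbhs_neq.
have h1 : `|h| < d by near: h; exact: dnbhs0_lt.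
by have := hd h h0 h1; rewrite {2}/GRing.scale/= mulr1.
Unshelve. all: by end_near. Qed.

Section HardyFunctions.
Context {R : realType}.
Local Notation C := R[i].
Local Notation mu := (@lebesgue_measure R).
Local Notation V := (C -> C^o).
Local Notation seqC := (nat -> C^o).
Local Notation I := (`[- pi, pi]%classic : set R).
Implicit Types (f g h : C -> C) (a b c d : seqC) (w : C).
Local Notation sqnT := (@sqn R V dotT).
Local Notation tends := (@tends R seqC dotS).

Lemma normC_lt1 w : (`|w| < 1) = (normc w < 1).
Proof. by rewrite normcE -ltcR. Qed.

Lemma psum_tends_ext f w : H2 f -> normc w < 1 -> psum_tends (coef f) w (ext f w).
Proof. by move=> hf w1; have [g [_ _ ? _ _]] := ext_divide hf w1. Qed.

(** Division by [z - w] on the circle remains valid on the disk: the partial sums of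
    both sides at [v] differ by a single term, which tends to 0. *)
Lemma ext_shift_at f g (l : C) w v : H2 f -> H2 g -> normc v < 1 ->
  aeT f (fun z => l + (z ^ 1 * g z - w * g z)) -> ext f v = l + (v - w) * ext g v.
Proof.
move=> hf hg v1 fE.
have zg := H2_Xn_mul 1 hg; have wg := H2Z w hg.
have fc n : coef f n = (if n is 0%N then l else 0) + ((if n is k.+1 then coef g k else 0) - w * coef g n).
  have -> : coef f = coef (fun z => l + (z ^ 1 * g z - w * g z)).
    by apply: ae_coef => //; [exact: H2_mT|exact: H2_mT (H2D (H2_cst l) (H2B zg wg))].
  rewrite coefD; [|exact: L1T_cst|exact: H2_L1 (H2B zg wg)].
  rewrite coefB; [|exact: H2_L1|exact: H2_L1].
  rewrite coef_Xmul// coefZ; last exact: H2_L1.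
  rewrite -[LHS]/(coef (fun=> l) n + (shiftS (coef g) n - w * coef g n)); congr (_ + _).
  have -> : coef (fun=> l) = l *: delta 0.
    rewrite -coef_Xn -coefZ; last exact: L1T_Xz.
    by apply/funext => k; apply: eq_intT => t; rewrite expr0z mulr1.
  by rewrite -[LHS]/(l * (0%N == n)%:R); case: n => [|n]; rewrite ?mulr1 ?mulr0.
apply: ext_psum.
have id N : \sum_(k < N.+1) coef f k * v ^+ k =
   l + (v - w) * (\sum_(k < N.+1) coef g k * v ^+ k) - coef g N * v ^+ N.+1.
  elim: N => [|N IH].
    by rewrite !big_ord_recr !big_ord0/= fc; ring.
  by rewrite big_ord_recr/= IH [in RHS]big_ord_recr/= fc !exprS; ring.
apply: cvg_pred.
have gp := psum_tends_ext hg v1.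
have h1 := cvg_bounded_geometric v1 (fun n => normc_fourier n%:Z (H2_L1 hg)).
have c0 : (fun N => normc (v - w) * normc (\sum_(k < N.+1) coef g k * v ^+ k - ext g v) +
   normc v * normc (coef g N * v ^+ N)) @ \oo --> (normc (v - w) * 0 + normc v * 0 : R).
  apply: cvgD; apply: cvgMl_tmp => //.
  exact: (cvg_succ (u := fun N => normc (\sum_(k < N) coef g k * v ^+ k - ext g v))).
rewrite !mulr0 addr0 in c0.
apply: (squeeze_cvgr _ (cvg_cst 0) c0); apply: nearW => N; rewrite normc_ge0/= id.
have -> : l + (v - w) * (\sum_(k < N.+1) coef g k * v ^+ k) - coef g N * v ^+ N.+1 - (l + (v - w) * ext g v) =
  (v - w) * (\sum_(k < N.+1) coef g k * v ^+ k - ext g v) + - (v * (coef g N * v ^+ N)).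
  by rewrite exprS; ring.
by apply: (le_trans (le_normcD _ _)); rewrite normcN !normcM.
Qed.

(** Dividing twice by [z - w] at [w = z] gives
    [f (z + h) = f z + h (g z + h g' (z + h))], with [g'] bounded near [z]. *)
Lemma analytic_ext f : H2 f -> analytic (ext f).
Proof.
move=> hf z; rewrite normC_lt1 => z1.
have [g [hg fE _ _ _]] := ext_divide hf z1.
have [g' [hg' gE _ _ _]] := ext_divide hg z1.
pose K := normT g' / ((1 - normc z) / 2) + 1.
have z0 := normc_ge0 z.
have r0 : 0 < (1 - normc z) / 2 by lra.
have K0 : 0 < K.
  rewrite ltr_pwDr//; apply: mulr_ge0; first exact: sqrtr_ge0.
  by rewrite invr_ge0 ltW.
apply: (@derivable_intro C (ext f) z (ext g z)) => e e0.
have er : e = (complex.Re e)%:C%C by rewrite RRe_real// gtr0_real.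
have e0' : 0 < complex.Re e by rewrite -ltcR -er.
pose d := Num.min ((1 - normc z) / 2) (complex.Re e / K).
have d0 : 0 < d by rewrite lt_min r0 divr_gt0.
exists d%:C%C; first by rewrite ltcR.
move=> h h0; rewrite normcE ltcR => hd.
have hr : normc h < (1 - normc z) / 2 by apply: (lt_le_trans hd); rewrite ge_min lexx.
have he : normc h < complex.Re e / K by apply: (lt_le_trans hd); rewrite ge_min lexx orbT.
have v1 : normc (h + z) < 1 by apply: (le_lt_trans (le_normcD _ _)); lra.
have v2 : (1 - normc z) / 2 <= 1 - normc (h + z).
  by have := le_normcD h z; lra.
rewrite (ext_shift_at hf hg v1 fE) (ext_shift_at hg hg' v1 gE) addrK.
have [q [_ _ _ qB _]] := ext_divide hg' v1.
have aux (x y t : C) : y - h^-1 * (x + h * (y + h * t) - x) = - (h * t) by field.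
rewrite aux normrN normcE er ltcR normcM.
have q1 : normc (ext g' (h + z)) <= K.
  apply: (le_trans qB); apply: (@le_trans _ _ (normT g' / ((1 - normc z) / 2))); last by rewrite lerDl.
  apply: ler_wpM2l; first exact: sqrtr_ge0.
  by rewrite lef_pV2 ?posrE//; lra.
apply: (@le_lt_trans _ _ (normc h * K)); first by apply: ler_wpM2l => //; exact: normc_ge0.
by rewrite -ltr_pdivlMr.
Qed.

(** Multiplying extensions in the disk amounts to multiplying boundary functions,
    because both the passage from the circle to the disk and its converse respect
    products. *)
Lemma is_productP p f g : H2 p -> H2 f ->
  is_product (ext p) f g <-> H2 g /\ aeT g (fun z => p z * f z).
Proof.
move=> hp hf; have pf1 := L2M (H2_L2 hp) (H2_L2 hf); split=> -[hg].
  move=> gE; split=> //; apply: ext_inj => //; first exact: H2_L1.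
  - by move=> n n0; exact: hg.2.
  - by move=> n n0; exact: fourier_mul_neg.
  move=> w w1; exists (ext p w * ext f w).
    by rewrite -gE ?normC_lt1//; exact: psum_tends_ext.
  by apply: ext_mul => //; [exact: pf1.1|exact: aeT_refl].
move=> gE; split=> // w; rewrite normC_lt1 => w1.
by apply: ext_psum; apply: ext_mul => //; exact: H2_mT.
Qed.

Lemma L2_ae_le f g : mT f -> L2 g -> {ae mu, forall t, normc (f (expi t)) <= normc (g (expi t))} ->
  L2 f /\ normT f <= normT g.
Proof.
move=> mf g2 fg; have /L2E[mg ig] := g2.
have le_int : (\int[mu]_(t in I) (normc (f (expi t)) ^+ 2)%:E <= \int[mu]_(t in I) (normc (g (expi t)) ^+ 2)%:E)%E.
  apply: ae_ge0_le_integral => //.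
  - by move=> t _; rewrite lee_fin sqr_ge0.
  - by apply/measurable_EFinP; apply: measI; apply: measurable_funX; exact: (mT_normc mf).
  - by move=> t _; rewrite lee_fin sqr_ge0.
  - by apply/measurable_EFinP; apply: measI; apply: measurable_funX; exact: (mT_normc mg).
  - by move: fg; apply: ae_imp => t h _; rewrite lee_fin ler_pXn2r// nnegrE normc_ge0.
have f2 : L2 f.
  apply/L2E; split=> //; apply/integrableP; split.
    by apply/measurable_EFinP; apply: measI; apply: measurable_funX; exact: (mT_normc mf).
  have := integral_normc2 g2 => gE; rewrite gE in le_int.
  apply: (le_lt_trans _ (le_lt_trans le_int (ltry _))).
  by rewrite le_eqVlt; apply/orP; left; apply/eqP; apply: eq_integral => t _ /=; rewrite ger0_norm ?sqr_ge0.
split=> //; move: le_int; rewrite (integral_normc2 f2) (integral_normc2 g2) lee_fin.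
rewrite ler_pM2l; last by have := pi_gt0 R; lra.
by move=> h; rewrite ler_sqrt//; exact: (sqn_ge0 L2_prehilbert g2).
Qed.

Lemma normT1 : normT (cst (1 : C)) = 1 :> R.
Proof.
rewrite /normT dotT_sqn (_ : (fun _ => _) = cst 1) ?cint_cst ?sqrtr1//.
by apply/funext => t; rewrite normc1 expr1n.
Qed.

(** The powers of [f] are unimodular too, so [|ext f w| ^ n] is at most
    [1 / (1 - |w|)] for every [n]. *)
Lemma unimodular_ext_le1 f : H2 f -> {ae mu, forall t, normc (f (expi t)) = 1} ->
  forall w, normc w < 1 -> normc (ext f w) <= 1.
Proof.
move=> hf f1 w w1.
have pw n : exists g, [/\ H2 g, {ae mu, forall t, normc (g (expi t)) = 1}, normT g <= 1 & ext g w = ext f w ^+ n].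
  elim: n => [|n [g [hg g1 gn gE]]].
    exists (cst 1); split; [exact: H2_cst|by apply: ae_all => t; exact: normc1|by rewrite normT1|].
    rewrite expr0; apply: ext_psum; have := psum_tends_delta w.
    rewrite (_ : coef _ = delta 0)// -coef_Xn; apply/funext => k; apply: eq_intT => t.
    by rewrite expr0z.
  have mfg : mT (fun z => f z * g z) by apply: mTM; exact: H2_mT.
  have fg1 : {ae mu, forall t, normc (f (expi t) * g (expi t)) = 1}.
    by move: f1 g1; apply: ae_imp2 => t h1 h2; rewrite normcM h1 h2 mulr1.
  have [fg2 fgn] : L2 (fun z => f z * g z) /\ normT (fun z => f z * g z) <= normT (cst (1 : C)).
    apply: L2_ae_le => //; first exact: L2_cst.
    by move: fg1; apply: ae_imp => t ->; rewrite normc1.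
  have hfg := H2M hf hg fg2.
  exists (fun z => f z * g z); split=> //; first by rewrite -normT1.
  by rewrite exprS -gE; apply: ext_psum; apply: ext_mul => //; exact: aeT_refl.
have bnd n : normc (ext f w) ^+ n <= 1 / (1 - normc w).
  have [g [hg _ gn gE]] := pw n; rewrite -normcX -gE.
  have [q [_ _ _ qB _]] := ext_divide hg w1; apply: (le_trans qB).
  by apply: ler_wpM2r => //; rewrite invr_ge0; lra.
rewrite leNgt; apply/negP => x1; set x := normc _ in bnd x1.
have x0 : 0 < x by lra.
have c : (fun n => x^-1 ^+ n) @ \oo --> (0 : R).
  by apply: cvg_expr; rewrite ger0_norm ?invr_ge0 ?(ltW x0)// invf_lt1.
have d0 : 0 < 1 - normc w by lra.
have [N _ hN] := (cvgrPdist_lt _ _).1 c _ d0.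
have := hN N (leqnn N); rewrite sub0r normrN ger0_norm; last by apply: exprn_ge0; rewrite invr_ge0 ltW.
rewrite exprVn; apply/negP; rewrite -leNgt -[leLHS]invrK lef_pV2 ?posrE ?exprn_gt0 ?invr_gt0//.
by have := bnd N; rewrite mul1r.
Qed.

Lemma inner_of_unimodular f : H2 f -> {ae mu, forall t, normc (f (expi t)) = 1} -> inner f.
Proof.
move=> hf f1; split=> //; exists 1 => z; rewrite normC_lt1.
exact: unimodular_ext_le1.
Qed.

(** Bessel's inequality makes the coefficients of nonnegative index square summable. *)
Lemma L2_proj f : L2 f -> exists d, [/\ h2 d, forall n, d n = fourier f n%:Z &
  forall c, h2 c -> dotS c d = dotT (bd c) f].
Proof.
move=> f2; pose d : seqC := fun n => fourier f n%:Z.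
have dB n : \sum_(k < n) normc (d k) ^+ 2 <= sqnT f.
  have eo i j : dotT (fun z : C => z ^ i%:Z) (fun z : C => z ^ j%:Z) = (i == j)%:R.
    by rewrite -fourierE fourier_Xz.
  have := bessel L2_prehilbert (fun n => L2_Xz n%:Z) eo n f2.
  apply: le_trans; rewrite le_eqVlt; apply/orP; left; apply/eqP; apply: eq_bigr => k _.
  by rewrite -fourierE.
have [hd _] := riesz_fischer dB.
exists d; split=> // c hc.
have bdd := bd_L2 hd; have e2 := DB L2_prehilbert bdd f2.
have key : dotT (bd c) (bd d - f) = 0.
  apply: (dotT_bd_eq0 e2 _ hc) => n; rewrite (dotC L2_prehilbert e2 (L2_Xz _)).
  rewrite (dotBl L2_prehilbert bdd f2 (L2_Xz _)) -!fourierE.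
  by rewrite -[fourier (bd d) _]/(coef (bd d) n) coef_bd// subrr rmorph0.
apply/eqP; rewrite -subr_eq0; apply/eqP; rewrite -key.
by rewrite (dotBr L2_prehilbert bdd f2 (bd_L2 hc)).
Qed.

End HardyFunctions.

(** * Boundary values of Hardy functions *)
Section Nonvanishing.
Context {R : realType}.
Local Notation C := R[i].
Local Notation mu := (@lebesgue_measure R).
Local Notation seqC := (nat -> C^o).
Implicit Types (f g h : C -> C) (a b c d p : seqC) (w : C).
Local Notation ph := (@h2_prehilbert R).
Local Notation sqn := (@sqn R seqC dotS).
Local Notation tends := (@tends R seqC dotS).

Lemma h2_iter_shiftS c n : h2 c -> h2 (iter n shiftS c).
Proof. by move=> hc; elim: n => //= n IH; exact: h2_shiftS. Qed.

Lemma bd_iter_shiftS c n : h2 c -> aeT (bd (iter n shiftS c)) (fun z => z ^ n%:Z * bd c z).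
Proof.
move=> hc; elim: n => [|n IH] /=; first by apply: ae_all => t; rewrite expr0z mul1r.
apply: (aeT_trans (bd_shiftS (h2_iter_shiftS n hc))).
by move: IH; apply: ae_imp => t ->; rewrite expr1z mulrA -exprSz.
Qed.

(** A product of boundary functions is only integrable; its Fourier coefficients are
    inner products, which are accessible to the operators on [h2]. *)
Lemma fourier_corr c d (n : nat) : h2 c -> h2 d ->
  fourier (fun z => bd c z * (bd d z)^*%C) (- n%:Z) = dotS (iter n shiftS c) d.
Proof.
move=> hc hd; transitivity (dotT (fun z => z ^ n%:Z * bd c z) (bd d)).
  by apply: eq_intT => t; rewrite opprK mulrC mulrA.
apply: ae_dotT; try exact: bd_L2.
- by apply: L2_Xz_mul; exact: bd_L2.
- by apply: bd_L2; exact: h2_iter_shiftS.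
- by apply: aeT_sym; exact: bd_iter_shiftS.
- exact: aeT_refl.
Qed.

Lemma L1T_corr c d : h2 c -> h2 d -> L1T (fun z => bd c z * (bd d z)^*%C).
Proof. by move=> hc hd; apply: L2MJ; exact: bd_L2. Qed.

Lemma mT_zero_set f : mT f -> mT (fun z => if f z == 0 then 1 else 0 : C).
Proof.
move=> mf; pose A := (fun t : R => normc (f (expi t))) @^-1` [set 0].
have mA : measurable A.
  by rewrite -[A]setTI; apply: (mT_normc mf) => //; exact: measurable_set1.
apply: (@mT_real _ (\1_A)); first exact: measurable_indic.
move=> t; rewrite indicE; have [ft|ft] := eqVneq (f (expi t)) 0.
  by rewrite mem_set// /A /= ft normc0.
rewrite memNset// /A /= => /eq0_normc ft0.
by rewrite ft0 eqxx in ft.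
Qed.

(** Helson's argument: the part of [p] orthogonal to [z p, z^2 p, ...] has constant
    modulus, is nonzero when [p(0) != 0], and vanishes wherever [p] does. *)
Lemma nonvanishing0 p : h2 p -> p 0%N != 0 -> {ae mu, forall t, bd p (expi t) != 0}.
Proof.
move=> hp p0.
(* [M] is the closed span of the [S^n p] with [n >= 1], encoded as a double
   orthogonal complement. *)
pose M x := h2 x /\ forall d, h2 d -> (forall n, dotS (iter n.+1 shiftS p) d = 0) -> dotS x d = 0.
have MS n : M (iter n.+1 shiftS p) by split; [exact: h2_iter_shiftS|move=> d hd; exact].
have MZ k x : M x -> M (k *: x).
  move=> [hx Mx]; split; first exact: h2Z.
  by move=> d hd dp; rewrite (dotZl ph)// Mx ?mulr0.
have MD x y : M x -> M y -> M (x + y).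
  move=> [hx Mx] [hy My]; split; first exact: h2D.
  by move=> d hd dp; rewrite (dotDl ph)// Mx// My ?addr0.
have MSh x : M x -> M (shiftS x).
  move=> [hx Mx]; split; first exact: h2_shiftS.
  move=> d hd dp; rewrite dot_shiftSr//; apply: Mx; first exact: h2_bshift.
  by move=> n; rewrite -dot_shiftSr//; [exact: (dp n.+1)|exact: (h2_iter_shiftS n.+1)].
have M0 : M 0 by have := MZ 0 _ (MS 0%N); rewrite scale0r.
have Mcl (u : nat -> seqC) l : (forall n, M (u n)) -> h2 l -> tends u l -> M l.
  move=> Mu hl ul; split=> // d hd dp.
  apply: (tends_dot_cst ph (fun n => (Mu n).1) hl hd ul).
  by apply: nearW => n; exact: (Mu n).2.
have [m Mm orth] := projection_exists ph h2_complete (M := M) (fun x Mx => Mx.1) M0 MD MZ Mcl hp.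
pose g := p - m.
have hm := Mm.1; have hg : h2 g := DB ph hp hm.
have Mit n : M (iter n.+1 shiftS g).
  elim: n => [|n IH]; last exact: MSh.
  rewrite /= /g shiftSB; apply: MD; first exact: (MS 0%N).
  by rewrite -scaleN1r; apply: MZ; exact: MSh.
have g_orth n : dotS (iter n.+1 shiftS g) g = 0.
  by rewrite (dotC ph hg (Mit n).1) orth ?rmorph0//; exact: Mit.
have m0 : m 0%N = 0.
  rewrite -(dot_delta 0 hm); apply: Mm.2; first exact: h2_delta.
  by move=> n; rewrite dot_delta//; exact: (h2_iter_shiftS n.+1).
have K0 : sqn g != 0.
  apply/eqP => /(h2_definite hg) g0; move/eqP: p0; apply.
  have := congr1 (fun x : seqC => x 0%N) g0; rewrite /g -[LHS]/(p 0%N - m 0%N) m0 subr0.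
  by [].
have modulus : aeT (fun z => bd g z * (bd g z)^*%C) (fun=> (sqn g)%:C%C).
  apply: fourier_inj; [exact: L1T_corr|exact: L1T_cst|].
  have cst_f (k : C) n : fourier (fun=> k) n = k * (0 == n)%:R.
    rewrite -fourier_Xz -(fourierZ _ _ (L1T_Xz 0)); apply: eq_intT => t.
    by rewrite expr0z mulr1.
  have neg (n : nat) : fourier (fun z => bd g z * (bd g z)^*%C) (- n%:Z) = (sqn g)%:C%C * (0 == n)%:R.
    rewrite fourier_corr//; case: n => [|n]; last by rewrite g_orth mulr0.
    by rewrite mulr1 (dotxx ph).
  move=> [n|n]; last by rewrite NegzE neg cst_f.
  rewrite cst_f; transitivity ((fourier (fun z => bd g z * (bd g z)^*%C) (- n%:Z))^*%C).
    rewrite -fourierJ; last exact: L1T_corr.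
    by apply: eq_intT => t; rewrite rmorphM/= conjcK [X in _ = X * _]mulrC.
  by rewrite neg; case: n => [|n]; rewrite ?mulr1 ?mulr0 ?rmorph0 ?conjc_real.
(* Every element of the closed span of the [S^n p], in particular [g], is orthogonal
   to the restriction [w] of [g] to the zero set of [p]; so [g] vanishes on that set. *)
pose chi (z : C) : C := if bd p z == 0 then 1 else 0.
have mchi : mT chi by apply: mT_zero_set; exact: L2_mT (bd_L2 hp).
pose w z := chi z * bd g z.
have w2 : L2 w.
  apply: (@L2_bounded_mul _ (bd g) chi 1 mchi _ (bd_L2 hg)) => t.
  by rewrite /chi; case: ifP; rewrite ?normc1 ?normc0.
have [d [hd _ dw]] := L2_proj w2.
have dp n : dotS (iter n shiftS p) d = 0.
  rewrite dw; last exact: h2_iter_shiftS.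
  rewrite -[RHS](intT_cst (0 : C)); apply: ae_intT.
  - by apply: mTM; [exact: L2_mT (bd_L2 (h2_iter_shiftS n hp))|exact: mTJ (L2_mT w2)].
  - exact: mT_cst.
  have := bd_iter_shiftS n hp; apply: ae_imp => t ->.
  rewrite /w /chi; case: eqVneq => [->|_]; first by rewrite mulr0 mul0r.
  by rewrite mul0r rmorph0 mulr0.
have gd : dotS g d = 0 by rewrite /g (dotBl ph)// Mm.2 ?(dp 0%N) ?subr0// => n; exact: (dp n.+1).
pose u t := complex.Re (chi (expi t)) * normc (bd g (expi t)) ^+ 2.
have uE : cint u = 0.
  have := gd; rewrite dw// /dotT intTE => /eqP; rewrite eq_complex /= => /andP[/eqP h _].
  rewrite -[RHS]h; apply: eq_cint => t _; rewrite /u -Re_mulJ /w /chi.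
  by case: ifP => _; rewrite ?mul1r ?mul0r ?rmorph0 ?mulr0.
have u0 t : 0 <= u t.
  by apply: mulr_ge0; [rewrite /chi; case: ifP|exact: sqr_ge0].
have iu : int1 u.
  have /L2E[mg ig] := bd_L2 hg.
  apply: (int1_le _ _ ig) => [|t].
    apply: measurable_funM; first exact: mchi.1.
    by apply: measurable_funX; exact: (mT_normc mg).
  rewrite ger0_norm// /u /chi; case: ifP => _ /=; rewrite ?mul1r ?mul0r//.
  exact: sqr_ge0.
apply: (@ae_one_period _ (fun z => bd p z != 0)).
have := cint_eq0_ae iu u0 uE; apply: ae_imp2 modulus => t gK h It.
have := h It; rewrite /u /chi; case: eqVneq => //= _; rewrite mul1r.
move: gK; rewrite mulJ_normc => /complexI -> gz.
by rewrite gz eqxx in K0.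
Qed.

Lemma iter_bshiftK c m : (forall k, (k < m)%N -> c k = 0) -> iter m shiftS (iter m bshift c) = c.
Proof.
elim: m => //= m IH cm; rewrite -iterS iterSr -[RHS]IH; last by move=> k km; apply: cm; exact: ltnW.
congr (iter m shiftS _); rewrite [RHS]bshiftK iter_bshiftE addn0 cm//.
by rewrite scale0r add0r.
Qed.

(** After division by a power of [z], the value at 0 is nonzero. *)
Lemma nonvanishing c : h2 c -> c != 0 -> {ae mu, forall t, bd c (expi t) != 0}.
Proof.
move=> hc c0; have [m cm mmin] : exists2 m, c m != 0 & forall k, (k < m)%N -> c k = 0.
  have ex : exists m, c m != 0.
    apply/not_existsP => h; move/eqP: c0; apply; apply/funext => n.
    by apply/eqP; apply/negPn/negP; exact: h.
  exists (ex_minn ex); first by case: ex_minnP.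
  case: ex_minnP => m _ hm k km; apply/eqP; apply/negPn/negP => /hm.
  by rewrite leqNgt km.
have hb : h2 (iter m bshift c) by exact: h2_iter_bshift.
have b0 : iter m bshift c 0%N != 0 by rewrite iter_bshiftE addn0.
have := nonvanishing0 hb b0; have := bd_iter_shiftS m hb; rewrite iter_bshiftK//.
by apply: ae_imp2 => t -> h; rewrite mulf_neq0// -normc_gt0 normc_expiXz ltr01.
Qed.

End Nonvanishing.

(** * Hankel operators on coefficient sequences *)
Section Hankel.
Context {R : realType}.
Local Notation C := R[i].
Local Notation seqC := (nat -> C^o).
Implicit Types (f g h u : C -> C) (a b c d p : seqC) (w : C).
Local Notation ph := (@h2_prehilbert R).
Local Notation nrm := (@nrm R seqC dotS).

(** The operators [f |-> P (u conj f)], where [P] is the orthogonal projection on the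
    Hardy space: this is the Hankel operator of symbol [u] composed with [invC].
    Antilinearity removes the reflection, so that the Hankel property reads
    [H S = S^* H] and self-adjointness becomes [ah_sym]. *)
Record antihankel (H : seqC -> seqC) : Prop := AntiHankel {
  ah_h2 : forall c, h2 c -> h2 (H c);
  ahD : forall c d, h2 c -> h2 d -> H (c + d) = H c + H d;
  ahZ : forall (k : C) c, h2 c -> H (k *: c) = k^*%C *: H c;
  ah_sym : forall c d, h2 c -> h2 d -> dotS (H c) d = dotS (H d) c;
  ah_shift : forall c, h2 c -> H (shiftS c) = bshift (H c) }.

Lemma projH2P f : L2 f -> H2 (projH2 f) /\ forall n, coef (projH2 f) n = fourier f n%:Z.
Proof.
move=> f2; have [d [hd df dd]] := L2_proj f2.
have bdd := bd_L2 hd.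
have [hg gP] : [set g | H2 g /\ forall h, H2 h -> dotT (fun z => f z - g z) h = 0] (projH2 f).
  apply: xgetPex; exists (bd d); split; first exact: bd_H2.
  move=> h hh; have h2' := H2_L2 hh; have hbh := h2_coef hh.
  rewrite (dotBl L2_prehilbert f2 bdd h2') (dotC L2_prehilbert h2' f2) (dotC L2_prehilbert h2' bdd).
  have E k : L2 k -> dotT h k = dotT (bd (coef h)) k.
    move=> k2; apply: ae_dotT => //; first exact: bd_L2.
      by apply: aeT_sym; exact: bd_coef.
    exact: aeT_refl.
  by rewrite !E// -dd// subrr.
split=> // n; apply/esym/eqP; rewrite -subr_eq0; apply/eqP.
have := gP _ (H2_Xn n).
by rewrite (dotBl L2_prehilbert f2 (H2_L2 hg) (L2_Xz _)) -!fourierE.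
Qed.

Lemma normT_invC f : H2 f -> normT (invC f) = normT f.
Proof.
move=> hf; rewrite -(nrm_coef hf) -(nrm_coef (H2_invC hf)) (coef_invC hf).
by rewrite /nrm /sqn (dot_conjS (h2_coef hf) (h2_coef hf)) ReJ.
Qed.

Lemma normT_ae0 f : L2 f -> normT f <= 0 -> aeT f (fun=> 0).
Proof.
move=> f2 f0; apply: dotT_definite => //.
have := sqrtr_ge0 (complex.Re (dotT f f)); rewrite -/(normT f) => f0'.
have {f0 f0'} : normT f = 0 by apply/eqP; rewrite eq_le f0.
move=> /eqP; rewrite sqrtr_eq0 => h.
rewrite (dotxx L2_prehilbert f2); have := sqn_ge0 L2_prehilbert f2.
rewrite /sqn => h'; have -> : complex.Re (dotT f f) = 0 by apply/eqP; rewrite eq_le h.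
by [].
Qed.

(** This composition with [invC] turns a linear Hankel operator into an [antihankel]. *)
Definition seq_op (G : operator) c : seqC := coef (G (invC (bd c))).

Section BoundedOperator.
Variable G : @operator R.
Hypothesis bG : bounded_operator G.

(** Operators act on representatives; the norm bound forces them to respect almost
    everywhere equality. *)
Lemma bop_ae f g : H2 f -> H2 g -> aeT f g -> aeT (G f) (G g).
Proof.
case: bG => GH Glin [M GM] hf hg fg.
pose d := fun z => (-1) * f z + g z.
have hd : H2 d by apply: H2D => //; exact: H2Z.
have d0 : aeT d (fun=> 0) by move: fg; apply: ae_imp => t; rewrite /d => ->; rewrite mulN1r addNr.
have nd : normT d = 0.
  rewrite /normT (ae_dotT (H2_L2 hd) (L2_cst 0) (H2_L2 hd) (L2_cst 0) d0 d0).
  by rewrite (dot0l L2_prehilbert (L2_cst 0)) sqrtr0.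
have Gd0 : aeT (G d) (fun=> 0).
  by apply: normT_ae0; [exact: H2_L2 (GH _ hd)|have := GM _ hd; rewrite nd mulr0].
have := Glin (-1) f g hf hg; rewrite -/d; move: Gd0; apply: ae_imp2 => t -> /esym/eqP.
by rewrite mulN1r addrC subr_eq0 => /eqP.
Qed.

Lemma coef_bop_ae f g : H2 f -> H2 g -> aeT f g -> coef (G f) = coef (G g).
Proof.
case: bG => GH _ _ hf hg fg; apply: ae_coef; try exact: H2_mT (GH _ _).
exact: bop_ae.
Qed.

Lemma coef_bop f : H2 f -> coef (G f) = seq_op G (conjS (coef f)).
Proof.
move=> hf; have hc := h2_conjS (h2_coef hf).
apply: coef_bop_ae => //; first by apply: H2_invC; exact: bd_H2.
rewrite -{1}(invCK f); apply: aeT_invC; apply: aeT_sym.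
by rewrite -coef_invC//; apply: bd_coef; exact: H2_invC.
Qed.

Lemma seq_op_h2 c : h2 c -> h2 (seq_op G c).
Proof. by case: bG => GH _ _ hc; apply: h2_coef; apply: GH; apply: H2_invC; exact: bd_H2. Qed.

Lemma seq_op_linear (k : C) c d : h2 c -> h2 d ->
  seq_op G (k *: c + d) = k^*%C *: seq_op G c + seq_op G d.
Proof.
case: (bG) => GH Glin _ hc hd.
have hkc := h2Z k hc; have hs := h2D hkc hd.
have Hc := H2_invC (bd_H2 hc); have Hd := H2_invC (bd_H2 hd).
have Hs : H2 (fun z => k^*%C * invC (bd c) z + invC (bd d) z) by apply: H2D => //; exact: H2Z.
rewrite /seq_op.
have -> : coef (G (invC (bd (k *: c + d)))) = coef (G (fun z => k^*%C * invC (bd c) z + invC (bd d) z)).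
  apply: coef_bop_ae => //; first by apply: H2_invC; exact: bd_H2.
  have -> : (fun z => k^*%C * invC (bd c) z + invC (bd d) z) = invC (fun z => k * bd c z + bd d z).
    by apply/funext => z; rewrite /invC rmorphD rmorphM.
  apply: aeT_invC; apply: (aeT_trans (bdD hkc hd)).
  by have := bdZ k hc; apply: ae_imp => t ->.
have HGc := GH _ Hc; have HGd := GH _ Hd.
have -> : coef (G (fun z => k^*%C * invC (bd c) z + invC (bd d) z)) =
    coef (fun z => k^*%C * G (invC (bd c)) z + G (invC (bd d)) z).
  apply: ae_coef; [exact: H2_mT (GH _ Hs)| |exact: Glin].
  by apply: mTD; [apply: mTZ|]; exact: H2_mT.
rewrite coefD; [|exact: L1TZ (H2_L1 HGc)|exact: H2_L1].
by rewrite coefZ//; exact: H2_L1.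
Qed.

Lemma seq_opD c d : h2 c -> h2 d -> seq_op G (c + d) = seq_op G c + seq_op G d.
Proof. by move=> hc hd; have := seq_op_linear 1 hc hd; rewrite rmorph1 !scale1r. Qed.

Lemma seq_opZ (k : C) c : h2 c -> seq_op G (k *: c) = k^*%C *: seq_op G c.
Proof.
move=> hc; have h0 := D0 ph.
have z0 : seq_op G 0 = 0.
  by have := seq_opD h0 h0; rewrite addr0 => /eqP; rewrite -subr_eq0 opprD addrA subrr sub0r oppr_eq0 => /eqP.
by have := seq_op_linear k hc h0; rewrite addr0 z0 addr0.
Qed.

Lemma seq_op_bounded : exists M : R, forall c, h2 c -> nrm (seq_op G c) <= M * nrm c.
Proof.
case: bG => GH _ [M GM]; exists M => c hc; have hb := bd_H2 hc; have hi := H2_invC hb.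
rewrite /seq_op nrm_coef; last exact: GH.
by apply: (le_trans (GM _ hi)); rewrite (normT_invC hb) -(nrm_coef hb) (coef_bd hc).
Qed.

Variable v : nat -> C.
Hypothesis G_matrix : forall j k, seq_op G (delta k) j = v (j + k)%N.

(** Both sides agree on finite sequences because the matrix [v (j + k)] is symmetric,
    and both are continuous in [c]. *)
Lemma seq_op_coord c j : h2 c -> seq_op G c j = dotS (seq_op G (delta j)) c.
Proof.
have [M HM] := seq_op_bounded; have hd := @h2_delta R; have hHj := seq_op_h2 (hd j).
move=> hc; apply/eqP; rewrite -subr_eq0; apply/eqP.
apply: (@additive_eq0 _ (fun c => seq_op G c j - dotS (seq_op G (delta j)) c)
  (M + nrm (seq_op G (delta j))) _ _ _ _ hc) => [a b ha hb|a ha|k N].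
- rewrite (seq_opD ha hb) (dotDr ph ha hb hHj).
  rewrite -[(seq_op G a + seq_op G b) j]/(seq_op G a j + seq_op G b j) opprD addrACA//.
- rewrite mulrDl; apply: (le_trans (le_normcD _ _)); rewrite normcN; apply: lerD.
    exact: le_trans (normc_coord j (seq_op_h2 ha)) (HM _ ha).
  exact: (cauchy_schwarz ph hHj ha).
rewrite (seq_opZ k (hd N)) (dotZr ph k (hd N) hHj) (dot_delta N hHj).
by rewrite -[(_ *: seq_op G (delta N)) j]/(k^*%C * seq_op G (delta N) j) !G_matrix addnC subrr.
Qed.

Lemma seq_op_antihankel : antihankel (seq_op G).
Proof.
have hd := @h2_delta R; have [M HM] := seq_op_bounded.
split; [exact: seq_op_h2|exact: seq_opD|exact: seq_opZ| |].
- move=> c d hc hd'; have hHc := seq_op_h2 hc; apply/eqP; rewrite -subr_eq0; apply/eqP.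
  apply: (@additive_eq0 _ (fun d => dotS (seq_op G c) d - dotS (seq_op G d) c)
    (nrm (seq_op G c) + M * nrm c) _ _ _ _ hd') => [a b ha hb|a ha|k N].
  + rewrite (seq_opD ha hb) (dotDr ph ha hb hHc) (dotDl ph (seq_op_h2 ha) (seq_op_h2 hb) hc).
    by rewrite opprD addrACA.
  + rewrite mulrDl; apply: (le_trans (le_normcD _ _)); rewrite normcN; apply: lerD.
      exact: (cauchy_schwarz ph hHc ha).
    rewrite mulrAC; apply: (le_trans (cauchy_schwarz ph (seq_op_h2 ha) hc)).
    by apply: ler_wpM2r; [exact: nrm_ge0|exact: HM].
  rewrite (seq_opZ k (hd N)) (dotZr ph k (hd N) hHc) (dotZl ph _ (seq_op_h2 (hd N)) hc).
  by rewrite (dot_delta N hHc) (seq_op_coord N hc) subrr.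
- move=> c hc; apply/funext => j; have hsc := h2_shiftS hc.
  have E : bshift (seq_op G (delta j)) = seq_op G (delta j.+1).
    by apply/funext => k; rewrite /bshift !G_matrix addnS.
  have hHj := seq_op_h2 (hd j).
  rewrite (seq_op_coord j hsc) (dotC ph hsc hHj) (dot_shiftSr hc hHj).
  rewrite -(dotC ph hc (h2_bshift hHj)) E.
  exact/esym/(seq_op_coord j.+1 hc).
Qed.

(** The adjoint of [H C] is [C H], because [C] is a conjugation and [H] satisfies
    [ah_sym]. *)
Lemma coef_adjoint g : H2 g -> H2 (adjoint G g) /\ coef (adjoint G g) = conjS (seq_op G (coef g)).
Proof.
move=> hg; have ah := seq_op_antihankel.
have hcg := h2_coef hg; have hHg := seq_op_h2 hcg; have hq := h2_conjS hHg.
have GH : forall f, H2 f -> H2 (G f) by case: bG.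
have cand f : H2 f -> dotT (G f) g = dotT f (bd (conjS (seq_op G (coef g)))).
  move=> hf; have hcf := h2_coef hf; have hjf := h2_conjS hcf.
  transitivity (dotS (seq_op G (coef g)) (conjS (coef f))).
    by rewrite -(dotS_coef (GH _ hf) hg) (coef_bop hf); exact: (ah_sym ah hjf hcg).
  rewrite (dotC ph hjf hHg) -(dot_conjS hjf hHg) (conjSK (coef f)).
  have := dotS_coef hf (bd_H2 hq); rewrite (coef_bd hq); exact.
have [h1 h2'] : [set h | H2 h /\ forall f, H2 f -> dotT (G f) g = dotT f h] (adjoint G g).
  by apply: xgetPex; exists (bd (conjS (seq_op G (coef g)))); split; [exact: bd_H2|].
split=> //; apply/funext => n; rewrite -[in RHS](coef_bd hq).
have hz := H2_Xn n.
rewrite /coef !fourierE (dotC L2_prehilbert (L2_Xz n%:Z) (H2_L2 h1)).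
by rewrite (dotC L2_prehilbert (L2_Xz n%:Z) (bd_L2 hq)) -h2'// -cand.
Qed.

End BoundedOperator.

Definition is_hankel u (G : operator) := bounded_operator G /\
  forall q : {poly C}, aeT (G (horner q)) (projH2 (fun z => u z * invJ (horner q) z)).

Lemma hankel_matrix u G : L2 u -> is_hankel u G ->
  forall j k, seq_op G (delta k) j = fourier u (j + k)%N.
Proof.
move=> u2 [bG hG] j k.
have XE : (fun z : C => z ^ k%:Z) = horner ('X^k).
  by apply/funext => z; rewrite hornerXn.
have hz : H2 (fun z : C => z ^ k%:Z) by exact: H2_Xn.
have iE : invC (fun z : C => z ^ k%:Z) = (fun z => z ^ k%:Z).
  by apply/funext => z; rewrite /invC -!exprnP rmorphXn/= conjcK.
have w2 : L2 (fun z => u z * invJ (horner ('X^k)) z).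
  apply: (L2_circle _ (L2_Xz_mul (- k%:Z) u2)) => t.
  by rewrite /invJ hornerXn mulrC -expiXz_conj -exprnP rmorphXn.
have [Hp pE] := projH2P w2.
have -> : seq_op G (delta k) = coef (G (fun z => z ^ k%:Z)).
  apply: (coef_bop_ae bG) => //; first by apply: H2_invC; apply: bd_H2; exact: h2_delta.
  by rewrite -iE; apply: aeT_invC; exact: bd_delta.
have -> : coef (G (fun z => z ^ k%:Z)) = coef (projH2 (fun z => u z * invJ (horner ('X^k)) z)).
  apply: ae_coef; [|exact: H2_mT|by rewrite XE].
  by apply: H2_mT; case: bG => GH _ _; exact: GH.
rewrite pE; apply: eq_intT => t.
rewrite /invJ hornerXn -mulrA; congr (_ * _).
have -> : (expi t)^*%C ^+ k = expi t ^ (- k%:Z) by rewrite -expiXz_conj -exprnP rmorphXn.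
by rewrite -expfzDr ?expi_neq0// PoszD opprD addrC.
Qed.

(** If no operator had the defining property, [hankel u] would be the zero operator,
    which has no singular value. *)
Lemma hankelP u s : L2 u -> singular_value (hankel u) s -> is_hankel u (hankel u).
Proof.
move=> u2 [s0 [f [hf fE] f0]]; rewrite /hankel; case: xgetP => [G _ //|Gno].
exfalso; apply: f0; move: fE; rewrite /hankel.
have -> : xget (fun _ _ => 0) [set G | bounded_operator G /\ forall q : {poly C},
   aeT (G (horner q)) (projH2 (fun z => u z * invJ (horner q) z))] = (fun _ _ => 0).
  case: xgetP => // G _ hG; by case: (Gno G).
set A := adjoint _ => fE.
have H0 : H2 (fun _ : C => 0 : C) by exact: (H2_cst 0).
have [h1 hA] : [set h | H2 h /\ forall f0, H2 f0 -> dotT ((fun _ _ => 0) f0 : C -> C) (fun=> 0) = dotT f0 h] (A (fun=> 0)).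
  apply: xgetPex; exists (fun=> 0); split=> // g hg.
  by rewrite (dot0l L2_prehilbert (L2_cst 0)) (dot0r L2_prehilbert (H2_L2 hg)).
have A0 : aeT (A (fun=> 0)) (fun=> 0).
  apply: dotT_definite; first exact: H2_L2.
  by rewrite -(hA _ h1) (dot0l L2_prehilbert (L2_cst 0)).
move: fE A0; apply: ae_imp2 => t /= -> /eqP; rewrite mulf_eq0 => /orP[|/eqP//].
by rewrite rmorphXn expf_eq0/= => /eqP/complexI s00; rewrite s00 ltxx in s0.
Qed.

End Hankel.

(** * The Schmidt space *)
Section SchmidtSpace.
Context {R : realType}.
Local Notation C := R[i].
Local Notation seqC := (nat -> C^o).
Implicit Types (a b c d e f g h x y : seqC).
Local Notation ph := (@h2_prehilbert R).
Local Notation nrm := (@nrm R seqC dotS).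
Local Notation sqn := (@sqn R seqC dotS).
Local Notation tends := (@tends R seqC dotS).
Variables (H : seqC -> seqC) (s : R).
Hypothesis ah : antihankel H.
Hypothesis s0 : 0 < s.
Let hd := @h2_delta R.

Definition schmidt c := h2 c /\ H (H c) = ((s ^+ 2)%:C)%C *: c.
Local Notation E := schmidt.
(** On the Schmidt space this is an antiunitary involution, by [JJ] and [J_dot]. *)
Definition invol c : seqC := ((s^-1)%:C)%C *: H c.
Local Notation J := invol.

Lemma E_h2 c : E c -> h2 c. Proof. by case. Qed.
Hint Resolve E_h2 : core.

Lemma H_sqr_sym c d : h2 c -> h2 d -> dotS (H (H c)) d = dotS c (H (H d)).
Proof.
move=> hc hd'; have hHc := ah_h2 ah hc; have hHd := ah_h2 ah hd'.
rewrite (ah_sym ah hHc hd') (dotC ph hHc hHd) (ah_sym ah hc hHd).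
by rewrite -(dotC ph (ah_h2 ah hHd) hc).
Qed.

Lemma H0 : H 0 = 0.
Proof. by have := ahZ ah 0 (D0 ph); rewrite scale0r rmorph0 scale0r. Qed.

Lemma real_sqr_conj : (((s ^+ 2)%:C)%C : C)^*%C = ((s ^+ 2)%:C)%C.
Proof. exact: conjc_real. Qed.

Lemma E0 : E 0.
Proof. by split; [exact: (D0 ph)|rewrite !H0 scaler0]. Qed.

Lemma ED c d : E c -> E d -> E (c + d).
Proof.
move=> [hc Ec] [hd' Ed]; split; first exact: h2D.
rewrite (ahD ah hc hd') (ahD ah (ah_h2 ah hc) (ah_h2 ah hd')) Ec Ed.
by rewrite scalerDr.
Qed.

Lemma EZ (k : C) c : E c -> E (k *: c).
Proof.
move=> [hc Ec]; split; first exact: h2Z.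
by rewrite (ahZ ah k hc) (ahZ ah _ (ah_h2 ah hc)) conjcK Ec !scalerA mulrC.
Qed.

Lemma EB c d : E c -> E d -> E (c - d).
Proof. by move=> Ec Ed; rewrite -(scaleN1r d); apply: ED => //; exact: EZ. Qed.

(** The eigenvalue equation is tested against the basis vectors, where the symmetry of
    [H^2] moves the operator to the other side. *)
Lemma E_closed (u : nat -> seqC) l : (forall n, E (u n)) -> h2 l -> tends u l -> E l.
Proof.
move=> Eu hl ul; split=> //.
have hHl := ah_h2 ah (ah_h2 ah hl).
have hsl := h2Z ((s ^+ 2)%:C)%C hl.
apply/eqP; rewrite -subr_eq0; apply/eqP; apply: h2_total; first exact: (DB ph hHl hsl).
move=> k; have hHd := ah_h2 ah (ah_h2 ah (hd k)).
have hsd := h2Z ((s ^+ 2)%:C)%C (hd k).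
have move_op y : h2 y -> dotS (H (H y) - ((s ^+ 2)%:C)%C *: y) (delta k) =
    dotS y (H (H (delta k)) - ((s ^+ 2)%:C)%C *: delta k).
  move=> hy; rewrite (dotBl ph (ah_h2 ah (ah_h2 ah hy)) (h2Z _ hy) (hd k)).
  rewrite (dotBr ph hHd hsd hy) (H_sqr_sym hy (hd k)) (dotZl ph _ hy (hd k)).
  by rewrite (dotZr ph _ (hd k) hy) real_sqr_conj.
rewrite (move_op _ hl).
apply: (tends_dot_cst ph (fun n => (Eu n).1) hl (DB ph hHd hsd) ul).
apply: nearW => n; rewrite -(move_op _ (Eu n).1) (Eu n).2 subrr.
exact: (dot0l ph (hd k)).
Qed.

Lemma J_h2 c : h2 c -> h2 (J c).
Proof. by move=> hc; apply: h2Z; exact: (ah_h2 ah hc). Qed.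

Lemma sV_conj : (((s^-1)%:C)%C : C)^*%C = ((s^-1)%:C)%C.
Proof. exact: conjc_real. Qed.

Lemma sV2 : ((s^-1)%:C)%C * ((s^-1)%:C)%C * ((s ^+ 2)%:C)%C = 1 :> C.
Proof.
rewrite -!rmorphM/= (_ : s^-1 * s^-1 * s ^+ 2 = 1) ?rmorph1//.
by field; rewrite gt_eqF.
Qed.

Lemma HJ c : E c -> H (J c) = s%:C%C *: c.
Proof.
move=> [hc Ec]; rewrite /J (ahZ ah _ (ah_h2 ah hc)) Ec sV_conj scalerA.
congr (_ *: _); rewrite -rmorphM/=; congr (_%:C)%C; field; by rewrite gt_eqF.
Qed.

Lemma sJ c : H c = s%:C%C *: J c.
Proof.
rewrite /J scalerA -rmorphM/= divff ?gt_eqF// rmorph1 scale1r//.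
Qed.

Lemma JJ c : E c -> J (J c) = c.
Proof.
move=> Ec; rewrite {1}/J (HJ Ec) scalerA -rmorphM/= mulVf ?gt_eqF// rmorph1 scale1r//.
Qed.

Lemma EJ c : E c -> E (J c).
Proof.
move=> Ec; split; first exact: J_h2 (E_h2 Ec).
rewrite (HJ Ec) (ahZ ah _ (E_h2 Ec)) [in LHS]sJ scalerA conjc_real.
by rewrite -rmorphM -expr2.
Qed.

Lemma J_dot c x : E c -> h2 x -> dotS (J c) (J x) = dotS x c.
Proof.
move=> Ec hx; have hc := E_h2 Ec; have hHc := ah_h2 ah hc; have hHx := ah_h2 ah hx.
rewrite /J (dotZl ph _ hHc (h2Z _ hHx)) (dotZr ph _ hHx hHc) (ah_sym ah hc hHx).
rewrite (H_sqr_sym hx hc) Ec.2 (dotZr ph _ hc hx) sV_conj real_sqr_conj !mulrA sV2 mul1r//.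
Qed.

Lemma J_sqn c : E c -> sqn (J c) = sqn c.
Proof. by move=> Ec; rewrite /sqn (J_dot Ec (E_h2 Ec)). Qed.

Lemma J_shiftS c : h2 c -> J (shiftS c) = bshift (J c).
Proof. by move=> hc; rewrite /J (ah_shift ah hc). Qed.

Lemma J_iter_shiftS c n : h2 c -> J (iter n shiftS c) = iter n bshift (J c).
Proof.
move=> hc; elim: n => //= n IH.
by rewrite J_shiftS ?IH//; exact: h2_iter_shiftS.
Qed.

(** [S^* (J g) = J f] has the same norm as [J g], because [J] and [S] preserve norms;
    so the constant coefficient of [J g] vanishes. *)
Lemma J_shift_lift g f : E g -> E f -> f = shiftS g -> J g = shiftS (J f).
Proof.
move=> Eg Ef fg; have hg := E_h2 Eg; have hJg := J_h2 hg.
have b : bshift (J g) = J f by rewrite fg (J_shiftS hg).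
have := sqn_bshift hJg; rewrite b (J_sqn Eg) (J_sqn Ef) fg (sqn_shiftS hg) => h.
have Jg0 : J g 0%N = 0.
  apply/eq0_normc/eqP; rewrite -sqrf_eq0; apply/eqP.
  by move: h; move: (sqn g) (normc _ ^+ 2) => x y h; rewrite -[LHS](addrK x) -h subrr.
by rewrite {1}(bshiftK (J g)) Jg0 scale0r add0r b -fg.
Qed.

(** * Near invariance of the Schmidt space *)
Section LowestIndex.
(** [m] is the order of the common zero at [0] of the Schmidt space. *)
Variable m : nat.
Hypothesis Em_lt : forall e k, E e -> (k < m)%N -> e k = 0.
Hypothesis Em : exists2 e, E e & e m != 0.

Lemma Em_shift h : h2 h -> (forall k, (k < m)%N -> h k = 0) -> shiftS h m = 0.
Proof. by move=> hh h0; case: m h0 => //= m' h0; apply: h0. Qed.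

Lemma iter_bshift_decomp y n : h2 y ->
  y = psum delta y n + iter n shiftS (iter n bshift y).
Proof.
move=> hy; elim: n => [|n IH]; first by rewrite /psum big_ord0 add0r.
rewrite {1}IH {1}(bshiftK (iter n bshift y)) /psum big_ord_recr/= -addrA; congr (_ + _).
have itD a b k : iter k shiftS (a + b) = iter k shiftS a + iter k shiftS b.
  by elim: k => //= k ->; rewrite shiftSD.
have itZ (l : C) a k : iter k shiftS (l *: a) = l *: iter k shiftS a.
  by elim: k => //= k ->; rewrite shiftSZ.
rewrite itD itZ iter_bshiftE addn0 -iterSr; congr (_ *: _ + _).
elim: n {IH} => //= n ->; apply/funext => -[|k] //=.
Qed.

(** Write [f = S^(m+1) g] and [y = H g]. Then [(H^2 - s^2) g] is the combination of the
    [H (delta k)], [k <= m], with coefficients [conj (y k)]. It is orthogonal to [E], and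
    pairing it with [J e], where [e] in [E] has a nonzero coefficient of index [m], yields
    [y m = 0]. For [h = S^* f = S^m g] this says that [H h] vanishes at 0, and then
    [H^2 f = s^2 f] descends to [h]. *)
Lemma near_invariant f : E f -> f m = 0 -> f = shiftS (bshift f) /\ E (bshift f).
Proof.
move=> Ef fm; have hf := E_h2 Ef.
have flt k : (k < m.+1)%N -> f k = 0.
  by rewrite ltnS leq_eqVlt => /orP[/eqP->//|km]; exact: Em_lt.
have fS : f = shiftS (bshift f).
  by rewrite {1}(bshiftK f) flt// scale0r add0r.
split=> //.
pose g := iter m.+1 bshift f; have hg : h2 g by exact: h2_iter_bshift.
have fg : iter m.+1 shiftS g = f by exact: iter_bshiftK.
have hgE : bshift f = iter m shiftS g by rewrite -fg.
pose y := H g; have hy := ah_h2 ah hg.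
have it_H n c : h2 c -> H (iter n shiftS c) = iter n bshift (H c).
  move=> hc; elim: n => //= n IH; rewrite (ah_shift ah (h2_iter_shiftS n hc)).
  by rewrite IH.
have Hf : H f = iter m.+1 bshift y by rewrite -fg it_H.
have hHf := ah_h2 ah hf.
have ym : y m = 0.
  have [e0 Ee0 e0m] := Em; pose e := J e0; have Ee := EJ Ee0; have he := E_h2 Ee.
  have hps n : h2 (psum delta y n) by exact: (D_psum ph hd).
  have Hps n : dotS (H (psum delta y n)) e = \sum_(k < n) (y k)^*%C * H e k.
    elim: n => [|n IH].
      by rewrite /psum !big_ord0 H0 (dot0l ph he).
    have hyd := h2Z (y n) (hd n).
    have -> : psum delta y n.+1 = psum delta y n + y n *: delta n by rewrite /psum big_ord_recr.
    rewrite big_ord_recr (ahD ah (hps n) hyd) (ahZ ah _ (hd n)).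
    rewrite (dotDl ph (ah_h2 ah (hps n)) (h2Z _ (ah_h2 ah (hd n))) he) IH; congr (_ + _).
    rewrite (dotZl ph _ (ah_h2 ah (hd n)) he) (ah_sym ah (hd n) he).
    by rewrite (dot_delta n (ah_h2 ah he)).
  have yE := iter_bshift_decomp m.+1 hy.
  have hit := h2_iter_shiftS m.+1 (h2_iter_bshift m.+1 hy).
  have Hy : dotS (H y) e = \sum_(k < m.+1) (y k)^*%C * H e k + ((s ^+ 2)%:C)%C * dotS g e.
    transitivity (dotS (H (psum delta y m.+1 + iter m.+1 shiftS (iter m.+1 bshift y))) e).
      by rewrite -yE.
    rewrite (ahD ah (hps _) hit).
    rewrite (dotDl ph (ah_h2 ah (hps _)) (ah_h2 ah hit) he) Hps; congr (_ + _).
    transitivity (dotS (((s ^+ 2)%:C)%C *: g) e); last exact: (dotZl ph _ hg he).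
    have itZ (l : C) a k : iter k bshift (l *: a) = l *: iter k bshift a.
      by elim: k => //= k ->; rewrite bshiftZ.
    by rewrite -Hf (it_H _ _ hHf) Ef.2 itZ.
  have Hy2 : dotS (H y) e = ((s ^+ 2)%:C)%C * dotS g e.
    by rewrite (H_sqr_sym hg he) Ee.2 (dotZr ph _ he hg) real_sqr_conj.
  have EHe : E (H e) by rewrite (HJ Ee0); exact: EZ.
  move: Hy; rewrite Hy2 big_ord_recr/= big1 ?add0r; last first.
    by move=> k _; rewrite (Em_lt EHe)// mulr0.
  rewrite -[X in X = _]add0r => /addIr /esym/eqP; rewrite mulf_eq0 conjc_eq0 => /orP[/eqP//|].
  rewrite (HJ Ee0) -[X in X == 0]/(s%:C%C * e0 m) mulf_eq0 (negbTE e0m) orbF.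
  by move=> /eqP/complexI sz; move: s0; rewrite sz ltxx.
split; first exact: h2_bshift.
have hit := h2_iter_shiftS m hg.
have Hh : H (bshift f) = iter m bshift y by rewrite hgE it_H.
have z0 : H (bshift f) 0%N = 0 by rewrite Hh iter_bshiftE addn0.
have hHb := ah_h2 ah (h2_bshift hf).
rewrite (bshiftK (H (bshift f))) z0 scale0r add0r (ah_shift ah (h2_bshift hHb)).
have -> : bshift (H (bshift f)) = H f by rewrite Hh Hf.
by rewrite Ef.2 bshiftZ.
Qed.

(** [p] is the normalised projection of [delta m] on [E], which represents the
    functional [y |-> y m] there. *)
Lemma extremal_exists : exists p (r : C),
  [/\ E p, dotS p p = 1, r != 0 & forall y, E y -> y m = r * dotS y p].
Proof.
have [q Eq qP] := projection_exists ph h2_complete (M := E) E_h2 E0 ED EZ E_closed (hd m).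
have hq := E_h2 Eq.
have yq y : E y -> y m = dotS y q.
  move=> Ey; have hy := E_h2 Ey; rewrite -(dot_delta m hy).
  rewrite (dotC ph (hd m) hy) (dotC ph hq hy); congr (_^*%C).
  by apply/eqP; rewrite -subr_eq0 -(dotBl ph (hd m) hq hy); apply/eqP; exact: qP.
have n0 : nrm q != 0.
  apply/eqP => nq; have [e Ee] := Em; rewrite (yq e Ee).
  have q0 : q = 0 by apply: (h2_definite hq); rewrite -(sqr_nrm ph hq) nq expr0n.
  by rewrite q0 (dot0r ph (E_h2 Ee)) eqxx.
pose k : C := ((nrm q)^-1)%:C%C.
have kJ : k^*%C = k by exact: conjc_real.
have nk : (nrm q)%:C%C * k = 1 by rewrite -rmorphM mulfV// rmorph1.
exists (k *: q), (nrm q)%:C%C; split.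
- exact: EZ.
- rewrite (dotZl ph k hq (h2Z k hq)) (dotZr ph k hq hq) kJ (dotxx ph hq) -(sqr_nrm ph hq).
  rewrite rmorphXn /=.
  have aux (x y : C) : y * (y * x ^+ 2) = (x * y) * (x * y) by ring.
  by rewrite aux nk mulr1.
- by apply/negP => /eqP/complexI/eqP; rewrite (negbTE n0).
move=> y Ey; have hy := E_h2 Ey.
by rewrite (dotZr ph k hq hy) kJ mulrA nk mul1r yq.
Qed.

Lemma dot_iter_shiftSr n a b : h2 a -> h2 b ->
  dotS (iter n shiftS a) b = dotS a (iter n bshift b).
Proof.
move=> ha; elim: n b => //= n IH b hb.
rewrite (dot_shiftSr (h2_iter_shiftS n ha) hb) (IH _ (h2_bshift hb)) -iterSr//.
Qed.

(** * Division by the extremal function *)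
Section Extremal.
Variables (p : seqC) (r : C).
Hypotheses (Ep : E p) (pp : dotS p p = 1) (r0 : r != 0).
Hypothesis pm : forall y, E y -> y m = r * dotS y p.
Let q := J p.
Let hp : h2 p := E_h2 Ep.
Let Eq : E q := EJ Ep.
Let hq : h2 q := E_h2 Eq.

Lemma orth_p y : E y -> y m = 0 -> dotS y p = 0.
Proof. by move=> Ey; rewrite pm// => /eqP; rewrite mulf_eq0 (negbTE r0) => /eqP. Qed.

Lemma orth_shift g : E g -> E (shiftS g) -> dotS (shiftS g) p = 0.
Proof.
move=> Eg Esg; apply: orth_p => //; apply: Em_shift; first exact: E_h2.
by move=> k; exact: Em_lt.
Qed.

Definition deflate f := f - dotS f p *: p.
(** One step of the division by [p]: [f] is [<f,p> p] plus [z] times [bstep f]. *)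
Definition bstep f := bshift (deflate f).
Definition codeflate g := g - dotS g q *: q.
(** The adjoint of [bstep] on [E], by [bstep_adj]. *)
Definition fstep g := shiftS (codeflate g).

Lemma E_deflate f : E f -> E (deflate f).
Proof. by move=> Ef; apply: EB => //; exact: EZ. Qed.
Lemma E_codeflate f : E f -> E (codeflate f).
Proof. by move=> Ef; apply: EB => //; exact: EZ. Qed.

Lemma qq : dotS q q = 1.
Proof. by rewrite (J_dot Ep hp). Qed.

Lemma dot_deflate f : E f -> dotS (deflate f) p = 0.
Proof.
move=> Ef; have hf := E_h2 Ef.
by rewrite (dotBl ph hf (h2Z _ hp) hp) (dotZl ph _ hp hp) pp mulr1 subrr.
Qed.

Lemma dot_codeflate f : E f -> dotS (codeflate f) q = 0.
Proof.
move=> Ef; have hf := E_h2 Ef.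
by rewrite (dotBl ph hf (h2Z _ hq) hq) (dotZl ph _ hq hq) qq mulr1 subrr.
Qed.

Lemma bstepP f : E f -> deflate f = shiftS (bstep f) /\ E (bstep f).
Proof.
move=> Ef; have Ed := E_deflate Ef; apply: near_invariant => //.
by rewrite pm// dot_deflate// mulr0.
Qed.

Lemma bstep_decomp f : E f -> f = dotS f p *: p + shiftS (bstep f).
Proof. by move=> Ef; rewrite -(bstepP Ef).1 addrC subrK. Qed.

Lemma E_bstep f : E f -> E (bstep f). Proof. by move=> /bstepP[]. Qed.

(** Near invariance conjugated by [J]: as [J h] is orthogonal to [p], it is [S g] for
    some [g] in [E], and then [S h = J g]. *)
Lemma E_shift h : E h -> dotS h q = 0 -> E (shiftS h).
Proof.
move=> Eh hq0; have EJh := EJ Eh; have hh := E_h2 Eh.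
have m0 : J h m = 0.
  rewrite (pm EJh) -{1}(JJ Ep) (J_dot Eh hq) (dotC ph hh hq) hq0.
  by rewrite rmorph0 mulr0.
have [fS Eb] := near_invariant EJh m0.
by rewrite -(JJ Eh) -(J_shift_lift Eb EJh fS); exact: EJ.
Qed.

Lemma E_fstep g : E g -> E (fstep g).
Proof. by move=> Eg; apply: E_shift; [exact: E_codeflate|exact: dot_codeflate]. Qed.

Lemma dot_fstep_p g : E g -> dotS (fstep g) p = 0.
Proof. by move=> Eg; apply: orth_shift; [exact: E_codeflate|exact: E_fstep]. Qed.

Lemma dot_bstep_q f : E f -> dotS (bstep f) q = 0.
Proof.
move=> Ef; have [dS Eb] := bstepP Ef; have Ed := E_deflate Ef.
have hb := E_h2 Eb; have EJd := EJ Ed.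
have JS := J_shift_lift Eb Ed dS.
have ES : E (shiftS (J (deflate f))) by rewrite -JS; exact: EJ.
have := J_dot Eq hb; rewrite (JJ Ep) JS => <-.
by rewrite (dotC ph (E_h2 ES) hp) (orth_shift EJd ES) rmorph0.
Qed.

(** The ranges of [bstep] and [fstep] are orthogonal to [q] and [p] respectively, so
    neither correction term is seen by the other factor. *)
Lemma bstep_adj f g : E f -> E g -> dotS (bstep f) g = dotS f (fstep g).
Proof.
move=> Ef Eg; have [dS Eb] := bstepP Ef.
have hf := E_h2 Ef; have hg := E_h2 Eg; have hb := E_h2 Eb.
have Ec := E_codeflate Eg; have hc := E_h2 Ec; have hs := E_h2 (E_fstep Eg).
have -> : dotS (bstep f) g = dotS (bstep f) (codeflate g).
  by rewrite (dotBr ph hg (h2Z _ hq) hb) (dotZr ph _ hq hb) dot_bstep_q// mulr0 subr0.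
rewrite -(dot_shiftS hb hc) -dS (dotBl ph hf (h2Z _ hp) hs) (dotZl ph _ hp hs).
by rewrite (dotC ph hs hp) (dot_fstep_p Eg) rmorph0 mulr0 subr0.
Qed.

Lemma bstepD f g : E f -> E g -> bstep (f + g) = bstep f + bstep g.
Proof.
move=> Ef Eg; rewrite /bstep -bshiftD; congr bshift; rewrite /deflate.
by rewrite (dotDl ph (E_h2 Ef) (E_h2 Eg) hp) scalerDl opprD addrACA.
Qed.
Lemma bstepZ (k : C) f : E f -> bstep (k *: f) = k *: bstep f.
Proof.
move=> Ef; rewrite /bstep -bshiftZ; congr bshift; rewrite /deflate.
by rewrite (dotZl ph k (E_h2 Ef) hp) scalerBr scalerA.
Qed.

Lemma E_iter_bstep n f : E f -> E (iter n bstep f).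
Proof. by move=> Ef; elim: n => //= n; exact: E_bstep. Qed.

(** The coefficients of the quotient [f / p], produced by iterating the division step. *)
Definition quot f : seqC := fun n => dotS (iter n bstep f) p.

Lemma quotD f g : E f -> E g -> quot (f + g) = quot f + quot g.
Proof.
move=> Ef Eg; apply/funext => n; rewrite -[RHS]/(quot f n + quot g n) /quot.
have -> : iter n bstep (f + g) = iter n bstep f + iter n bstep g.
  by elim: n => //= n ->; rewrite bstepD//; exact: E_iter_bstep.
exact: (dotDl ph (E_h2 (E_iter_bstep n Ef)) (E_h2 (E_iter_bstep n Eg)) hp).
Qed.
Lemma quotZ (k : C) f : E f -> quot (k *: f) = k *: quot f.
Proof.
move=> Ef; apply/funext => n; rewrite -[RHS]/(k * quot f n) /quot.
have -> : iter n bstep (k *: f) = k *: iter n bstep f.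
  by elim: n => //= n ->; rewrite bstepZ//; exact: E_iter_bstep.
exact: (dotZl ph k (E_h2 (E_iter_bstep n Ef)) hp).
Qed.
Lemma quotB f g : E f -> E g -> quot (f - g) = quot f - quot g.
Proof. by move=> Ef Eg; rewrite -(scaleN1r g) (quotD Ef (EZ _ Eg)) (quotZ _ Eg) scaleN1r. Qed.

Lemma quot_bstep f : quot (bstep f) = bshift (quot f).
Proof. by apply/funext => n; rewrite /quot /bshift iterSr. Qed.

Lemma quot_p : quot p = delta 0.
Proof.
have b0 : bstep p = 0 by rewrite /bstep /deflate pp scale1r subrr.
have b00 : bstep 0 = 0 by rewrite -{1}(scale0r p) (bstepZ 0 Ep) scale0r.
apply/funext => -[|n]; rewrite /quot; first exact: pp.
rewrite iterSr b0 (_ : iter n bstep 0 = 0); first exact: (dot0l ph hp).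
by elim: n => //= n ->.
Qed.

Lemma quot_shiftS g : E g -> dotS g q = 0 -> quot (shiftS g) = shiftS (quot g).
Proof.
move=> Eg gq; have ES := E_shift Eg gq; have d0 := orth_shift Eg ES.
have b : bstep (shiftS g) = g by rewrite /bstep /deflate d0 scale0r subr0.
by apply/funext => -[|n]; rewrite /quot ?iterSr ?b//; exact: d0.
Qed.

Lemma quot_fstep g : E g -> quot (fstep g) = shiftS (quot g) - dotS g q *: shiftS (quot q).
Proof.
move=> Eg; rewrite /fstep quot_shiftS; [|exact: E_codeflate|exact: dot_codeflate].
by rewrite /codeflate (quotB Eg (EZ _ Eq)) (quotZ _ Eq) shiftSB shiftSZ.
Qed.

Lemma sqn_bstep f : E f -> sqn f = normc (dotS f p) ^+ 2 + sqn (bstep f).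
Proof.
move=> Ef; have hb := E_h2 (E_bstep Ef); have hs := h2_shiftS hb.
have o : dotS (dotS f p *: p) (shiftS (bstep f)) = 0.
  rewrite (dotZl ph _ hp hs) (dotC ph hs hp) -(bstepP Ef).1 (dot_deflate Ef).
  by rewrite rmorph0 mulr0.
have s1 : sqn p = 1 by rewrite /sqn pp.
rewrite -(sqn_shiftS hb) -[X in X + _]mulr1 -{1}s1 -(sqnZ ph _ hp).
by rewrite -(sqnD_orth ph (h2Z _ hp) hs o) -bstep_decomp.
Qed.

Lemma sqn_iter_bstep f n : E f ->
  sqn f = \sum_(k < n) normc (quot f k) ^+ 2 + sqn (iter n bstep f).
Proof.
move=> Ef; elim: n => [|n IH]; first by rewrite big_ord0 add0r.
rewrite IH (sqn_bstep (E_iter_bstep n Ef)) addrA big_ord_recr; reflexivity.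
Qed.

(** Each division step loses exactly the squared modulus of the coefficient it
    produces. *)
Lemma quotP f : E f -> h2 (quot f) /\ sqn (quot f) <= sqn f.
Proof.
move=> Ef; apply: riesz_fischer => n; rewrite (sqn_iter_bstep n Ef) lerDl.
exact: (sqn_ge0 ph (E_h2 (E_iter_bstep n Ef))).
Qed.
Lemma h2_quot f : E f -> h2 (quot f). Proof. by move=> /quotP[]. Qed.
Hint Resolve h2_quot : core.

Lemma quot_mul_decomp f : E f -> aeT (fun z => bd p z * bd (quot f) z)
  (fun z => dotS f p * bd p z + z ^ 1 * (bd p z * bd (quot (bstep f)) z)).
Proof.
move=> Ef; have Eb := E_bstep Ef; have hqb := h2_quot Eb; set k := dotS f p.
have qf : quot f = k *: delta 0 + shiftS (quot (bstep f)) by rewrite quot_bstep; exact: bshiftK.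
have a1 := bdD (h2Z k (hd 0)) (h2_shiftS hqb); rewrite -qf in a1.
have a2 : aeT (bd (k *: delta 0)) (fun=> k).
  apply: (aeT_trans (bdZ k (hd 0))); move: (@bd_delta R 0); apply: ae_imp => t ->.
  by rewrite expr0z mulr1.
have a3 : aeT (bd (quot f)) (fun z => k + bd (shiftS (quot (bstep f))) z).
  by move: a1 a2; apply: ae_imp2 => t -> ->.
by move: a3 (bd_shiftS hqb); apply: ae_imp2 => t -> ->; rewrite mulrDr mulrC mulrCA.
Qed.

(** Both sides have the same Fourier coefficients: the division step reduces the
    coefficient of index [n + 1] for [f] to that of index [n] for [bstep f]. *)
Lemma quot_mul f : E f -> aeT (bd f) (fun z => bd p z * bd (quot f) z).
Proof.
have L1 f' : E f' -> L1T (fun z => bd p z * bd (quot f') z).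
  by move=> Ef; apply: L2M; apply: bd_L2 => //; exact: h2_quot.
have Hneg f' n : E f' -> n < 0 -> fourier (fun z => bd p z * bd (quot f') z) n = 0.
  by move=> Ef n0; apply: fourier_mul_neg => //; apply: bd_H2 => //; exact: h2_quot.
move=> Ef; apply: fourier_inj; [exact: H2_L1 (bd_H2 (E_h2 Ef))|exact: L1|].
move=> [n|n]; last by rewrite (bd_H2 (E_h2 Ef)).2// Hneg.
rewrite -[LHS]/(coef (bd f) n) (coef_bd (E_h2 Ef)).
elim: n f Ef => [|n IH] f Ef; have Eb := E_bstep Ef.
all: have Lb := L1 _ Eb; have Lp := H2_L1 (bd_H2 hp).
all: rewrite (ae_fourier _ (L1 _ Ef).1 _ (quot_mul_decomp Ef)); last first.
1,3: by apply: mTD; [exact: (L1TZ _ Lp).1|exact: (L1T_Xz_mul _ Lb).1].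
all: rewrite (fourierD _ (L1TZ _ Lp) (L1T_Xz_mul _ Lb)) (fourierZ _ _ Lp) fourier_Xz_mul.
all: rewrite -[fourier (bd p) _]/(coef (bd p) _) (coef_bd hp) {1}(bstep_decomp Ef).
  by rewrite (Hneg _ _ Eb).
by rewrite -[n.+1]addn1 PoszD addrK -(IH _ Eb) addn1.
Qed.

(** Both sides have the same Fourier coefficients, because [J S^n = S^*^n J] and [J]
    is antiunitary on [E]. *)
Lemma J_mulJ f g : E f -> E g ->
  aeT (fun z => bd (J f) z * (bd (J g) z)^*%C) (fun z => bd g z * (bd f z)^*%C).
Proof.
have neg f' g' (n : nat) : E f' -> E g' ->
    fourier (fun z => bd (J f') z * (bd (J g') z)^*%C) (- n%:Z) =
    fourier (fun z => bd g' z * (bd f' z)^*%C) (- n%:Z).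
  move=> Ef Eg; have hf := E_h2 Ef; have hg := E_h2 Eg.
  have hJf := J_h2 hf; have hJg := J_h2 hg; have hi := h2_iter_shiftS n hg.
  rewrite (fourier_corr n hJf hJg) (fourier_corr n hg hf).
  rewrite -(J_dot Ef hi) (J_iter_shiftS n hg).
  exact: dot_iter_shiftSr.
move=> Ef Eg; have hf := E_h2 Ef; have hg := E_h2 Eg.
have hJf := J_h2 hf; have hJg := J_h2 hg.
apply: fourier_inj; [exact: L1T_corr|exact: L1T_corr|].
have pos c d (n : int) : h2 c -> h2 d -> fourier (fun z => bd c z * (bd d z)^*%C) n =
    (fourier (fun z => bd d z * (bd c z)^*%C) (- n))^*%C.
  move=> hc hd'; rewrite -(fourierJ _ (L1T_corr hd' hc)); apply: eq_intT => t.
  by rewrite rmorphM/= conjcK [in RHS](mulrC (_^*%C)).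
move=> [n|n]; last by rewrite NegzE neg.
by rewrite (pos _ _ _ hJf hJg) (pos _ _ _ hg hf) neg.
Qed.

(** * The inner function *)
Local Notation mu := (@lebesgue_measure R).

Lemma ae_and (P Q : R -> Prop) : {ae mu, forall t, P t} -> {ae mu, forall t, Q t} ->
  {ae mu, forall t, P t /\ Q t}.
Proof. exact: ae_imp2. Qed.

Lemma unimodular_quotient (P A B D JF F Q : C) : JF = P * A -> Q = P * D -> F = P * B ->
  JF * Q^*%C = P * F^*%C -> P != 0 -> normc D = 1 -> A = D * B^*%C.
Proof.
move=> -> -> -> h P0 D1; have PJ0 : P^*%C != 0 by rewrite conjc_eq0.
have DD1 : D * D^*%C = 1 by rewrite mulJ_normc D1 expr1n.
move: h; rewrite !rmorphM/= => h.
apply: (mulfI (mulf_neq0 P0 PJ0)).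
transitivity (D * (P * A * (P^*%C * D^*%C))); last by rewrite h; ring.
rewrite -[A]mul1r -[in LHS]DD1; ring.
Qed.

Definition theta_seq := shiftS (quot q).
Local Notation theta := (bd theta_seq).
Let hth : h2 theta_seq := h2_shiftS (h2_quot Eq).

Lemma p_ae_neq0 : {ae mu, forall t, bd p (expi t) != 0}.
Proof.
apply: nonvanishing => //; apply/eqP => p0; move: pp.
by rewrite p0 (dot0l ph (D0 ph)) => /esym/eqP; rewrite oner_eq0.
Qed.

(** Almost everywhere [|q| = |p|], by [J_mulJ], and [p] is nonzero. *)
Lemma quot_q_unimodular : {ae mu, forall t, normc (bd (quot q) (expi t)) = 1}.
Proof.
have a := J_mulJ Ep Ep; have b := quot_mul Eq.
have ab : {ae mu, forall t, bd p (expi t) * bd (quot q) (expi t) *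
    (bd p (expi t) * bd (quot q) (expi t))^*%C = bd p (expi t) * (bd p (expi t))^*%C}.
  by move: a b; apply: ae_imp2 => t <- <-.
move: ab p_ae_neq0; apply: ae_imp2 => t; rewrite !mulJ_normc => /complexI.
rewrite normcM exprMn => /eqP h p0; apply/eqP.
rewrite -(@eqrXn2 _ 2)// ?normc_ge0// expr1n.
move: h; rewrite -[X in _ == X]mulr1 => /eqP/mulfI -> //.
by rewrite expf_neq0// gt_eqF// normc_gt0.
Qed.

Lemma theta_unimodular : {ae mu, forall t, normc (theta (expi t)) = 1}.
Proof.
move: (bd_shiftS (h2_quot Eq)) quot_q_unimodular; apply: ae_imp2 => t -> h.
by rewrite normcM normc_expiXz mul1r.
Qed.

(** Divide [J f (J p)^* = p f^* ] by [|p|^2], and recall that [quot q] is unimodular. *)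
Lemma quot_J f : E f ->
  aeT (bd (quot (J f))) (fun z => bd (quot q) z * (bd (quot f) z)^*%C).
Proof.
move=> Ef; have a := J_mulJ Ef Ep.
have h1 := ae_and (quot_mul (EJ Ef)) (ae_and (quot_mul Eq) (quot_mul Ef)).
have h2 := ae_and a (ae_and p_ae_neq0 quot_q_unimodular).
move: h1 h2; apply: ae_imp2 => t [h1 [h2 h3]] [h4 [h5 h6]].
exact: unimodular_quotient h1 h2 h3 h4 h5 h6.
Qed.

Local Notation inK c := (model_space theta (bd c)).

Lemma mT_theta_pair (f g : C -> C) : mT f -> mT g ->
  mT (fun z => f z * (theta z * g z)^*%C).
Proof.
by move=> mf mg; apply: mTM => //; apply: mTJ; apply: mTM => //; exact: H2_mT (bd_H2 hth).
Qed.

(** [theta (quot f)^* ] is [z quot (J f)] almost everywhere; so the inner product of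
    [quot f] with [theta h] is the conjugate of a coefficient of index [-1] of an
    analytic product. *)
Lemma quot_model f : E f -> inK (quot f).
Proof.
move=> Ef; have Hf := bd_H2 (h2_quot Ef); split=> // h hh.
have HA := bd_H2 (h2_quot (EJ Ef)); have Lz := L1T_Xz_mul 1 (L2M (H2_L2 HA) (H2_L2 hh)).
transitivity (intT (fun z => (z ^ 1 * (bd (quot (J f)) z * h z))^*%C)); last first.
  rewrite (intTJ Lz); have -> : intT (fun z => z ^ 1 * (bd (quot (J f)) z * h z)) =
      fourier (fun z => bd (quot (J f)) z * h z) (-1).
    by apply: eq_intT => t; rewrite opprK mulrC.
  by rewrite (fourier_mul_neg HA hh)// rmorph0.
apply: ae_intT.
- by apply: mT_theta_pair; exact: H2_mT.
- exact: mTJ Lz.1.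
move: (quot_J Ef) (bd_shiftS (h2_quot Eq)); apply: ae_imp2 => t -> ->.
move: (bd (quot q) _) (bd (quot f) _) (h _) (_ ^ 1) => A B D Z.
by rewrite !rmorphM/= conjcK; ring.
Qed.

Definition theta_mul d := coef (fun z => theta z * bd d z).

Lemma theta_mulP d : h2 d -> H2 (fun z => theta z * bd d z).
Proof.
move=> hd'; have Hd := bd_H2 hd'; have Ht := bd_H2 hth; apply: H2M => //.
have [] // := @L2_ae_le _ (fun z => theta z * bd d z) (bd d) _ (H2_L2 Hd) _.
  by apply: mTM; exact: H2_mT.
by move: theta_unimodular; apply: ae_imp => t h; rewrite normcM h mul1r.
Qed.

Lemma inK_dot c : h2 c -> inK c <-> (forall d, h2 d -> dotS c (theta_mul d) = 0).
Proof.
move=> hc; have Hc := bd_H2 hc.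
have dE d : h2 d -> dotS c (theta_mul d) = dotT (bd c) (fun z => theta z * bd d z).
  move=> hd'; have Ht := theta_mulP hd'.
  by rewrite -{1}(coef_bd hc) dotS_coef.
split=> [[_ h] d hd'|h]; first by rewrite dE// h//; exact: bd_H2.
split=> // g hg; have hcg := h2_coef hg; rewrite -[RHS](h _ hcg) (dE _ hcg).
apply: ae_intT.
- by apply: mT_theta_pair; exact: H2_mT.
- by apply: mT_theta_pair; [exact: H2_mT|exact: H2_mT (bd_H2 hcg)].
by move: (bd_coef hg); apply: ae_imp => t ->.
Qed.

(** The model space is the orthogonal complement of a shift invariant subspace. *)
Lemma inK_bshift c : h2 c -> inK c -> inK (bshift c).
Proof.
move=> hc cK; apply/(inK_dot (h2_bshift hc)) => d hd'.
have Hd := theta_mulP hd'; have hs := h2_shiftS hd'.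
have <- : dotS c (theta_mul (shiftS d)) = 0 by apply: (inK_dot hc).1.
have -> : theta_mul (shiftS d) = shiftS (theta_mul d).
  rewrite /theta_mul -(coef_Xmul Hd); apply: ae_coef.
  - exact: H2_mT (theta_mulP hs).
  - exact: H2_mT (H2_Xn_mul 1 Hd).
  by move: (bd_shiftS hd'); apply: ae_imp => t ->; rewrite mulrCA.
have ht : h2 (theta_mul d) := h2_coef Hd.
by rewrite (dotC ph (h2_shiftS ht) hc) (dot_shiftSr ht hc) -(dotC ph ht (h2_bshift hc)).
Qed.

Lemma inK_dot_theta c : h2 c -> inK c -> dotS c theta_seq = 0.
Proof.
move=> hc cK; rewrite -[RHS]((inK_dot hc).1 cK _ (hd 0)); congr dotS.
rewrite -[LHS](coef_bd hth); apply: ae_coef.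
- exact: H2_mT (bd_H2 hth).
- exact: H2_mT (theta_mulP (hd 0)).
by move: (@bd_delta R 0); apply: ae_imp => t ->; rewrite expr0z mulr1.
Qed.

(** The vectors of [E] that represent the coefficients of [quot], by [dot_coefvec];
    their quotients are the projections of the monomials on the model space, by
    [dot_quot_coefvec]. *)
Definition coefvec n := iter n fstep p.

Lemma E_coefvec n : E (coefvec n).
Proof. by elim: n => //= n; exact: E_fstep. Qed.

Lemma dot_coefvec f n : E f -> dotS f (coefvec n) = quot f n.
Proof.
elim: n f => // n IH f Ef.
by rewrite [coefvec _]/(fstep (coefvec n)) -(bstep_adj Ef (E_coefvec n)) (IH _ (E_bstep Ef)) quot_bstep.
Qed.

Lemma dot_quot_coefvec c n : h2 c -> inK c -> dotS c (quot (coefvec n)) = c n.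
Proof.
elim: n c => [|n IH] c hc cK; first by rewrite /coefvec/= quot_p dot_delta.
have hv := h2_quot (E_coefvec n).
rewrite [coefvec _]/(fstep (coefvec n)) (quot_fstep (E_coefvec n)).
rewrite (dotBr ph (h2_shiftS hv) (h2Z _ hth) hc) (dotZr ph _ hth hc) (inK_dot_theta hc cK).
rewrite mulr0 subr0 (dotC ph (h2_shiftS hv) hc) (dot_shiftSr hv hc).
by rewrite -(dotC ph hv (h2_bshift hc)) (IH _ (h2_bshift hc) (inK_bshift hc cK)).
Qed.

Lemma E_psum a n : E (psum coefvec a n).
Proof.
elim: n => [|n IH]; rewrite /psum ?big_ord0 ?big_ord_recr; first exact: E0.
by apply: ED => //; apply: EZ; exact: E_coefvec.
Qed.

(** This identity gives both the norm bound that makes the series of [quot_onto]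
    converge and the quotient of its sum. *)
Lemma dot_psum_coefvec a n f : E f -> dotS (psum coefvec a n) f = dotS (trunc a n) (quot f).
Proof.
move=> Ef; have hf := E_h2 Ef; have hqf := h2_quot Ef; rewrite /trunc /psum.
rewrite (dot_suml ph (F := fun k => a k *: coefvec k) (n := n) (fun k _ => h2Z (a k) (E_h2 (E_coefvec k))) hf).
rewrite (dot_suml ph (F := fun k => a k *: delta k) (n := n) (fun k _ => h2Z (a k) (hd k)) hqf).
apply: eq_bigr => k _; have hv := E_h2 (E_coefvec k).
rewrite (dotZl ph _ hv hf) (dotZl ph _ (hd k) hqf); congr (_ * _).
by rewrite (dotC ph hf hv) (dot_coefvec k Ef) (dotC ph hqf (hd k)) (dot_delta k hqf).
Qed.

(** For [x = psum coefvec a n], [|x|^2 = Re <trunc a n, quot x>] is at most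
    [|trunc a n| |x|]. *)
Lemma nrm_psum_coefvec a n : nrm (psum coefvec a n) <= nrm (trunc a n).
Proof.
have Ex := E_psum a n; set x := psum coefvec a n; have hx := E_h2 Ex.
have ht := h2_trunc a n; have [hqx qx] := quotP Ex.
have qn : nrm (quot x) <= nrm x by rewrite ler_sqrt// (sqn_ge0 ph hx).
have s1 : sqn x <= nrm (trunc a n) * nrm (quot x).
  rewrite /sqn (dot_psum_coefvec a n Ex).
  exact: le_trans (ler_Re_normc _) (cauchy_schwarz ph ht hqx).
have s2 : sqn x <= nrm (trunc a n) * nrm x.
  exact: le_trans s1 (ler_wpM2l (nrm_ge0 _) qn).
move: s2; rewrite -(sqr_nrm ph hx) expr2.
have [->|x0] := eqVneq (nrm x) 0; first by rewrite nrm_ge0.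
by rewrite ler_pM2r// lt_def x0 nrm_ge0.
Qed.

Lemma psum_restrict (e : nat -> seqC) a k n : (k <= n)%N ->
  psum e (fun j => if (j < k)%N then 0 else a j) n = psum e a n - psum e a k.
Proof.
move=> /subnKC <-; elim: (n - k)%N => [|j IH].
  rewrite addn0 subrr /psum big1// => i _; by rewrite ltn_ord scale0r.
have psumS b i : psum e b i.+1 = psum e b i + b i *: e i by rewrite /psum big_ord_recr.
by rewrite addnS !psumS IH ltnNge leq_addr/= addrAC.
Qed.

(** The series [sum_n c_n coefvec n] converges, because its partial sums are dominated
    in norm by those of [c]. Its sum [x] has quotient [c] and norm at most [|c|]; the
    converse inequality is [quotP]. *)
Lemma quot_onto c : h2 c -> inK c -> exists2 x, E x & quot x = c /\ nrm x = nrm c.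
Proof.
move=> hc cK; pose x n := psum coefvec c n; have Ex n : E (x n) := E_psum c n.
have hx n := E_h2 (Ex n); have ht n := h2_trunc c n.
have tc := trunc_tends hc.
have cau : cauchy_nrm (dot := dotS) x.
  have half k n : (k <= n)%N -> nrm (x n - x k) <= nrm (trunc c n - trunc c k).
    by move=> kn; rewrite /x /trunc -!psum_restrict//; exact: nrm_psum_coefvec.
  move=> e e0; have [N hN] := tends_cauchy ph ht hc tc e0; exists N => k n Nk Nn.
  case/orP: (leq_total n k) => kn; first exact: le_lt_trans (half _ _ kn) (hN _ _ Nk Nn).
  rewrite (nrmBC ph (hx k) (hx n)); exact: le_lt_trans (half _ _ kn) (hN _ _ Nn Nk).
have [y hy xy] := h2_complete hx cau.
have Ey := E_closed Ex hy xy.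
have qy : quot y = c.
  apply/funext => n; have hv := h2_quot (E_coefvec n); rewrite -(dot_coefvec n Ey).
  apply: (tends_dot ph hx hy (E_h2 (E_coefvec n)) xy (fun N => dot_psum_coefvec c N (E_coefvec n))).
  have c0 (M : R) (v : R^nat) : v @ \oo --> 0 -> (fun N => v N * M) @ \oo --> 0.
    by move=> v0; rewrite -[X in _ --> X](mul0r M); apply: cvgMr_tmp.
  apply: (squeeze_cvgr _ (cvg_cst 0) (c0 (nrm (quot (coefvec n))) _ tc)); apply: nearW => N.
  rewrite normc_ge0 /= -(dot_quot_coefvec n hc cK) -(dotBl ph (ht N) hc hv).
  exact: (cauchy_schwarz ph (DB ph (ht N) hc) hv).
exists y => //; split=> //; apply/eqP; rewrite eq_le; apply/andP; split.
  apply: (tends_nrm_le ph hx hy xy) => n; apply: (le_trans (nrm_psum_coefvec c n)).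
  rewrite ler_sqrt ?(sqn_ge0 ph hc)// (sqn_psum ph hd (@delta_orth R)).
  have := bessel ph hd (@delta_orth R) n hc; apply: le_trans.
  by under [X in _ <= X]eq_bigr do rewrite (dot_delta _ hc).
rewrite -qy ler_sqrt ?(sqn_ge0 ph hy)//; exact: (quotP Ey).2.
Qed.

Lemma schmidt_model_of_extremal : exists P th : C -> C,
  [/\ H2 P, H2 th, {ae mu, forall t, normc (th (expi t)) = 1},
    forall f, E f -> exists2 k, model_space th k & aeT (bd f) (fun z => P z * k z) &
    forall k, model_space th k -> exists f k', [/\ E f /\ nrm f = normT k, H2 k',
      aeT (bd f) (fun z => P z * k z), aeT k' (conj_theta th k) &
      aeT (bd (J f)) (fun z => P z * k' z)]].
Proof.
exists (bd p), theta; split; [exact: bd_H2|exact: bd_H2|exact: theta_unimodular| |].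
  by move=> f Ef; exists (bd (quot f)); [exact: quot_model|exact: quot_mul].
move=> k [Hk kK]; have hc := h2_coef Hk; have kc := bd_coef Hk.
have cK : inK (coef k).
  split; first exact: bd_H2.
  move=> h hh; rewrite -[RHS](kK h hh); apply: ae_intT.
  - by apply: mT_theta_pair; [exact: H2_mT (bd_H2 hc)|exact: H2_mT].
  - by apply: mT_theta_pair; exact: H2_mT.
  by move: kc; apply: ae_imp => t ->.
have [f Ef [qf nf]] := quot_onto hc cK.
exists f, (bd (quot (J f))); split.
- by split=> //; rewrite nf nrm_coef.
- exact: bd_H2 (h2_quot (EJ Ef)).
- by move: (quot_mul Ef) kc; rewrite qf; apply: ae_imp2 => t -> ->.
- have := quot_J Ef; rewrite qf => qJ.
  have h1 := ae_and qJ (ae_and kc (bd_shiftS (h2_quot Eq))).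
  move: h1; apply: ae_imp => t [-> [-> h]]; rewrite /conj_theta h.
  by rewrite expr1z mulrA [_^*%C * _]mulrC expi_mulJ mul1r.
- exact: quot_mul (EJ Ef).
Qed.

End Extremal.

Lemma schmidt_model : exists P th : C -> C,
  [/\ H2 P, H2 th, {ae (@lebesgue_measure R), forall t, normc (th (expi t)) = 1},
    forall f, E f -> exists2 k, model_space th k & aeT (bd f) (fun z => P z * k z) &
    forall k, model_space th k -> exists f k', [/\ E f /\ nrm f = normT k, H2 k',
      aeT (bd f) (fun z => P z * k z), aeT k' (conj_theta th k) &
      aeT (bd (J f)) (fun z => P z * k' z)]].
Proof.
have [p [r [Ep pp r0 pm]]] := extremal_exists.
exact: (schmidt_model_of_extremal Ep pp r0 pm).
Qed.
End LowestIndex.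

(** The results on division apply to the least index [m] at which some element of the
    Schmidt space has a nonzero coefficient. *)
Lemma schmidt_structure : (exists2 e, E e & e != 0) -> exists P th : C -> C,
  [/\ H2 P, H2 th, {ae (@lebesgue_measure R), forall t, normc (th (expi t)) = 1},
    forall f, E f -> exists2 k, model_space th k & aeT (bd f) (fun z => P z * k z) &
    forall k, model_space th k -> exists f k', [/\ E f /\ nrm f = normT k, H2 k',
      aeT (bd f) (fun z => P z * k z), aeT k' (conj_theta th k) &
      aeT (bd (J f)) (fun z => P z * k' z)]].
Proof.
move=> [e Ee e0].
have ex : exists m, `[< exists2 e, E e & e m != 0 >].
  apply/not_existsP => h; move/eqP: e0; apply; apply/funext => n.
  apply/eqP/negPn/negP => en; apply: (h n); apply/asboolP; by exists e.
case: (ex_minnP ex) => m /asboolP Em hm; apply: (schmidt_model _ Em) => f k Ef km.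
apply/eqP/negPn/negP => fk; have : (m <= k)%N by apply: hm; apply/asboolP; exists f.
by rewrite leqNgt km.
Qed.

End SchmidtSpace.

(** * The eigenspaces of the Hankel operator *)
Section EigenKernels.
Context {R : realType}.
Local Notation C := R[i].
Local Notation seqC := (nat -> C^o).
Implicit Types (f g h u : C -> C).
Variables (G : @operator R) (s : R).
Hypothesis bG : bounded_operator G.
Hypothesis ah : antihankel (seq_op G).
Hypothesis adjP : forall g, H2 g ->
  H2 (adjoint G g) /\ coef (adjoint G g) = conjS (seq_op G (coef g)).
Local Notation H := (seq_op G).
Local Notation c2 := (((s ^+ 2)%:C)%C).

Let GH f : H2 f -> H2 (G f). Proof. by case: bG => h _ _; exact: h. Qed.

(** On coefficients [G (adjoint G)] is the square of the antilinear operator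
    [seq_op G]. *)
Lemma eigenker_left f :
  eigenker (G \o adjoint G) c2 f <-> H2 f /\ schmidt H s (coef f).
Proof.
have E g : H2 g -> coef (G (adjoint G g)) = H (H (coef g)).
  by move=> hg; have [h1 h2] := adjP hg; rewrite (coef_bop bG h1) h2 conjSK.
split=> -[hf fE]; split=> //.
  split; first exact: h2_coef.
  rewrite -E// -coefZ; last exact: H2_L1.
  apply: ae_coef => //; apply: H2_mT; [exact: GH (adjP hf).1|exact: H2Z].
apply: coef_inj; [exact: GH (adjP hf).1|exact: H2Z|].
by rewrite coefZ ?E ?fE.2//; exact: H2_L1.
Qed.

(** [invC] conjugates one product into the other. *)
Lemma eigenker_right f :
  eigenker (adjoint G \o G) c2 f <-> eigenker (G \o adjoint G) c2 (invC f).
Proof.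
have E g : H2 g -> coef (adjoint G (G g)) = conjS (H (H (conjS (coef g)))).
  by move=> hg; have [h1 ->] := adjP (GH hg); rewrite (coef_bop bG hg).
have conjZ (c : seqC) : conjS (c2 *: c) = c2 *: conjS c.
  by apply/funext => n; rewrite /conjS rmorphM [X in X * _]conjc_real.
rewrite eigenker_left; split=> -[hf fE].
  have hi := H2_invC hf; split=> //; split; first exact: h2_coef.
  rewrite (coef_invC hf) -conjZ -coefZ; last exact: H2_L1.
  rewrite -[LHS]conjSK -E//; congr conjS; apply: ae_coef => //.
    by apply: H2_mT (adjP (GH hf)).1.
  by apply: H2_mT; exact: H2Z.
have hf' : H2 f by rewrite -(invCK f); exact: H2_invC.
split=> //; apply: coef_inj; [exact: (adjP (GH hf')).1|exact: H2Z|].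
rewrite coefZ; last exact: H2_L1.
by rewrite E// -(coef_invC hf') fE.2 conjZ (coef_invC hf') conjSK.
Qed.

End EigenKernels.

Theorem theorem1p3 (R : realType) (u : R[i] -> R[i]) (s : R) :
  BMOA u -> singular_value (hankel u) s ->
  exists theta p : R[i] -> R[i],
    [/\ inner theta,
        isometric_multiplier p (model_space theta),
        eigenker (adjoint (hankel u) \o hankel u) ((s ^+ 2)%:C)%C
          = invC @` mul_space p (model_space theta),
        eigenker (hankel u \o adjoint (hankel u)) ((s ^+ 2)%:C)%C
          = mul_space p (model_space theta) &
        forall f g, model_space theta f -> is_product p f g ->
          exists2 h, is_product p (conj_theta theta f) h
                   & aeT (hankel u (invC g)) (fun z => (s%:C)%C * h z)].
Proof.
move=> [hu _] sv; have u2 := H2_L2 hu.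
have [bG hG] := hankelP u2 sv; have M := hankel_matrix u2 (conj bG hG).
case: sv => s0 [f0 f0E f0_neq0].
pose v (n : nat) := fourier u n%:Z.
have ah := @seq_op_antihankel _ _ bG v M; have adjP := @coef_adjoint _ _ bG v M.
have left_ker := eigenker_left s bG adjP; have right_ker := eigenker_right s bG adjP.
move: bG {hG M} ah adjP left_ker right_ker f0E.
set G := hankel u => bG ah adjP left_ker right_ker f0E.
have [hi Ei] := (left_ker _).1 ((right_ker _).1 f0E).
have nz : exists2 e, schmidt (seq_op G) s e & e != 0.
  exists (coef (invC f0)) => //; apply/eqP => c0; apply: f0_neq0.
  have hf0 : H2 f0 by case: f0E.
  have c0' : coef f0 = coef (cst 0 : R[i] -> R[i]).
    rewrite -(conjSK (coef f0)) -(coef_invC hf0) c0.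
    apply/funext => n; rewrite /conjS -[in LHS]/(0 : R[i]) rmorph0.
    by rewrite /coef fourierE (dot0l (@L2_prehilbert R) (L2_Xz n)).
  exact: coef_inj hf0 (H2_cst 0) c0'.
have [P [th [HP Hth th1 Kp pK]]] := schmidt_structure ah s0 nz.
have prodP k g : model_space th k -> is_product (ext P) k g <-> H2 g /\ aeT g (fun z => P z * k z).
  by move=> Kk; exact: (is_productP g HP Kk.1).
have coef_eq e g k : h2 e -> H2 g -> aeT (bd e) (fun z => P z * k z) ->
    aeT g (fun z => P z * k z) -> coef g = e.
  move=> he hg e1 e2; rewrite -(coef_bd he); apply: ae_coef; [exact: H2_mT|exact: H2_mT (bd_H2 he)|].
  exact: aeT_trans e2 (aeT_sym e1).
have left_image : eigenker (G \o adjoint G) ((s ^+ 2)%:C)%C = mul_space (ext P) (model_space th).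
  apply/seteqP; split=> [g /left_ker[hg Eg]|g [k Kk /(prodP _ _ Kk)[hg gE]]].
    have [k Kk ke] := Kp _ Eg; exists k => //; apply/(prodP _ _ Kk); split=> //.
    exact: aeT_trans (aeT_sym (bd_coef hg)) ke.
  have [e [k' [[Ee _] _ ek _ _]]] := pK _ Kk.
  by apply/left_ker; split=> //; rewrite (coef_eq _ _ _ Ee.1 hg ek gE).
exists th, (ext P); split.
- exact: inner_of_unimodular.
- split; first exact: analytic_ext.
  move=> k Kk; have [e [k' [[Ee en] _ ek _ _]]] := pK _ Kk.
  have hb := bd_H2 Ee.1; exists (bd e); first by apply/(prodP _ _ Kk).
  by rewrite -en -(nrm_coef hb) (coef_bd Ee.1).
- rewrite -left_image; apply/seteqP; split=> [f /right_ker fE|_ [g gE <-]].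
    by exists (invC f); rewrite ?invCK.
  by apply/right_ker; rewrite invCK.
- exact: left_image.
move=> k g Kk /(prodP _ _ Kk)[hg gE].
have [e [k' [[Ee _] Hk' ek k'E Je]]] := pK _ Kk.
have ce := coef_eq _ _ _ Ee.1 hg ek gE.
have hJ := J_h2 s ah Ee.1.
have mc : mT (conj_theta th k).
  by apply: mTM; [apply: mTM; [exact: mTJ mT_id|exact: H2_mT]|apply: mTJ; exact: H2_mT Kk.1].
have Hc : H2 (conj_theta th k).
  apply: (H2_ae _ k'E Hk'); apply: (L2_ae_le mc (H2_L2 Hk') _).1.
  by move: k'E; apply: ae_imp => t ->.
exists (bd (invol (seq_op G) s e)).
  apply/(is_productP _ HP Hc); split; first exact: bd_H2.
  by move: Je k'E; apply: ae_imp2 => t -> ->.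
have hig := H2_invC hg; have HG : H2 (G (invC g)) by case: bG => h _ _; exact: h.
apply: coef_inj => //; first exact: H2Z (bd_H2 hJ).
rewrite (coefZ _ (H2_L1 (bd_H2 hJ))) (coef_bd hJ) (coef_bop bG hig) (coef_invC hg) conjSK ce.
exact: (sJ (seq_op G) s0).
Qed.
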